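(* Let $\Lambda\subseteq[0,\infty)$ be an additive semigroup with $0\in\Lambda$, $f$ a holomorphic function on a region $G\subseteq\mathbb C$, and $w$ an admissible weight function on $\Lambda$. If $a\in\mathscr A_w(\Lambda)$ satisfies $\overline{\widetilde a(\mathbb H)}\subseteq G$, then there exists $c\in\mathscr A_w(\Lambda)$ with $f\circ\widetilde a=\widetilde c$ on $\overline{\mathbb H}$.
   Context: $\mathbb H=\{\operatorname{Re}s>0\}$. A weight function is $w\colon\Lambda\to(0,\infty)$, $w(0)=1$, $w(\lambda+\lambda')\le w(\lambda)w(\lambda')$; admissible: $w\ge1$ and $\lim_k w(k\lambda)^{1/k}=1$ for all $\lambda$. $\mathscr A_w(\Lambda)$: $a\colon\Lambda\to\mathbb C$ with $\sum_\lambda|a(\lambda)|w(\lambda)<\infty$, convolution $(a*b)(\lambda)=\sum_{\lambda'+\lambda''=\lambda}a(\lambda')b(\lambda'')$. $\widetilde a(s)=\sum_\lambda a(\lambda)e^{-\lambda s}$ for $s\in\overline{\mathbb H}$. *)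

(* Defs.v *)
From Stdlib Require Import Reals Lra List.
Open Scope R_scope.

Definition Cx : Type := (R * R)%type.
Definition Cre (z : Cx) : R := fst z.
Definition Cim (z : Cx) : R := snd z.
Definition C0 : Cx := (0, 0).
Definition Cadd (z w : Cx) : Cx := (fst z + fst w, snd z + snd w).
Definition Copp (z : Cx) : Cx := (- fst z, - snd z).
Definition Csub (z w : Cx) : Cx := Cadd z (Copp w).
Definition Cmul (z w : Cx) : Cx :=
  (fst z * fst w - snd z * snd w, fst z * snd w + snd z * fst w).
Definition RtoC (x : R) : Cx := (x, 0).
Definition Cnorm (z : Cx) : R := sqrt (fst z ^ 2 + snd z ^ 2).
Definition Cexp (z : Cx) : Cx := (exp (fst z) * cos (snd z), exp (fst z) * sin (snd z)).

Definition Copen (U : Cx -> Prop) : Prop :=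
  forall z, U z -> exists r, 0 < r /\ forall y, Cnorm (Csub y z) < r -> U y.

Definition Cregion (G : Cx -> Prop) : Prop :=
  Copen G /\ (exists z, G z) /\
  forall U V : Cx -> Prop, Copen U -> Copen V ->
    (forall z, G z -> U z \/ V z) ->
    (exists z, G z /\ U z) -> (exists z, G z /\ V z) ->
    exists z, G z /\ U z /\ V z.

Definition Cderiv_at (f : Cx -> Cx) (z d : Cx) : Prop :=
  forall eps, 0 < eps -> exists delta, 0 < delta /\
    forall h, Cnorm h < delta ->
      Cnorm (Csub (Csub (f (Cadd z h)) (f z)) (Cmul d h)) <= eps * Cnorm h.

Definition holomorphic_on (G : Cx -> Prop) (f : Cx -> Cx) : Prop :=
  forall z, G z -> exists d, Cderiv_at f z d.

Definition add_semigroup0 (Lam : R -> Prop) : Prop :=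
  (forall x, Lam x -> 0 <= x) /\ Lam 0 /\ (forall x y, Lam x -> Lam y -> Lam (x + y)).

Definition weight (Lam : R -> Prop) (w : R -> R) : Prop :=
  (forall l, Lam l -> 0 < w l) /\ w 0 = 1 /\
  (forall l l', Lam l -> Lam l' -> w (l + l') <= w l * w l').

Definition admissible (Lam : R -> Prop) (w : R -> R) : Prop :=
  weight Lam w /\ (forall l, Lam l -> 1 <= w l) /\
  (forall l, Lam l ->
     Un_cv (fun k => Rpower (w (INR (S k) * l)) (/ INR (S k))) 1).

Definition finsub (Lam : R -> Prop) (l : list R) : Prop := NoDup l /\ Forall Lam l.

Definition Rsum_list (f : R -> R) (l : list R) : R := fold_right (fun x acc => f x + acc) 0 l.
Definition Csum_list (f : R -> Cx) (l : list R) : Cx := fold_right (fun x acc => Cadd (f x) acc) C0 l.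

(** summability of a nonnegative family over Lambda *)
Definition Rsummable (Lam : R -> Prop) (f : R -> R) : Prop :=
  exists M, forall l, finsub Lam l -> Rsum_list f l <= M.

Definition Chas_sum (Lam : R -> Prop) (f : R -> Cx) (S : Cx) : Prop :=
  forall eps, 0 < eps -> exists l0, finsub Lam l0 /\
    forall l, finsub Lam l -> incl l0 l -> Cnorm (Csub (Csum_list f l) S) < eps.

(** A_w(Lambda): a : Lambda -> C (values off Lambda irrelevant) with sum |a| w < oo *)
Definition in_Aw (Lam : R -> Prop) (w : R -> R) (a : R -> Cx) : Prop :=
  Rsummable Lam (fun l => Cnorm (a l) * w l).

Definition tilde_is (Lam : R -> Prop) (a : R -> Cx) (s z : Cx) : Prop :=
  Chas_sum Lam (fun l => Cmul (a l) (Cexp (Cmul (RtoC (- l)) s))) z.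

Definition in_closure_tilde_H (Lam : R -> Prop) (a : R -> Cx) (z : Cx) : Prop :=
  forall eps, 0 < eps -> exists s y, 0 < Cre s /\ tilde_is Lam a s y /\ Cnorm (Csub y z) < eps.

(* Main.v *)
(** Near a finite partial sum P of the series of a, Taylor's formula expands f(P + R) as the sum of
    f^(n)(P)/n! R^n with R of small norm, so everything reduces to bounding the norm of phi(P) for phi
    holomorphic near the closure of the image.  If phi(P) is already known to have an absolutely
    convergent expansion, its coefficients are Bohr means; P being a finite sum, phi(P) is bounded by some
    M on a slightly larger half-plane Re s > -d, and shifting the line of integration bounds the
    coefficient at x by M e^(-sigma x).  As w grows subexponentially on the finitely generated semigroup of
    the exponents of P, this gives a norm bound A M with A depending on neither phi nor the length of the
    expansion.  That phi(P) does have an expansion follows by continuity from P(s + x) with x large, where P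
    is nearly constant: the uniform bound lets the same Taylor argument descend to x = 0 in finitely many
    equal steps.  Goursat's theorem for rectangles is the only tool from
    complex analysis; composed with the exponential it also yields the Cauchy estimates. *)

Require Import Defs.
From Stdlib Require Import Reals Lra Lia List Factorial Permutation Classical ClassicalEpsilon.
From Coquelicot Require Import Coquelicot.
Open Scope R_scope.

(** The constant [A] must not depend on [phi] because the bound is applied to all Taylor
    coefficients f^(n)/n! at once: on the r/4-neighbourhood of the closed image they are at most B
    (48/r)^n, a remainder of norm r/96 turns this into A B 2^(-n), and the series converges. Mere
    finiteness for each n would give nothing. Such an [A] is available only for the finite part P:
    it needs values to the left of the imaginary axis, where the full series may diverge, and it
    needs the sum of w(x) e^(-sigma x) over all exponents to be finite, which can fail on Lambda but
    holds on a finitely generated subsemigroup. Hence P and the remainder play different roles: P is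
    composed with, the remainder only multiplies. The size of the remainder is therefore encoded by
    its action ([multiplier]), and no convolution of two infinite series is ever formed. The closed
    image is compact, so one radius r serves throughout; it is spent as r/8 for P on the extended
    half-plane, r/4 for the centres of the Taylor expansions, and r/2 for the bound that feeds the
    Cauchy estimates. *)

(** * Calculus of the complex derivative *)

Definition cderiv (f : C -> C) (z d : C) : Prop := Cderiv_at f z d.

(** Holds by conversion: the operations on pairs used in the statement unfold to those of
    Coquelicot's [C], so from here on library notation and [ring] are available. *)
Lemma cderivE (f : C -> C) (z d : C) :
  cderiv f z d <-> forall eps, 0 < eps -> exists de, 0 < de /\
    forall h : C, Cmod h < de -> Cmod ((f (z + h) - f z) - d * h)%C <= eps * Cmod h.
Proof. apply iff_refl. Qed.

(** Bridge through which the rules for sums, products and compositions are borrowed from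
    Coquelicot. *)
Lemma cderiv_is_derive (f : C -> C) (z d : C) :
  cderiv f z d <->
  is_derive (K := C_AbsRing) (V := AbsRing_NormedModule C_AbsRing) f z d.
Proof.
  rewrite cderivE. split.
  - intros H; split; [apply is_linear_scal_l|].
    intros x Hx.
    assert (Hxz : z = x) by (apply (is_filter_lim_locally_unique (K := C_AbsRing) (V := AbsRing_NormedModule C_AbsRing)); exact Hx).
    subst x. intros eps.
    destruct (H eps (cond_pos eps)) as [de [Hde H2]].
    exists (mkposreal de Hde).
    assert (K : forall y : C, Cmod (y - z)%C < de -> Cmod ((f y - f z) - (y - z) * d)%C <= eps * Cmod (y - z)%C).
    { intros y Hy. specialize (H2 (y - z)%C Hy).
      replace (z + (y - z))%C with y in H2 by ring.
      replace ((y - z) * d)%C with (d * (y - z))%C by ring. exact H2. }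
    intros y Hy. exact (K y Hy).
  - intros [_ H] eps Heps.
    destruct (H z (fun P HP => HP) (mkposreal eps Heps)) as [de Hde].
    exists de; split; [apply cond_pos|]. intros h Hh.
    specialize (Hde (z + h)%C).
    change (Cmod ((z + h) - z)%C < de ->
       Cmod ((f (z + h) - f z) - (z + h - z) * d)%C <= eps * Cmod (z + h - z)%C) in Hde.
    replace (z + h - z)%C with h in Hde by ring.
    replace (d * h)%C with (h * d)%C by ring. apply Hde, Hh.
Qed.

Lemma cderiv_const (c z : C) : cderiv (fun _ => c) z 0%C.
Proof. apply cderiv_is_derive. apply (is_derive_const (K:=C_AbsRing) (V:=AbsRing_NormedModule C_AbsRing)). Qed.

Lemma cderiv_id (z : C) : cderiv (fun u => u) z 1%C.
Proof. apply cderiv_is_derive. apply (is_derive_id (K:=C_AbsRing)). Qed.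

Lemma cderiv_plus (f g : C -> C) (z d e : C) :
  cderiv f z d -> cderiv g z e -> cderiv (fun u => f u + g u)%C z (d + e)%C.
Proof.
  rewrite !cderiv_is_derive. intros H1 H2.
  apply (is_derive_plus (K:=C_AbsRing) (V:=AbsRing_NormedModule C_AbsRing) f g z d e H1 H2).
Qed.

Lemma cderiv_mult (f g : C -> C) (z d e : C) :
  cderiv f z d -> cderiv g z e ->
  cderiv (fun u => f u * g u)%C z (d * g z + f z * e)%C.
Proof.
  rewrite !cderiv_is_derive. intros H1 H2.
  apply (is_derive_mult (K:=C_AbsRing) f g z d e H1 H2 Cmult_comm).
Qed.

Lemma cderiv_comp (f g : C -> C) (z d e : C) :
  cderiv f (g z) d -> cderiv g z e -> cderiv (fun u => f (g u)) z (e * d)%C.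
Proof.
  rewrite !cderiv_is_derive. intros H1 H2.
  apply (is_derive_comp (K:=C_AbsRing) (V:=AbsRing_NormedModule C_AbsRing) f g z d e H1 H2).
Qed.

Lemma cderiv_ext_loc (f g : C -> C) (z d : C) (r : R) :
  0 < r -> (forall u, Cmod (u - z)%C < r -> f u = g u) -> cderiv f z d -> cderiv g z d.
Proof.
  rewrite !cderivE. intros Hr He H eps Heps. destruct (H eps Heps) as [de [Hde H1]].
  exists (Rmin de r); split; [apply Rmin_pos; lra|]. intros h Hh.
  assert (E1 : Cmod h < de) by (eapply Rlt_le_trans; [exact Hh|apply Rmin_l]).
  assert (E2 : Cmod h < r) by (eapply Rlt_le_trans; [exact Hh|apply Rmin_r]).
  specialize (H1 h E1).
  rewrite <- !He. exact H1.
  - replace (z - z)%C with (RtoC 0) by ring. rewrite Cmod_0. lra.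
  - replace (z + h - z)%C with h by ring. exact E2.
Qed.

Lemma cderiv_eq (f : C -> C) (z d e : C) : cderiv f z d -> d = e -> cderiv f z e.
Proof. intros H <-. exact H. Qed.

Lemma cderiv_lin (c k z : C) : cderiv (fun u => c + k * u)%C z k.
Proof.
  refine (cderiv_eq _ _ _ _ (cderiv_plus (fun _ => c) (fun u => k * u)%C z _ _ (cderiv_const c z)
    (cderiv_mult (fun _ => k) (fun u => u) z _ _ (cderiv_const k z) (cderiv_id z))) _).
  ring.
Qed.

Lemma cderiv_opp (f : C -> C) (z d : C) : cderiv f z d -> cderiv (fun u => - f u)%C z (- d)%C.
Proof.
  intros H. apply (cderiv_eq _ _ (d * - (1))%C); [|ring].
  apply (cderiv_ext_loc (fun u => 0 + - (1) * f u)%C _ _ _ 1); [lra|intros; ring|].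
  apply (cderiv_comp (fun u => 0 + - (1) * u)%C f); [apply cderiv_lin|exact H].
Qed.

Definition ccts (f : C -> C) (z : C) : Prop :=
  forall eps, 0 < eps -> exists de, 0 < de /\ forall u, Cmod (u - z)%C < de -> Cmod (f u - f z)%C < eps.

Lemma cderiv_ccts (f : C -> C) (z d : C) : cderiv f z d -> ccts f z.
Proof.
  rewrite cderivE. intros H eps Heps. destruct (H 1 Rlt_0_1) as [de [Hde H1]].
  set (K := 1 + Cmod d + 1).
  assert (HK : 0 < K) by (unfold K; pose proof (Cmod_ge_0 d); lra).
  exists (Rmin de (eps / K)). split.
  - apply Rmin_pos; [lra|apply Rdiv_lt_0_compat; lra].
  - intros u Hu.
    assert (E1 : Cmod (u - z)%C < de) by (eapply Rlt_le_trans; [exact Hu|apply Rmin_l]).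
    assert (E2 : Cmod (u - z)%C < eps / K) by (eapply Rlt_le_trans; [exact Hu|apply Rmin_r]).
    specialize (H1 _ E1).
    replace (z + (u - z))%C with u in H1 by ring.
    replace (f u - f z)%C with (((f u - f z) - d * (u - z)) + d * (u - z))%C by ring.
    eapply Rle_lt_trans; [apply Cmod_triangle|]. rewrite Cmod_mult.
    assert (E3 : Cmod (u - z)%C * K < eps).
    { apply (Rmult_lt_compat_r K) in E2; [|lra]. unfold Rdiv in E2. rewrite Rmult_assoc, Rinv_l in E2; lra. }
    unfold K in E3. pose proof (Cmod_ge_0 (u-z)%C). nra.
Qed.

Lemma im_le_Cmod (c : C) : Rabs (snd c) <= Cmod c.
Proof. eapply Rle_trans; [apply Rmax_r|apply Rmax_Cmod]. Qed.

Lemma fst_le_Cmod (c : C) : Rabs (fst c) <= Cmod c.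
Proof. eapply Rle_trans; [apply Rmax_l|apply Rmax_Cmod]. Qed.

Lemma Cmod_le_sum (c : C) : Cmod c <= Rabs (fst c) + Rabs (snd c).
Proof.
  destruct c as [x y]; simpl.
  replace (x, y) with (RtoC x + Ci * RtoC y)%C by (apply injective_projections; simpl; ring).
  eapply Rle_trans; [apply Cmod_triangle|].
  rewrite Cmod_mult, Cmod_Ci, !Cmod_R. lra.
Qed.

(** * Integration of complex functions of a real variable *)

(** Componentwise, to match [cint], which is a pair of real Riemann integrals; [pcont_eps] converts
    to the metric form. *)
Definition pcont (g : R -> C) (t : R) : Prop :=
  continuous (fun u => fst (g u)) t /\ continuous (fun u => snd (g u)) t.

Lemma pcont_eps (g : R -> C) (t : R) :
  pcont g t <-> forall eps, 0 < eps -> exists de, 0 < de /\ forall u, Rabs (u - t) < de -> Cmod (g u - g t)%C < eps.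
Proof.
  split.
  - intros [H1 H2] eps Heps.
    assert (He : 0 < eps / 2) by lra.
    destruct (H1 (ball (fst (g t)) (mkposreal _ He)) (locally_ball _ _)) as [d1 D1].
    destruct (H2 (ball (snd (g t)) (mkposreal _ He)) (locally_ball _ _)) as [d2 D2].
    exists (Rmin d1 d2). split; [apply Rmin_pos; apply cond_pos|].
    intros u Hu.
    assert (E1 : Rabs (fst (g u) - fst (g t)) < eps / 2)
      by (apply D1; eapply Rlt_le_trans; [exact Hu|apply Rmin_l]).
    assert (E2 : Rabs (snd (g u) - snd (g t)) < eps / 2)
      by (apply D2; eapply Rlt_le_trans; [exact Hu|apply Rmin_r]).
    eapply Rle_lt_trans; [apply Cmod_le_sum|]. simpl. unfold Rminus in *. lra.
  - intros H; split; intros P [e HP];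
    destruct (H e (cond_pos e)) as [de [Hde H1]];
    exists (mkposreal de Hde); intros u Hu; apply HP; specialize (H1 u Hu);
    (eapply Rle_lt_trans; [|exact H1]).
    + apply (fst_le_Cmod (g u - g t)%C).
    + apply (im_le_Cmod (g u - g t)%C).
Qed.

Lemma pcont_comp (F : C -> C) (g : R -> C) (t : R) :
  ccts F (g t) -> pcont g t -> pcont (fun u => F (g u)) t.
Proof.
  intros HF Hg. rewrite pcont_eps in *. intros eps Heps.
  destruct (HF eps Heps) as [d [Hd H1]]. destruct (Hg d Hd) as [d' [Hd' H2]].
  exists d'; split; [exact Hd'|]. intros u Hu. apply H1, H2, Hu.
Qed.

Lemma pcont_const (c : C) (t : R) : pcont (fun _ => c) t.
Proof. split; apply continuous_const. Qed.

Lemma pcont_plus (f g : R -> C) (t : R) : pcont f t -> pcont g t -> pcont (fun u => f u + g u)%C t.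
Proof.
  intros [A1 A2] [B1 B2]. split.
  - apply (continuous_plus (V := R_NormedModule) _ _ t A1 B1).
  - apply (continuous_plus (V := R_NormedModule) _ _ t A2 B2).
Qed.

Lemma pcont_mult (f g : R -> C) (t : R) : pcont f t -> pcont g t -> pcont (fun u => f u * g u)%C t.
Proof.
  intros [A1 A2] [B1 B2]. split.
  - apply (continuous_minus (V := R_NormedModule) (fun u => fst (f u) * fst (g u)) (fun u => snd (f u) * snd (g u)));
    apply (continuous_mult (K := R_AbsRing)); assumption.
  - apply (continuous_plus (V := R_NormedModule) (fun u => fst (f u) * snd (g u)) (fun u => snd (f u) * fst (g u)));
    apply (continuous_mult (K := R_AbsRing)); assumption.
Qed.

Definition cint (g : R -> C) (a b : R) : C :=
  (RInt (fun t => fst (g t)) a b, RInt (fun t => snd (g t)) a b).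

Definition seg_cont (g : R -> C) (a b : R) : Prop := forall t, a <= t <= b -> pcont g t.

Lemma seg_cont_ex (g : R -> C) (a b : R) : a <= b -> seg_cont g a b ->
  ex_RInt (fun t => fst (g t)) a b /\ ex_RInt (fun t => snd (g t)) a b.
Proof.
  intros Hab H. split; apply (ex_RInt_continuous (V := R_CompleteNormedModule));
  rewrite Rmin_left, Rmax_right by lra; intros z Hz; apply H, Hz.
Qed.

Lemma cint_Chasles (g : R -> C) (a b c : R) : a <= b <= c -> seg_cont g a c ->
  (cint g a b + cint g b c)%C = cint g a c.
Proof.
  intros Hab H.
  destruct (seg_cont_ex g a b) as [A1 A2]; [lra|intros t Ht; apply H; lra|].
  destruct (seg_cont_ex g b c) as [B1 B2]; [lra|intros t Ht; apply H; lra|].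
  apply injective_projections; simpl; apply (RInt_Chasles (V := R_CompleteNormedModule)); assumption.
Qed.

Lemma cint_plus (f g : R -> C) (a b : R) : a <= b -> seg_cont f a b -> seg_cont g a b ->
  cint (fun t => f t + g t)%C a b = (cint f a b + cint g a b)%C.
Proof.
  intros Hab Hf Hg.
  destruct (seg_cont_ex f a b Hab Hf) as [A1 A2].
  destruct (seg_cont_ex g a b Hab Hg) as [B1 B2].
  apply injective_projections; simpl; apply (RInt_plus (V := R_CompleteNormedModule)); assumption.
Qed.

Lemma cint_scal (k : C) (g : R -> C) (a b : R) : a <= b -> seg_cont g a b ->
  cint (fun t => k * g t)%C a b = (k * cint g a b)%C.
Proof.
  intros Hab Hg.
  destruct (seg_cont_ex g a b Hab Hg) as [B1 B2].
  assert (S : forall (x : R) h, ex_RInt h a b -> ex_RInt (fun t => x * h t) a b /\ RInt (fun t => x * h t) a b = x * RInt h a b).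
  { intros x h Hh. split; [apply (ex_RInt_scal (V := R_NormedModule)), Hh|apply (RInt_scal (V := R_CompleteNormedModule)), Hh]. }
  apply injective_projections; simpl.
  - destruct (S (fst k) _ B1) as [C1 D1]. destruct (S (snd k) _ B2) as [C2 D2].
    rewrite <- D1, <- D2. apply (RInt_minus (V := R_CompleteNormedModule)); assumption.
  - destruct (S (fst k) _ B2) as [C1 D1]. destruct (S (snd k) _ B1) as [C2 D2].
    rewrite <- D1, <- D2. apply (RInt_plus (V := R_CompleteNormedModule)); assumption.
Qed.

Lemma cint_ext (f g : R -> C) (a b : R) : a <= b -> (forall t, a <= t <= b -> f t = g t) ->
  cint f a b = cint g a b.
Proof.
  intros Hab H. apply injective_projections; simpl;
  apply RInt_ext; rewrite Rmin_left, Rmax_right by lra; intros x Hx; rewrite H; lra.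
Qed.

Lemma cint_const (k : C) (a b : R) : cint (fun _ => k) a b = (RtoC (b - a) * k)%C.
Proof.
  apply injective_projections; simpl; rewrite RInt_const; unfold scal; simpl; unfold mult; simpl; ring.
Qed.

(* Rotate the value of the integral onto the positive real axis and bound its real part. *)
Lemma cint_bound (g : R -> C) (a b M : R) : a <= b -> seg_cont g a b ->
  (forall t, a <= t <= b -> Cmod (g t) <= M) -> Cmod (cint g a b) <= M * (b - a).
Proof.
  intros Hab Hg HM.
  assert (HM0 : 0 <= M) by (eapply Rle_trans; [apply Cmod_ge_0|apply (HM a); lra]).
  set (v := cint g a b).
  destruct (Req_dec (Cmod v) 0) as [E|E]; [rewrite E; nra|].
  set (u := (Cconj v / RtoC (Cmod v))%C).
  assert (NZ : RtoC (Cmod v) <> 0%C) by (intros Hc; apply RtoC_inj in Hc; auto).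
  assert (Hu : (u * v)%C = RtoC (Cmod v)).
  { unfold u. replace (Cconj v / RtoC (Cmod v) * v)%C with ((v * Cconj v) / RtoC (Cmod v))%C by (field; exact NZ).
    rewrite <- Cmod2_conj, RtoC_pow. field. exact NZ. }
  assert (Hu1 : Cmod u = 1).
  { apply (Rmult_eq_reg_r (Cmod v)); [|exact E]. rewrite <- Cmod_mult, Hu, Cmod_R, Rabs_pos_eq by apply Cmod_ge_0. ring. }
  assert (Hc : cint (fun t => u * g t)%C a b = RtoC (Cmod v)).
  { rewrite cint_scal by assumption. exact Hu. }
  assert (Hs : seg_cont (fun t => u * g t)%C a b).
  { intros t Ht. apply pcont_mult; [apply pcont_const|apply Hg, Ht]. }
  destruct (seg_cont_ex _ a b Hab Hs) as [A1 A2].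
  apply (f_equal fst) in Hc. cbn [fst cint] in Hc.
  change (fst (RtoC (Cmod v))) with (Cmod v) in Hc. rewrite <- Hc.
  eapply Rle_trans; [apply Rle_abs|].
  rewrite (Rmult_comm M). apply abs_RInt_le_const; [exact Hab|exact A1|].
  intros t Ht. eapply Rle_trans; [apply fst_le_Cmod|]. rewrite Cmod_mult, Hu1.
  pose proof (HM t Ht). lra.
Qed.

Lemma RInt_affine (k0 k1 a b : R) : RInt (fun t => k0 + k1 * t) a b = k0 * (b - a) + k1 * ((b ^ 2 - a ^ 2) / 2).
Proof.
  apply is_RInt_unique.
  replace (k0 * (b - a) + k1 * ((b ^ 2 - a ^ 2) / 2)) with
    (minus (k0 * b + k1 * (b ^ 2 / 2)) (k0 * a + k1 * (a ^ 2 / 2))) by (unfold minus, plus, opp; simpl; field).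
  apply (is_RInt_derive (fun t => k0 * t + k1 * (t ^ 2 / 2)) (fun t => k0 + k1 * t)).
  - intros x _. auto_derive; [trivial|field].
  - intros x _. apply continuity_pt_filterlim. reg.
Qed.

(** * Goursat's theorem *)

Definition hedge (f : C -> C) (y a b : R) : C := cint (fun t => f (t, y)) a b.
Definition vedge (f : C -> C) (x c d : R) : C := cint (fun t => f (x, t)) c d.
(** The contour integral over the boundary of the rectangle, counterclockwise; [Ci] comes from dz =
    i dt on the vertical sides. *)
Definition rect (f : C -> C) (a b c d : R) : C :=
  (hedge f c a b + Ci * vedge f b c d - hedge f d a b - Ci * vedge f a c d)%C.

Definition ccts_rect (f : C -> C) (a b c d : R) : Prop :=
  forall x y, a <= x <= b -> c <= y <= d -> ccts f (x, y).

Lemma pcont_horizontal (y t : R) : pcont (fun u => (u, y)) t.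
Proof. split; [apply continuous_id|apply continuous_const]. Qed.

Lemma pcont_vertical (x t : R) : pcont (fun u => (x, u)) t.
Proof. split; [apply continuous_const|apply continuous_id]. Qed.

Lemma ccts_hedge (f : C -> C) (a b c d y : R) : ccts_rect f a b c d -> c <= y <= d ->
  seg_cont (fun t => f (t, y)) a b.
Proof. intros H Hy t Ht. apply (pcont_comp f (fun u => (u, y))); [apply H; lra|apply pcont_horizontal]. Qed.

Lemma ccts_vedge (f : C -> C) (a b c d x : R) : ccts_rect f a b c d -> a <= x <= b ->
  seg_cont (fun t => f (x, t)) c d.
Proof. intros H Hy t Ht. apply (pcont_comp f (fun u => (x, u))); [apply H; lra|apply pcont_vertical]. Qed.

Lemma ccts_rect_sub (f : C -> C) (a b c d a' b' c' d' : R) : ccts_rect f a b c d ->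
  a <= a' -> b' <= b -> c <= c' -> d' <= d -> ccts_rect f a' b' c' d'.
Proof. intros H ? ? ? ? x y Hx Hy. apply H; lra. Qed.

(** Every inner edge is traversed twice in opposite directions and cancels. *)
Lemma rect_split (f : C -> C) (a m b c n d : R) : a <= m <= b -> c <= n <= d ->
  ccts_rect f a b c d ->
  rect f a b c d = (rect f a m c n + rect f m b c n + rect f a m n d + rect f m b n d)%C.
Proof.
  intros Hm Hn H. unfold rect.
  assert (E1 : forall y, c <= y <= d -> (hedge f y a m + hedge f y m b)%C = hedge f y a b).
  { intros y Hy. apply cint_Chasles; [exact Hm|]. eapply ccts_hedge; eauto. }
  assert (E2 : forall x, a <= x <= b -> (vedge f x c n + vedge f x n d)%C = vedge f x c d).
  { intros y Hy. apply cint_Chasles; [exact Hn|]. eapply ccts_vedge; eauto. }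
  rewrite <- (E1 c), <- (E1 d), <- (E2 a), <- (E2 b) by lra. ring.
Qed.

Lemma rect_plus (f g : C -> C) (a b c d : R) : a <= b -> c <= d ->
  ccts_rect f a b c d -> ccts_rect g a b c d ->
  rect (fun z => f z + g z)%C a b c d = (rect f a b c d + rect g a b c d)%C.
Proof.
  intros Hab Hcd Hf Hg. unfold rect, hedge, vedge.
  rewrite !cint_plus; [ring|..]; try assumption;
  (eapply ccts_hedge || eapply ccts_vedge); eauto; lra.
Qed.

Lemma rect_ext (f g : C -> C) (a b c d : R) : a <= b -> c <= d ->
  (forall x y, a <= x <= b -> c <= y <= d -> f (x, y) = g (x, y)) -> rect f a b c d = rect g a b c d.
Proof.
  intros Hab Hcd H. unfold rect, hedge, vedge.
  rewrite (cint_ext (fun t => f (t, c)) (fun t => g (t, c)) a b), (cint_ext (fun t => f (t, d)) (fun t => g (t, d)) a b),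
    (cint_ext (fun t => f (a, t)) (fun t => g (a, t)) c d), (cint_ext (fun t => f (b, t)) (fun t => g (b, t)) c d);
  try reflexivity; try assumption; intros t Ht; apply H; lra.
Qed.

Lemma rect_bound (f : C -> C) (a b c d M : R) : a <= b -> c <= d ->
  ccts_rect f a b c d ->
  (forall x y, a <= x <= b -> c <= y <= d -> Cmod (f (x, y)) <= M) ->
  Cmod (rect f a b c d) <= 2 * M * ((b - a) + (d - c)).
Proof.
  intros Hab Hcd Hf HM. unfold rect.
  assert (E1 : forall y, c <= y <= d -> Cmod (hedge f y a b) <= M * (b - a)).
  { intros y Hy. apply cint_bound; [exact Hab|eapply ccts_hedge; eauto|]. intros t Ht. apply HM; lra. }
  assert (E2 : forall x, a <= x <= b -> Cmod (Ci * vedge f x c d)%C <= M * (d - c)).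
  { intros x Hx. rewrite Cmod_mult, Cmod_Ci, Rmult_1_l.
    apply cint_bound; [exact Hcd|eapply ccts_vedge; eauto|]. intros t Ht. apply HM; lra. }
  unfold Cminus.
  eapply Rle_trans; [apply Cmod_triangle|]. rewrite Cmod_opp.
  eapply Rle_trans; [apply Rplus_le_compat_r, Cmod_triangle|]. rewrite Cmod_opp.
  eapply Rle_trans; [apply Rplus_le_compat_r, Rplus_le_compat_r, Cmod_triangle|].
  pose proof (E1 c). pose proof (E1 d). pose proof (E2 a). pose proof (E2 b). lra.
Qed.

(** Instead of a primitive along the contour, the eight real integrals of affine functions are
    evaluated and cancel algebraically. *)
Lemma rect_affine (k l : C) (a b c d : R) : rect (fun z => k + l * z)%C a b c d = 0%C.
Proof.
  unfold rect, hedge, vedge, cint.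
  assert (H : forall g k0 k1 x y, (forall t, g t = k0 + k1 * t) ->
     RInt g x y = k0 * (y - x) + k1 * ((y ^ 2 - x ^ 2) / 2)).
  { intros g k0 k1 x y Hg. rewrite <- RInt_affine. apply RInt_ext. intros t _. apply Hg. }
  destruct k as [k1 k2], l as [l1 l2].
  rewrite (H (fun t => fst (((k1, k2) + (l1, l2) * (t, c))%C)) (k1 - l2 * c) l1) by (intros; simpl; ring).
  rewrite (H (fun t => snd (((k1, k2) + (l1, l2) * (t, c))%C)) (k2 + l1 * c) l2) by (intros; simpl; ring).
  rewrite (H (fun t => fst (((k1, k2) + (l1, l2) * (t, d))%C)) (k1 - l2 * d) l1) by (intros; simpl; ring).
  rewrite (H (fun t => snd (((k1, k2) + (l1, l2) * (t, d))%C)) (k2 + l1 * d) l2) by (intros; simpl; ring).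
  rewrite (H (fun t => fst (((k1, k2) + (l1, l2) * (a, t))%C)) (k1 + l1 * a) (- l2)) by (intros; simpl; ring).
  rewrite (H (fun t => snd (((k1, k2) + (l1, l2) * (a, t))%C)) (k2 + l2 * a) l1) by (intros; simpl; ring).
  rewrite (H (fun t => fst (((k1, k2) + (l1, l2) * (b, t))%C)) (k1 + l1 * b) (- l2)) by (intros; simpl; ring).
  rewrite (H (fun t => snd (((k1, k2) + (l1, l2) * (b, t))%C)) (k2 + l2 * b) l1) by (intros; simpl; ring).
  apply injective_projections; simpl; field.
Qed.

(** The hypothesis says that each interval of length A/2^n contains its successor of half the
    length. Left ends increase, right ends decrease, and the supremum of the left ends lies in all
    of them. *)
Lemma nested_intervals (x : nat -> R) (A : R) : 0 <= A ->
  (forall n, x n <= x (S n) <= x n + A / 2 ^ S n) ->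
  exists l, forall n, x n <= l <= x n + A / 2 ^ n.
Proof.
  intros HA H.
  assert (P2 : forall n, 0 < 2 ^ n) by (intros; apply pow_lt; lra).
  assert (HD : forall n, A / 2 ^ n = A / 2 ^ S n + A / 2 ^ S n).
  { intros n. simpl. field. apply pow_nonzero. lra. }
  assert (HP : forall n, 0 <= A / 2 ^ n) by (intros; apply Rdiv_le_0_compat; [lra|apply P2]).
  assert (Up : forall k n, x n <= x (n + k)%nat).
  { induction k; intros n; [rewrite Nat.add_0_r; lra|].
    rewrite Nat.add_succ_r. specialize (IHk n). destruct (H (n + k)%nat). lra. }
  assert (Dn : forall k n, x (n + k)%nat + A / 2 ^ (n + k) <= x n + A / 2 ^ n).
  { induction k; intros n; [rewrite Nat.add_0_r; lra|].
    rewrite Nat.add_succ_r. specialize (IHk n). destruct (H (n + k)%nat).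
    rewrite (HD (n + k)%nat) in IHk. lra. }
  assert (B : forall m n, x m <= x n + A / 2 ^ n).
  { intros m n. pose proof (Up n m) as U. pose proof (Dn m n) as D. rewrite (Nat.add_comm n m) in D.
    pose proof (HP (m + n)%nat). lra. }
  destruct (completeness (fun y => exists n, y = x n)) as [l [Hl1 Hl2]].
  - exists (x O + A / 2 ^ O). intros y [n ->]. apply B.
  - exists (x O), O. reflexivity.
  - exists l. intros n. split; [apply Hl1; exists n; reflexivity|].
    apply Hl2. intros y [m ->]. apply B.
Qed.

(** The four quarters add up to the whole, so one of them carries at least a quarter of its
    modulus. *)
Lemma rect_quarter (f : C -> C) (a c A B : R) : 0 <= A -> 0 <= B ->
  ccts_rect f a (a + A) c (c + B) ->
  exists a' c', (a' = a \/ a' = a + A / 2) /\ (c' = c \/ c' = c + B / 2) /\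
    Cmod (rect f a (a + A) c (c + B)) <= 4 * Cmod (rect f a' (a' + A / 2) c' (c' + B / 2)).
Proof.
  intros HA HB H.
  pose proof (rect_split f a (a + A / 2) (a + A) c (c + B / 2) (c + B)) as E.
  specialize (E ltac:(lra) ltac:(lra) H). rewrite E.
  replace (a + A) with (a + A / 2 + A / 2) by lra. replace (c + B) with (c + B / 2 + B / 2) by lra.
  set (r1 := rect f a (a + A / 2) c (c + B / 2)).
  set (r2 := rect f (a + A / 2) (a + A / 2 + A / 2) c (c + B / 2)).
  set (r3 := rect f a (a + A / 2) (c + B / 2) (c + B / 2 + B / 2)).
  set (r4 := rect f (a + A / 2) (a + A / 2 + A / 2) (c + B / 2) (c + B / 2 + B / 2)).
  set (s := Cmod (r1 + r2 + r3 + r4)%C).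
  assert (T : s <= Cmod r1 + Cmod r2 + Cmod r3 + Cmod r4).
  { unfold s. eapply Rle_trans; [apply Cmod_triangle|]. apply Rplus_le_compat_r.
    eapply Rle_trans; [apply Cmod_triangle|]. apply Rplus_le_compat_r. apply Cmod_triangle. }
  destruct (Rle_dec s (4 * Cmod r1)); [exists a, c; auto|].
  destruct (Rle_dec s (4 * Cmod r2)); [exists (a + A / 2), c; auto|].
  destruct (Rle_dec s (4 * Cmod r3)); [exists a, (c + B / 2); auto|].
  exists (a + A / 2), (c + B / 2). fold r4. repeat split; auto. lra.
Qed.

(** Repeated quartering closes in on a point at which f is affine up to eps times the distance. The
    affine part integrates to zero; the error is of order eps times diameter times perimeter, that
    is eps/4^N, which exactly compensates the factor 4^N lost in the choices. *)
Lemma goursat (f : C -> C) (a b c d : R) : a <= b -> c <= d ->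
  (forall x y, a <= x <= b -> c <= y <= d -> exists D, cderiv f (x, y) D) ->
  rect f a b c d = 0%C.
Proof.
  intros Hab Hcd Hf.
  assert (Hc : ccts_rect f a b c d).
  { intros x y Hx Hy. destruct (Hf x y Hx Hy) as [D HD]. eapply cderiv_ccts; eauto. }
  set (A := b - a). set (B := d - c).
  assert (HA : 0 <= A) by (unfold A; lra). assert (HB : 0 <= B) by (unfold B; lra).
  assert (P2 : forall n, 0 < 2 ^ n) by (intros; apply pow_lt; lra).
  assert (HS : forall X n, X / 2 ^ S n = X / 2 ^ n / 2) by (intros; simpl; field; apply pow_nonzero; lra).
  assert (HP : forall X n, 0 <= X -> 0 <= X / 2 ^ n) by (intros; apply Rdiv_le_0_compat; [lra|apply P2]).
  set (J := fun n (p : R * R) => Cmod (rect f (fst p) (fst p + A / 2 ^ n) (snd p) (snd p + B / 2 ^ n))).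
  set (I := fun n (p : R * R) => a <= fst p /\ fst p + A / 2 ^ n <= b /\ c <= snd p /\ snd p + B / 2 ^ n <= d).
  assert (step : forall n p, exists q, I n p -> I (S n) q /\ J n p <= 4 * J (S n) q /\
      fst p <= fst q <= fst p + A / 2 ^ S n /\ snd p <= snd q <= snd p + B / 2 ^ S n).
  (* Outside the invariant the witness is a dummy, so that choice produces a total successor
     function. *)
  { intros n p. destruct (classic (I n p)) as [HI|HI]; [|exists p; tauto].
    destruct HI as [I1 [I2 [I3 I4]]].
    destruct (rect_quarter f (fst p) (snd p) (A / 2 ^ n) (B / 2 ^ n)) as [a' [c' [Ha [Hc' Hq]]]];
      [apply HP, HA|apply HP, HB|eapply ccts_rect_sub; eauto|].
    exists (a', c'). intros _. unfold I, J. cbn [fst snd]. rewrite !HS.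
    pose proof (HP A n HA). pose proof (HP B n HB).
    destruct Ha; destruct Hc'; subst a' c'; repeat split; try lra; exact Hq. }
  set (nx := fun n p => proj1_sig (constructive_indefinite_description _ (step n p))).
  set (sq := fix sq n := match n with O => (a, c) | S m => nx m (sq m) end).
  assert (nxP : forall n p, I n p -> I (S n) (nx n p) /\ J n p <= 4 * J (S n) (nx n p) /\
      fst p <= fst (nx n p) <= fst p + A / 2 ^ S n /\ snd p <= snd (nx n p) <= snd p + B / 2 ^ S n).
  { intros n p. unfold nx. destruct (constructive_indefinite_description _ (step n p)) as [q Hq]. exact Hq. }
  assert (HI : forall n, I n (sq n)).
  { induction n; [unfold I, A, B; simpl; lra|]. apply (nxP n (sq n) IHn). }
  assert (HJ : forall n, J O (a, c) <= 4 ^ n * J n (sq n)).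
  { induction n; [simpl; lra|]. pose proof (proj1 (proj2 (nxP n (sq n) (HI n)))) as H1.
    change (nx n (sq n)) with (sq (S n)) in H1.
    assert (0 < 4 ^ n) by (apply pow_lt; lra).
    change (4 ^ S n) with (4 * 4 ^ n). nra. }
  destruct (nested_intervals (fun n => fst (sq n)) A HA) as [px Hpx]; [intros n; apply (nxP n (sq n) (HI n))|].
  destruct (nested_intervals (fun n => snd (sq n)) B HB) as [py Hpy]; [intros n; apply (nxP n (sq n) (HI n))|].
  cbv beta in Hpx, Hpy.
  assert (HJ0 : J O (a, c) = Cmod (rect f a b c d)).
  { unfold J. simpl. do 2 f_equal; unfold A, B; field. }
  rewrite HJ0 in HJ.
  destruct (Hf px py) as [D HD].
  { specialize (Hpx O). specialize (HI O). unfold I in HI. lra. }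
  { specialize (Hpy O). specialize (HI O). unfold I in HI. lra. }
  rewrite cderivE in HD.
  set (L := A + B).
  (* [L] is half the perimeter of the original rectangle and bounds its diameter; after N
     quarterings both scale by 2^(-N), and N is taken so large that the small rectangle lies in the
     ball where the affine approximation holds. *)
  assert (key : forall eps, 0 < eps -> Cmod (rect f a b c d) <= 2 * eps * L ^ 2).
  { intros eps Heps. destruct (HD eps Heps) as [de [Hde H1]].
    assert (HL : 0 <= L) by (unfold L; lra).
    destruct (pow_lt_1_zero (/ 2) ltac:(rewrite Rabs_pos_eq; lra) (de / (L + 1))) as [N HN].
    { apply Rdiv_lt_0_compat; lra. }
    specialize (HN N (Nat.le_refl N)). rewrite Rabs_pos_eq in HN by (apply pow_le; lra).
    rewrite pow_inv in HN.
    assert (HLN : L / 2 ^ N < de).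
    { apply (Rmult_lt_compat_r (L + 1)) in HN; [|lra].
      unfold Rdiv in HN. rewrite (Rmult_assoc de), Rinv_l, Rmult_1_r in HN by lra.
      assert (0 < / 2 ^ N) by (apply Rinv_0_lt_compat, P2). unfold Rdiv. nra. }
    destruct (HI N) as [I1 [I2 [I3 I4]]].
    set (x0 := fst (sq N)) in *. set (y0 := snd (sq N)) in *.
    set (AN := A / 2 ^ N) in *. set (BN := B / 2 ^ N) in *.
    assert (HAN : 0 <= AN) by apply HP, HA. assert (HBN : 0 <= BN) by apply HP, HB.
    assert (ELN : L / 2 ^ N = AN + BN) by (unfold L, AN, BN; field; apply pow_nonzero; lra).
    set (p := (px, py) : C) in *.
    set (aff := fun z : C => (f p - D * p + D * z)%C).
    set (e := fun z : C => (f z + - aff z)%C).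
    assert (Hdist : forall x y, x0 <= x <= x0 + AN -> y0 <= y <= y0 + BN -> Cmod ((x, y) - p)%C <= AN + BN).
    { intros x y Hx Hy. eapply Rle_trans; [apply Cmod_le_sum|]. simpl.
      specialize (Hpx N). specialize (Hpy N).
      apply Rplus_le_compat; apply Rabs_le; unfold x0, y0, AN, BN in *; lra. }
    assert (Caff : ccts_rect aff x0 (x0 + AN) y0 (y0 + BN)).
    { intros x y _ _. eapply cderiv_ccts. apply cderiv_lin. }
    assert (Cf : ccts_rect f x0 (x0 + AN) y0 (y0 + BN)) by (eapply ccts_rect_sub; eauto).
    assert (Ce : ccts_rect e x0 (x0 + AN) y0 (y0 + BN)).
    { intros x y Hx Hy. destruct (Hf x y) as [D' HD']; [lra|lra|]. eapply cderiv_ccts.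
      apply cderiv_plus; [exact HD'|]. apply cderiv_opp. apply cderiv_lin. }
    assert (Er : rect f x0 (x0 + AN) y0 (y0 + BN) = rect e x0 (x0 + AN) y0 (y0 + BN)).
    { transitivity (rect (fun z => aff z + e z)%C x0 (x0 + AN) y0 (y0 + BN)).
      - apply rect_ext; [lra|lra|]. intros. unfold e. ring.
      - etransitivity; [apply (rect_plus aff e); assumption || lra|].
        unfold aff at 1. rewrite rect_affine. ring. }
    assert (Eb : Cmod (rect e x0 (x0 + AN) y0 (y0 + BN)) <= 2 * (eps * (AN + BN)) * (AN + BN)).
    { replace (AN + BN) with (x0 + AN - x0 + (y0 + BN - y0)) at 2 by ring.
      apply rect_bound; [lra|lra|exact Ce|].
      intros x y Hx Hy. specialize (Hdist x y Hx Hy).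
      specialize (H1 ((x, y) - p)%C ltac:(lra)).
      unfold e, aff. set (q := (x, y) : C) in *.
      replace (p + (q - p))%C with q in H1 by ring.
      replace (f q + - (f p - D * p + D * q))%C with (f q - f p - D * (q - p))%C by ring.
      eapply Rle_trans; [exact H1|]. apply Rmult_le_compat_l; lra. }
    specialize (HJ N). unfold J in HJ. fold x0 y0 AN BN in HJ. rewrite Er in HJ.
    assert (P4 : 0 < 4 ^ N) by (apply pow_lt; lra).
    eapply Rle_trans; [exact HJ|].
    eapply Rle_trans; [apply Rmult_le_compat_l; [lra|exact Eb]|].
    rewrite <- ELN. apply Req_le.
    replace 4 with (2 * 2) by lra. rewrite Rpow_mult_distr. field. apply pow_nonzero. lra. }
  apply Cmod_eq_0. apply Rle_antisym; [|apply Cmod_ge_0].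
  apply le_epsilon. intros eps Heps.
  assert (HL : 0 < 2 * L ^ 2 + 1) by (pose proof (pow2_ge_0 L); lra).
  eapply Rle_trans; [apply (key (eps / (2 * L ^ 2 + 1)))|].
  - apply Rdiv_lt_0_compat; lra.
  - rewrite Rplus_0_l. apply (Rmult_le_reg_r (2 * L ^ 2 + 1)); [exact HL|].
    replace (2 * (eps / (2 * L ^ 2 + 1)) * L ^ 2 * (2 * L ^ 2 + 1)) with (eps * (2 * L ^ 2)) by (field; lra).
    nra.
Qed.

(** * The derivative of a holomorphic function is holomorphic *)

Definition cexp (z : C) : C := Cexp z.
Definition cis (t : R) : C := (cos t, sin t).

Lemma cexp_plus (z w : C) : cexp (z + w)%C = (cexp z * cexp w)%C.
Proof.
  unfold cexp, Cexp. apply injective_projections; simpl;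
  rewrite exp_plus; [rewrite cos_plus|rewrite sin_plus]; ring.
Qed.

Lemma Cmod_cis (t : R) : Cmod (cis t) = 1.
Proof.
  unfold Cmod, cis. simpl. rewrite !Rmult_1_r. pose proof (sin2_cos2 t) as H. unfold Rsqr in H.
  replace (cos t * cos t + sin t * sin t) with 1 by lra. apply sqrt_1.
Qed.

Lemma cexp_polar (z : C) : cexp z = (RtoC (exp (fst z)) * cis (snd z))%C.
Proof. unfold cexp, Cexp, cis. apply injective_projections; simpl; ring. Qed.

Lemma Cmod_cexp (z : C) : Cmod (cexp z) = exp (fst z).
Proof. rewrite cexp_polar, Cmod_mult, Cmod_cis, Cmod_R, Rabs_pos_eq; [ring|left; apply exp_pos]. Qed.

Lemma cexp_0 : cexp 0%C = 1%C.
Proof. unfold cexp, Cexp. apply injective_projections; simpl; rewrite exp_0; [rewrite cos_0|rewrite sin_0]; ring. Qed.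

Lemma cis_plus (s t : R) : cis (s + t) = (cis s * cis t)%C.
Proof. unfold cis. apply injective_projections; simpl; [apply cos_plus|rewrite sin_plus; ring]. Qed.

Lemma cis_opp (t : R) : (cis (- t) * cis t)%C = 1%C.
Proof.
  rewrite <- cis_plus. replace (- t + t) with 0 by ring. unfold cis. rewrite cos_0, sin_0. reflexivity.
Qed.

Lemma derivable_lim_ineq (g : R -> R) (x l eps : R) : derivable_pt_lim g x l -> 0 < eps ->
  exists de, 0 < de /\ forall h, Rabs h < de -> Rabs (g (x + h) - g x - l * h) <= eps * Rabs h.
Proof.
  intros H Heps. destruct (H eps Heps) as [de Hde]. exists de. split; [apply cond_pos|].
  intros h Hh. destruct (Req_dec h 0) as [->|Hn].
  - rewrite Rplus_0_r, Rmult_0_r, Rabs_R0. replace (g x - g x - 0) with 0 by ring. rewrite Rabs_R0. lra.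
  - specialize (Hde h Hn Hh).
    replace (g (x + h) - g x - l * h) with (((g (x + h) - g x) / h - l) * h) by (field; exact Hn).
    rewrite Rabs_mult. apply Rmult_le_compat_r; [apply Rabs_pos|lra].
Qed.

(** The functional equation moves the question to 0, where the real derivatives of exp, cos and sin
    suffice. *)
Lemma cderiv_cexp (z : C) : cderiv cexp z (cexp z).
Proof.
  assert (H0 : forall eps, 0 < eps -> exists de, 0 < de /\
     forall h : C, Cmod h < de -> Cmod (cexp h - 1 - h)%C <= eps * Cmod h).
  { intros eps Heps.
    (* The errors below add up to 3 e m in the real part and 4 e m in the imaginary part, hence 7;
       the bound 1/2 ensures exp x <= 2. *)
    set (e := Rmin (eps / 7) (1 / 2)).
    assert (He : 0 < e) by (apply Rmin_pos; lra).
    assert (He1 : e <= eps / 7) by apply Rmin_l. assert (He2 : e <= 1 / 2) by apply Rmin_r.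
    destruct (derivable_lim_ineq exp 0 _ e (derivable_pt_lim_exp 0) He) as [d1 [D1 H1]].
    destruct (derivable_lim_ineq cos 0 _ e (derivable_pt_lim_cos 0) He) as [d2 [D2 H2]].
    destruct (derivable_lim_ineq sin 0 _ e (derivable_pt_lim_sin 0) He) as [d3 [D3 H3]].
    rewrite exp_0 in H1. rewrite cos_0, sin_0 in H2. rewrite sin_0, cos_0 in H3.
    exists (Rmin (Rmin d1 d2) (Rmin d3 e)). split; [apply Rmin_pos; apply Rmin_pos; assumption|].
    intros [x y] Hh.
    assert (Hm := fst_le_Cmod (x, y)). assert (Hm' := im_le_Cmod (x, y)). cbn [fst snd] in Hm, Hm'.
    set (m := Cmod (x, y)) in *.
    assert (A1 := Rmin_l (Rmin d1 d2) (Rmin d3 e)). assert (A2 := Rmin_r (Rmin d1 d2) (Rmin d3 e)).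
    assert (A3 := Rmin_l d1 d2). assert (A4 := Rmin_r d1 d2).
    assert (A5 := Rmin_l d3 e). assert (A6 := Rmin_r d3 e).
    specialize (H1 x ltac:(lra)). specialize (H2 y ltac:(lra)). specialize (H3 y ltac:(lra)).
    rewrite Rplus_0_l in H1, H2, H3.
    rewrite Ropp_0, Rmult_0_l, Rminus_0_r in H2. rewrite Rmult_1_l, ?Rminus_0_r in H3. rewrite Rmult_1_l in H1.
    assert (Hx := Rabs_pos x). assert (Hy := Rabs_pos y).
    assert (X1 : Rabs (exp x - 1) <= 2 * Rabs x).
    { replace (exp x - 1) with ((exp x - 1 - x) + x) by ring. eapply Rle_trans; [apply Rabs_triang|]. nra. }
    assert (X2 : 0 <= exp x <= 2).
    { split; [left; apply exp_pos|]. apply Rabs_le_between in X1. lra. }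
    assert (Y1 : Rabs (exp x * cos y - 1 - x) <= e * m + 2 * (e * m)).
    { replace (exp x * cos y - 1 - x) with ((exp x - 1 - x) + exp x * (cos y - 1)) by ring.
      eapply Rle_trans; [apply Rabs_triang|]. rewrite Rabs_mult, (Rabs_pos_eq (exp x)) by lra.
      assert (0 <= Rabs (cos y - 1)) by apply Rabs_pos. apply Rplus_le_compat; nra. }
    assert (Y2 : Rabs (exp x * sin y - y) <= 2 * (e * m) + 2 * (e * m)).
    { replace (exp x * sin y - y) with (exp x * (sin y - y) + (exp x - 1) * y) by ring.
      eapply Rle_trans; [apply Rabs_triang|]. rewrite !Rabs_mult, (Rabs_pos_eq (exp x)) by lra.
      assert (0 <= Rabs (sin y - y)) by apply Rabs_pos. apply Rplus_le_compat; [nra|].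
      assert (HX := Rabs_pos (exp x - 1)). nra. }
    eapply Rle_trans; [apply Cmod_le_sum|].
    unfold cexp, Cexp. cbn [fst snd Cminus Cplus Copp RtoC].
    replace (exp x * cos y + - (1) + - x) with (exp x * cos y - 1 - x) by ring.
    replace (exp x * sin y + - 0 + - y) with (exp x * sin y - y) by ring.
    assert (0 <= m) by apply Cmod_ge_0. nra. }
  rewrite cderivE. intros eps Heps.
  assert (Hp := exp_pos (fst z)).
  destruct (H0 (eps / exp (fst z))) as [de [Hde H]]; [apply Rdiv_lt_0_compat; lra|].
  exists de; split; [exact Hde|]. intros h Hh. specialize (H h Hh).
  rewrite cexp_plus. replace (cexp z * cexp h - cexp z - cexp z * h)%C with (cexp z * (cexp h - 1 - h))%C by ring.
  rewrite Cmod_mult, Cmod_cexp.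
  apply (Rmult_le_compat_l (exp (fst z))) in H; [|lra].
  eapply Rle_trans; [exact H|]. apply Req_le. field. lra.
Qed.

(** * Circle integrals and Cauchy's formula for the derivative *)

Lemma pcont_cis (t : R) : pcont cis t.
Proof. split; apply continuity_pt_filterlim; [apply continuity_cos|apply continuity_sin]. Qed.

Lemma pcont_comp_cis (k t : R) : pcont (fun t => cis (k * t)) t.
Proof.
  split; simpl.
  - apply (continuous_comp (fun t => k * t) cos); apply continuity_pt_filterlim; [reg|apply continuity_cos].
  - apply (continuous_comp (fun t => k * t) sin); apply continuity_pt_filterlim; [reg|apply continuity_sin].
Qed.

Lemma cint_cis (k a b : R) : k <> 0 -> a <= b ->
  cint (fun t => cis (k * t)) a b = ((sin (k * b) - sin (k * a)) / k, (cos (k * a) - cos (k * b)) / k).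
Proof.
  intros Hk Hab. apply injective_projections; simpl; apply is_RInt_unique.
  - replace ((sin (k * b) - sin (k * a)) / k) with (minus (sin (k * b) / k) (sin (k * a) / k))
      by (unfold minus, plus, opp; simpl; field; exact Hk).
    apply (is_RInt_derive (fun t => sin (k * t) / k) (fun t => cos (k * t))).
    + intros x _. auto_derive; [trivial|field; exact Hk].
    + intros x _. apply (pcont_comp_cis k x).
  - replace ((cos (k * a) - cos (k * b)) / k) with (minus (- cos (k * b) / k) (- cos (k * a) / k))
      by (unfold minus, plus, opp; simpl; field; exact Hk).
    apply (is_RInt_derive (fun t => - cos (k * t) / k) (fun t => sin (k * t))).
    + intros x _. auto_derive; [trivial|field; exact Hk].
    + intros x _. apply (pcont_comp_cis k x).
Qed.

(** Cauchy's integral for 2 pi f'(z) over the circle of radius [rho]. The circle is run clockwise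
    because its points arise as z + e^(-s) with s = - ln rho + i t. *)
Definition circ (f : C -> C) (z : C) (rho : R) : C :=
  cint (fun t => f (z + RtoC rho * cis (- t)) * (cis t / RtoC rho))%C 0 (2 * PI).

Definition holo_ball (f : C -> C) (z : C) (r : R) : Prop :=
  forall u, Cmod (u - z)%C < r -> exists d, cderiv f u d.

Lemma circ_cont (f : C -> C) (z : C) (rho r : R) : 0 < rho < r ->
  (forall u, Cmod (u - z)%C < r -> ccts f u) -> forall t,
  pcont (fun t => f (z + RtoC rho * cis (- t)) * (cis t / RtoC rho))%C t.
Proof.
  intros Hr Hf t. apply pcont_mult.
  - apply (pcont_comp f (fun t => z + RtoC rho * cis (- t))%C).
    + apply Hf. replace (z + RtoC rho * cis (- t) - z)%C with (RtoC rho * cis (- t))%C by ring.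
      rewrite Cmod_mult, Cmod_cis, Cmod_R, Rabs_pos_eq; lra.
    + apply pcont_plus; [apply pcont_const|]. apply pcont_mult; [apply pcont_const|].
      assert (H := pcont_comp_cis (-1) t). rewrite pcont_eps in *. intros eps Heps.
      destruct (H eps Heps) as [de [Hde H1]]. exists de; split; [exact Hde|]. intros u Hu. specialize (H1 u Hu).
      replace (- u) with (-1 * u) by ring. replace (- t) with (-1 * t) by ring. exact H1.
  - apply pcont_mult; [apply pcont_cis|apply pcont_const].
Qed.

(* With z + e^(-s) running over circles as s runs over vertical segments, Goursat on a rectangle of
   height 2 pi makes the mean independent of the radius. *)
Lemma circ_radius (f : C -> C) (z : C) (rho rho' r : R) : 0 < rho' <= rho -> rho < r ->
  holo_ball f z r -> circ f z rho' = circ f z rho.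
Proof.
  intros Hr Hr' Hf.
  (* Up to sign this is the form f(u) du / (u - z)^2 pulled back by u = z + e^(-s). *)
  set (h := fun s : C => (f (z + cexp (- s)) * cexp s)%C).
  set (a := - ln rho). set (b := - ln rho').
  assert (Hab : a <= b).
  { unfold a, b. apply Ropp_le_contravar.
    destruct (Req_dec rho' rho) as [->|Hn]; [lra|]. left; apply ln_increasing; lra. }
  assert (Hpi := PI_RGT_0).
  assert (E : rect h a b 0 (2 * PI) = 0%C).
  { apply goursat; [exact Hab|lra|]. intros x y Hx Hy.
    destruct (Hf (z + cexp (- (x, y)))%C) as [d Hd].
    { replace (z + cexp (- (x, y)) - z)%C with (cexp (- (x, y)))%C by ring. rewrite Cmod_cexp. simpl.
      eapply Rle_lt_trans; [|exact Hr']. rewrite <- (exp_ln rho) by lra.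
      destruct (Req_dec x a) as [->|Hn]; [unfold a; rewrite Ropp_involutive; lra|].
      left; apply exp_increasing. unfold a in *; lra. }
    eexists. apply (cderiv_mult (fun s => f (z + cexp (- s))%C) cexp); [|apply cderiv_cexp].
    apply (cderiv_comp f (fun s => z + cexp (- s))%C); [exact Hd|].
    apply (cderiv_plus (fun _ => z) (fun s => cexp (- s))%C); [apply cderiv_const|].
    apply (cderiv_comp cexp (fun s => - s)%C); [apply cderiv_cexp|].
    apply cderiv_opp, cderiv_id. }
  (* Periodicity of the exponential makes the horizontal edges cancel, so the two vertical ones
     agree. *)
  assert (P : hedge h 0 a b = hedge h (2 * PI) a b).
  { unfold hedge. apply cint_ext; [exact Hab|]. intros t _. unfold h.
    assert (P1 : cexp (t, 2 * PI) = cexp (t, 0)).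
    { rewrite !cexp_polar. cbn [fst snd]. unfold cis. rewrite cos_2PI, sin_2PI, cos_0, sin_0. reflexivity. }
    assert (P2 : cexp (- (t, 2 * PI)) = cexp (- (t, 0))).
    { rewrite !cexp_polar. cbn [fst snd Copp]. unfold cis.
      rewrite cos_neg, sin_neg, cos_2PI, sin_2PI, Ropp_0, cos_0, sin_0. reflexivity. }
    rewrite P1, P2. reflexivity. }
  assert (V : forall q, 0 < q -> vedge h (- ln q) 0 (2 * PI) = circ f z q).
  { intros q Hq. unfold vedge, circ. apply cint_ext; [lra|]. intros t _. unfold h.
    rewrite !cexp_polar. cbn [fst snd Copp]. rewrite Ropp_involutive, exp_ln, exp_Ropp, exp_ln, RtoC_inv by lra.
    unfold Cdiv. rewrite (Cmult_comm (/ RtoC q)). reflexivity. }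
  unfold rect in E. rewrite P in E. unfold a in E at 3. unfold b in E at 2. rewrite !V in E by lra.
  assert (E2 : (Ci * (circ f z rho' - circ f z rho))%C = 0%C) by (rewrite <- E; ring).
  assert (E3 : (circ f z rho' - circ f z rho)%C = 0%C).
  { replace (circ f z rho' - circ f z rho)%C with (- Ci * (Ci * (circ f z rho' - circ f z rho)))%C.
    - rewrite E2. ring.
    - replace (- Ci * (Ci * (circ f z rho' - circ f z rho)))%C with
        (- (Ci * Ci) * (circ f z rho' - circ f z rho))%C by ring.
      replace (Ci * Ci)%C with (- (1))%C by (apply injective_projections; simpl; ring). ring. }
  apply Ceq_minus. exact E3.
Qed.

Lemma cis_over_norm (rho t : R) : 0 < rho -> Cmod (cis t / RtoC rho)%C = / rho.
Proof.
  intros Hr. unfold Cdiv. rewrite Cmod_mult, Cmod_cis, Cmod_inv, Cmod_R, Rabs_pos_eq; [ring|lra|].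
  intros Hc. apply RtoC_inj in Hc. lra.
Qed.

(** By independence of the radius the circle may be shrunk until f is replaced by its first-order
    expansion: f(z) is multiplied by a mean-zero exponential and drops out, and the linear term
    contributes the constant d. *)
Lemma circ_deriv (f : C -> C) (z d : C) (rho r : R) : 0 < rho < r ->
  holo_ball f z r -> cderiv f z d -> circ f z rho = (RtoC (2 * PI) * d)%C.
Proof.
  intros Hr Hf Hd. assert (Hpi := PI_RGT_0).
  apply Ceq_minus, Cmod_eq_0, Rle_antisym; [|apply Cmod_ge_0].
  apply le_epsilon. intros eps Heps. rewrite Rplus_0_l.
  rewrite cderivE in Hd. destruct (Hd (eps / (2 * PI))) as [de [Hde H1]].
  { apply Rdiv_lt_0_compat; lra. }
  set (q := Rmin rho (de / 2)).
  assert (Hq : 0 < q) by (apply Rmin_pos; lra).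
  assert (Hq1 : q <= rho) by apply Rmin_l. assert (Hq2 : q <= de / 2) by apply Rmin_r.
  assert (NZ : RtoC q <> 0%C) by (intros Hc; apply RtoC_inj in Hc; lra).
  rewrite <- (circ_radius f z rho q r); [|lra|lra|exact Hf].
  (* [g] is the integrand of the first-order expansion, with integral 2 pi d, and [e] is the error.
     The error in f is at most a small multiple of q, which the factor 1/q of the kernel just
     compensates. *)
  set (g := fun t => (f z / RtoC q * cis (1 * t) + d)%C).
  set (e := fun t => (f (z + RtoC q * cis (- t)) * (cis t / RtoC q) + (- 1) * g t)%C).
  assert (Hcg : seg_cont g 0 (2 * PI)).
  { intros t _. apply pcont_plus; [|apply pcont_const].
    apply pcont_mult; [apply pcont_const|]. apply pcont_comp_cis. }
  assert (Hce : seg_cont e 0 (2 * PI)).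
  { intros t Ht. apply pcont_plus.
    - apply (circ_cont f z q r); [lra|]. intros u Hu. destruct (Hf u Hu) as [d' Hd']. eapply cderiv_ccts; eauto.
    - apply pcont_mult; [apply pcont_const|apply Hcg, Ht]. }
  assert (Hg : cint g 0 (2 * PI) = (RtoC (2 * PI) * d)%C).
  { unfold g. rewrite (cint_plus (fun t => f z / RtoC q * cis (1 * t))%C (fun _ => d)).
    - rewrite cint_scal; [|lra|intros t _; apply pcont_comp_cis].
      rewrite cint_cis, cint_const by lra. rewrite !Rmult_1_l, sin_2PI, cos_2PI, sin_0, cos_0.
      replace ((0 - 0) / 1, (1 - 1) / 1) with (RtoC 0) by (apply injective_projections; simpl; field).
      rewrite Rminus_0_r. ring.
    - lra.
    - intros t _. apply pcont_mult; [apply pcont_const|]. apply pcont_comp_cis.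
    - intros t _; apply pcont_const. }
  assert (E : circ f z q = (cint g 0 (2 * PI) + cint e 0 (2 * PI))%C).
  { rewrite <- cint_plus by (assumption || lra). apply cint_ext; [lra|]. intros t _. unfold e. ring. }
  rewrite E, Hg. replace (RtoC (2 * PI) * d + cint e 0 (2 * PI) - RtoC (2 * PI) * d)%C with (cint e 0 (2 * PI)) by ring.
  replace eps with (eps / (2 * PI) * (2 * PI - 0)) by (field; lra).
  apply cint_bound; [lra|exact Hce|]. intros t _.
  set (u := (RtoC q * cis (- t))%C).
  assert (Hu : Cmod u = q) by (unfold u; rewrite Cmod_mult, Cmod_cis, Cmod_R, Rabs_pos_eq; lra).
  specialize (H1 u ltac:(lra)).
  replace (e t) with ((f (z + u) - f z - d * u) * (cis t / RtoC q))%C.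
  - rewrite Cmod_mult, cis_over_norm by exact Hq. rewrite Hu in H1.
    apply (Rmult_le_reg_r q); [exact Hq|]. rewrite Rmult_assoc, Rinv_l by lra. lra.
  - unfold e, g. fold u. rewrite Rmult_1_l.
    replace (d * u)%C with (d * (RtoC q * cis (- t)))%C by reflexivity.
    replace ((f (z + u) - f z - d * (RtoC q * cis (- t))) * (cis t / RtoC q))%C with
      (f (z + u) * (cis t / RtoC q) - f z * (cis t / RtoC q) - d * (cis (- t) * cis t))%C by (field; exact NZ).
    rewrite cis_opp. field. exact NZ.
Qed.

Lemma cauchy_estimate (f : C -> C) (z d : C) (B rho r : R) : 0 < rho < r ->
  holo_ball f z r -> (forall u, Cmod (u - z)%C < r -> Cmod (f u) <= B) -> cderiv f z d -> Cmod d <= B / rho.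
Proof.
  intros Hr Hf HB Hd. assert (Hpi := PI_RGT_0).
  pose proof (circ_deriv f z d rho r Hr Hf Hd) as E.
  assert (Hb : Cmod (circ f z rho) <= B / rho * (2 * PI - 0)).
  { apply cint_bound; [lra| |].
    - intros t _. apply (circ_cont f z rho r Hr). intros u Hu. destruct (Hf u Hu) as [d' Hd'].
      eapply cderiv_ccts; eauto.
    - intros t _. rewrite Cmod_mult, cis_over_norm by lra.
      apply Rmult_le_compat_r; [left; apply Rinv_0_lt_compat; lra|]. apply HB.
      replace (z + RtoC rho * cis (- t) - z)%C with (RtoC rho * cis (- t))%C by ring.
      rewrite Cmod_mult, Cmod_cis, Cmod_R, Rabs_pos_eq; lra. }
  rewrite E, Cmod_mult, Cmod_R, Rabs_pos_eq in Hb by lra.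
  apply (Rmult_le_reg_l (2 * PI)); lra.
Qed.

(** * Mean value inequalities along segments *)

Lemma cderiv_path (F : C -> C) (z h d : C) (t : R) : cderiv F (z + RtoC t * h)%C d ->
  is_derive (fun s => fst (F (z + RtoC s * h)%C)) t (fst (d * h)%C) /\
  is_derive (fun s => snd (F (z + RtoC s * h)%C)) t (snd (d * h)%C).
Proof.
  intros Hd. rewrite cderivE in Hd.
  assert (K : forall eps, 0 < eps -> exists de, 0 < de /\ forall s, Rabs (s - t) < de ->
     Cmod (F (z + RtoC s * h) - F (z + RtoC t * h) - RtoC (s - t) * (d * h))%C <= eps * Rabs (s - t)).
  { intros eps Heps.
    assert (Hm := Cmod_ge_0 h).
    destruct (Hd (eps / (Cmod h + 1))) as [de [Hde H]]; [apply Rdiv_lt_0_compat; lra|].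
    exists (de / (Cmod h + 1)). split; [apply Rdiv_lt_0_compat; lra|]. intros s Hs.
    assert (Hs0 := Rabs_pos (s - t)).
    assert (Hs' : Rabs (s - t) * (Cmod h + 1) < de).
    { apply (Rmult_lt_compat_r (Cmod h + 1)) in Hs; [|lra].
      unfold Rdiv in Hs. rewrite Rmult_assoc, Rinv_l in Hs; lra. }
    assert (Em : Cmod (RtoC (s - t) * h)%C = Rabs (s - t) * Cmod h) by (rewrite Cmod_mult, Cmod_R; reflexivity).
    specialize (H (RtoC (s - t) * h)%C). rewrite Em in H. specialize (H ltac:(nra)).
    replace (z + RtoC t * h + RtoC (s - t) * h)%C with (z + RtoC s * h)%C in H by (rewrite RtoC_minus; ring).
    replace (RtoC (s - t) * (d * h))%C with (d * (RtoC (s - t) * h))%C by ring.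
    eapply Rle_trans; [exact H|].
    replace (eps / (Cmod h + 1) * (Rabs (s - t) * Cmod h)) with (eps * Rabs (s - t) * (Cmod h / (Cmod h + 1))) by (field; lra).
    assert (Cmod h / (Cmod h + 1) <= 1) by (apply -> Rdiv_le_1; lra).
    rewrite <- (Rmult_1_r (eps * Rabs (s - t))) at 2. apply Rmult_le_compat_l; [nra|assumption]. }
  split; (split; [apply is_linear_scal_l|]);
  (intros x Hx; assert (Hxt : t = x) by (apply (is_filter_lim_locally_unique (K := R_AbsRing) (V := R_NormedModule)); exact Hx);
   subst x; intros eps; destruct (K eps (cond_pos eps)) as [de [Hde H]];
   exists (mkposreal de Hde); intros s Hs; specialize (H s Hs)).
  - eapply Rle_trans; [|exact H]. eapply Rle_trans; [|apply fst_le_Cmod]. apply Req_le.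
    unfold norm; simpl. unfold abs; simpl. f_equal. unfold minus, plus, opp, scal; simpl. unfold mult; simpl. ring.
  - eapply Rle_trans; [|exact H]. eapply Rle_trans; [|apply im_le_Cmod]. apply Req_le.
    unfold norm; simpl. unfold abs; simpl. f_equal. unfold minus, plus, opp, scal; simpl. unfold mult; simpl. ring.
Qed.

Lemma is_derive_continuity_pt (g : R -> R) (x l : R) : is_derive g x l -> continuity_pt g x.
Proof. intros H. apply derivable_continuous_pt. exists l. apply is_derive_Reals, H. Qed.

(** The real mean value theorem is applied after projecting F onto the direction of its total
    increment v. A comparison function [psi] is allowed instead of a constant bound, since the
    Taylor remainder needs psi proportional to t^(n+1). *)
Lemma mean_value_ineq (F F' : C -> C) (z h : C) (psi m : R -> R) :
  (forall t, 0 <= t <= 1 -> cderiv F (z + RtoC t * h)%C (F' (z + RtoC t * h)%C)) ->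
  (forall t, 0 <= t <= 1 -> is_derive psi t (m t)) ->
  (forall t, 0 <= t <= 1 -> Cmod (F' (z + RtoC t * h) * h)%C <= m t) ->
  Cmod (F (z + h) - F z)%C <= psi 1 - psi 0.
Proof.
  intros HF Hpsi Hm.
  set (v := (F (z + h) - F z)%C).
  destruct (Req_dec (Cmod v) 0) as [E|E].
  - rewrite E. destruct (MVT_gen psi 0 1 m) as [c [Hc Ec]].
    + rewrite Rmin_left, Rmax_right by lra. intros x Hx. apply Hpsi. lra.
    + rewrite Rmin_left, Rmax_right by lra. intros x Hx. eapply is_derive_continuity_pt. apply Hpsi. lra.
    + rewrite Rmin_left, Rmax_right in Hc by lra. rewrite Ec.
      pose proof (Hm c Hc). pose proof (Cmod_ge_0 (F' (z + RtoC c * h) * h)%C). lra.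
  - set (a := fst v / Cmod v). set (b := snd v / Cmod v).
    assert (Hv : fst v * fst v + snd v * snd v = Cmod v * Cmod v).
    { unfold Cmod. rewrite sqrt_sqrt; [ring|]. pose proof (pow2_ge_0 (fst v)). pose proof (pow2_ge_0 (snd v)). lra. }
    assert (Hab : a * a + b * b = 1).
    { unfold a, b. replace (fst v / Cmod v * (fst v / Cmod v) + snd v / Cmod v * (snd v / Cmod v)) with
       ((fst v * fst v + snd v * snd v) / (Cmod v * Cmod v)) by (field; exact E). rewrite Hv. field. exact E. }
    (* The unit vector (a, b) is v/|v|, so the projected increment of F is exactly |v|, while by
       Cauchy-Schwarz the derivative of [th] is nonpositive. *)
    set (th := fun t => a * fst (F (z + RtoC t * h)%C) + b * snd (F (z + RtoC t * h)%C) - psi t).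
    set (dth := fun t => a * fst (F' (z + RtoC t * h) * h)%C + b * snd (F' (z + RtoC t * h) * h)%C - m t).
    assert (Hth : forall t, 0 <= t <= 1 -> is_derive th t (dth t)).
    { intros t Ht. destruct (cderiv_path _ _ _ _ _ (HF t Ht)) as [D1 D2].
      apply (is_derive_minus (K := R_AbsRing) (V := R_NormedModule)); [|apply Hpsi, Ht].
      apply (is_derive_plus (K := R_AbsRing) (V := R_NormedModule)); apply is_derive_scal; assumption. }
    destruct (MVT_gen th 0 1 dth) as [c [Hc Ec]].
    + rewrite Rmin_left, Rmax_right by lra. intros x Hx. apply Hth. lra.
    + rewrite Rmin_left, Rmax_right by lra. intros x Hx. eapply is_derive_continuity_pt. apply Hth. lra.
    + rewrite Rmin_left, Rmax_right in Hc by lra.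
      assert (Hneg : dth c <= 0).
      { unfold dth. specialize (Hm c Hc). set (w := (F' (z + RtoC c * h) * h)%C) in *.
        assert (Hw : fst w * fst w + snd w * snd w = Cmod w * Cmod w).
        { unfold Cmod. rewrite sqrt_sqrt; [ring|]. pose proof (pow2_ge_0 (fst w)). pose proof (pow2_ge_0 (snd w)). lra. }
        assert (a * fst w + b * snd w <= Cmod w).
        { apply Rsqr_incr_0_var; [|apply Cmod_ge_0]. unfold Rsqr. rewrite <- Hw.
          pose proof (pow2_ge_0 (a * snd w - b * fst w)).
          replace (fst w * fst w + snd w * snd w) with ((a * a + b * b) * (fst w * fst w + snd w * snd w)) by (rewrite Hab; ring).
          nra. }
        lra. }
      assert (Hfin : th 1 - th 0 = Cmod v - (psi 1 - psi 0)).
      { unfold th. replace (z + RtoC 1 * h)%C with (z + h)%C by ring. replace (z + RtoC 0 * h)%C with z by ring.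
        assert (Ev : Cmod v = a * fst v + b * snd v).
        { unfold a, b. replace (fst v / Cmod v * fst v + snd v / Cmod v * snd v) with ((fst v * fst v + snd v * snd v) / Cmod v) by (field; exact E).
          rewrite Hv. field. exact E. }
        rewrite Ev. unfold v. simpl. ring. }
      lra.
Qed.

Lemma mean_value_Lipschitz (F F' : C -> C) (z h : C) (L : R) :
  (forall t, 0 <= t <= 1 -> cderiv F (z + RtoC t * h)%C (F' (z + RtoC t * h)%C)) ->
  (forall t, 0 <= t <= 1 -> Cmod (F' (z + RtoC t * h)%C) <= L) ->
  Cmod (F (z + h) - F z)%C <= L * Cmod h.
Proof.
  intros HF HL.
  replace (L * Cmod h) with (L * Cmod h * 1 - L * Cmod h * 0) by ring.
  apply (mean_value_ineq F F' z h (fun t => L * Cmod h * t) (fun _ => L * Cmod h)); [exact HF| |].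
  - intros t _. auto_derive; [trivial|ring].
  - intros t Ht. rewrite Cmod_mult. apply Rmult_le_compat_r; [apply Cmod_ge_0|apply HL, Ht].
Qed.

Lemma ball_convex (p u v : C) (r t : R) : Cmod (u - p)%C < r -> Cmod (u + v - p)%C < r -> 0 <= t <= 1 ->
  Cmod (u + RtoC t * v - p)%C < r.
Proof.
  intros Hu Hv Ht.
  replace (u + RtoC t * v - p)%C with (RtoC (1 - t) * (u - p) + RtoC t * (u + v - p))%C by (rewrite RtoC_minus; ring).
  eapply Rle_lt_trans; [apply Cmod_triangle|]. rewrite !Cmod_mult, !Cmod_R, !Rabs_pos_eq by lra.
  destruct (Req_dec t 0) as [->|]; [lra|].
  assert (t * Cmod (u + v - p)%C < t * r) by (apply Rmult_lt_compat_l; lra).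
  assert ((1 - t) * Cmod (u - p)%C <= (1 - t) * r) by (apply Rmult_le_compat_l; lra). lra.
Qed.

(** A total function, so that it can be iterated; its value is meaningful only where f is
    differentiable ([der_spec]). *)
Definition der (f : C -> C) (z : C) : C := epsilon (inhabits (RtoC 0)) (fun d => cderiv f z d).

Lemma der_spec (f : C -> C) (z : C) : (exists d, cderiv f z d) -> cderiv f z (der f z).
Proof. apply epsilon_spec. Qed.

Lemma holo_ball_sub (f : C -> C) (z u : C) (r s : R) : holo_ball f z r -> Cmod (u - z)%C + s <= r -> holo_ball f u s.
Proof.
  intros H Hs v Hv. apply H. replace (v - z)%C with ((v - u) + (u - z))%C by ring.
  eapply Rle_lt_trans; [apply Cmod_triangle|]. lra.
Qed.

Lemma dist_circle (z u : C) (rho t : R) : 0 < rho ->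
  Cmod (u + RtoC rho * cis t - z)%C <= Cmod (u - z)%C + rho.
Proof.
  intros Hr. replace (u + RtoC rho * cis t - z)%C with ((u - z) + RtoC rho * cis t)%C by ring.
  eapply Rle_trans; [apply Cmod_triangle|]. rewrite Cmod_mult, Cmod_cis, Cmod_R, Rabs_pos_eq; lra.
Qed.

(** Near z the formula 2 pi f'(v) = [circ f v rho] holds with one fixed radius, so difference
    quotients of f' are circle means of difference quotients of f. These converge uniformly on the
    circle because f' is Lipschitz, which is obtained by bootstrapping: f bounded, hence f' bounded,
    hence f Lipschitz, hence f' Lipschitz. *)
Lemma holo_der (f : C -> C) (z : C) (r0 : R) : 0 < r0 -> holo_ball f z r0 -> exists d, cderiv (der f) z d.
Proof.
  intros Hr0 Hf0. assert (Hpi := PI_RGT_0).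
  assert (Cz : Cmod (z - z)%C = 0) by (replace (z - z)%C with (RtoC 0) by ring; apply Cmod_0).
  assert (Hcz : ccts f z) by (eapply cderiv_ccts; apply der_spec, Hf0; lra).
  destruct (Hcz 1 Rlt_0_1) as [r1 [Hr1 Hb]].
  (* Continuity at z provides the initial bound [B]; every later radius is a fixed fraction of this
     [r]. *)
  set (r := Rmin r0 r1). assert (Hr : 0 < r) by (apply Rmin_pos; lra).
  assert (Hra : r <= r0) by apply Rmin_l. assert (Hrb : r <= r1) by apply Rmin_r.
  set (B := 1 + Cmod (f z)).
  assert (HB : forall u, Cmod (u - z)%C < r -> Cmod (f u) <= B).
  { intros u Hu. replace (f u) with ((f u - f z) + f z)%C by ring. eapply Rle_trans; [apply Cmod_triangle|].
    specialize (Hb u ltac:(lra)). unfold B. lra. }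
  assert (Hf : holo_ball f z r) by (eapply holo_ball_sub; [exact Hf0|lra]).
  set (L1 := B / (r / 4)).
  assert (HL1 : forall u, Cmod (u - z)%C < r / 2 -> Cmod (der f u) <= L1).
  { intros u Hu. apply (cauchy_estimate f u (der f u) B (r / 4) (r / 2)); [lra| | |].
    - eapply holo_ball_sub; [exact Hf|lra].
    - intros v Hv. apply HB. replace (v - z)%C with ((v - u) + (u - z))%C by ring.
      eapply Rle_lt_trans; [apply Cmod_triangle|]. lra.
    - apply der_spec, Hf. lra. }
  assert (HLip : forall u h, Cmod (u - z)%C < r / 2 -> Cmod (u + h - z)%C < r / 2 -> Cmod (f (u + h) - f u)%C <= L1 * Cmod h).
  { intros u h Hu Hh. apply (mean_value_Lipschitz f (der f)).
    - intros t Ht. apply der_spec, Hf. pose proof (ball_convex z u h (r / 2) t Hu Hh Ht). lra.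
    - intros t Ht. apply HL1. apply ball_convex; assumption. }
  assert (Hcts : forall u, Cmod (u - z)%C < r -> ccts f u).
  { intros u Hu. destruct (Hf u Hu) as [d Hd]. eapply cderiv_ccts; eauto. }
  set (L2 := L1 / (r / 8)).
  assert (HL1p : 0 <= L1) by (eapply Rle_trans; [apply Cmod_ge_0|apply (HL1 z); lra]).
  assert (HL2p : 0 <= L2) by (apply Rdiv_le_0_compat; lra).
  (* Subtracting the circle formulas at u + h and u, with the same radius r/8, transfers the
     Lipschitz bound from f to f'. *)
  assert (HLip2 : forall u h, Cmod (u - z)%C < r / 4 -> Cmod (u + h - z)%C < r / 4 -> Cmod (der f (u + h) - der f u)%C <= L2 * Cmod h).
  { intros u h Hu Hh.
    assert (Hc : forall v, Cmod (v - z)%C < r / 4 -> (circ f v (r / 8) = RtoC (2 * PI) * der f v)%C).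
    { intros v Hv. apply (circ_deriv f v (der f v) (r / 8) (r / 4)); [lra| |].
      - eapply holo_ball_sub; [exact Hf|lra].
      - apply der_spec, Hf. lra. }
    assert (Hcc : forall v, Cmod (v - z)%C < r / 4 -> seg_cont (fun t => f (v + RtoC (r / 8) * cis (- t)) * (cis t / RtoC (r / 8)))%C 0 (2 * PI)).
    { intros v Hv t _. apply (circ_cont f v (r / 8) (r / 4)); [lra|]. intros w Hw. apply Hcts.
      replace (w - z)%C with ((w - v) + (v - z))%C by ring. eapply Rle_lt_trans; [apply Cmod_triangle|]. lra. }
    assert (E : (RtoC (2 * PI) * (der f (u + h) - der f u))%C =
       cint (fun t => (f (u + h + RtoC (r / 8) * cis (- t)) * (cis t / RtoC (r / 8))) + (- 1) * (f (u + RtoC (r / 8) * cis (- t)) * (cis t / RtoC (r / 8))))%C 0 (2 * PI)).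
    { rewrite cint_plus; [|lra|apply Hcc, Hh|intros t Ht; apply pcont_mult; [apply pcont_const|apply Hcc; assumption]].
      rewrite cint_scal; [|lra|apply Hcc, Hu].
      change (cint (fun t => (f (u + h + RtoC (r / 8) * cis (- t)) * (cis t / RtoC (r / 8))))%C 0 (2 * PI)) with (circ f (u + h)%C (r / 8)).
      change (cint (fun t => (f (u + RtoC (r / 8) * cis (- t)) * (cis t / RtoC (r / 8))))%C 0 (2 * PI)) with (circ f u (r / 8)).
      rewrite !Hc by assumption. ring. }
    apply (Rmult_le_reg_l (2 * PI)); [lra|].
    replace (2 * PI * Cmod (der f (u + h) - der f u)%C) with (Cmod (RtoC (2 * PI) * (der f (u + h) - der f u))%C)
      by (rewrite Cmod_mult, Cmod_R, Rabs_pos_eq; lra).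
    rewrite E. replace (2 * PI * (L2 * Cmod h)) with (L2 * Cmod h * (2 * PI - 0)) by ring.
    apply cint_bound; [lra| |].
    - intros t Ht. apply pcont_plus; [apply Hcc; assumption|]. apply pcont_mult; [apply pcont_const|apply Hcc; assumption].
    - intros t _. set (k := (RtoC (r / 8) * cis (- t))%C).
      replace (f (u + h + k) * (cis t / RtoC (r / 8)) + - 1 * (f (u + k) * (cis t / RtoC (r / 8))))%C with
        ((f (u + k + h) - f (u + k)) * (cis t / RtoC (r / 8)))%C by (replace (u + h + k)%C with (u + k + h)%C by ring; ring).
      rewrite Cmod_mult, cis_over_norm by lra. unfold L2, Rdiv.
      replace (L1 * / (r * / 8) * Cmod h) with (L1 * Cmod h * / (r * / 8)) by ring.
      apply Rmult_le_compat_r; [left; apply Rinv_0_lt_compat; lra|].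
      pose proof (dist_circle z u (r / 8) (- t)) as G1. pose proof (dist_circle z (u + h)%C (r / 8) (- t)) as G2.
      fold k in G1, G2. apply HLip.
      + lra.
      + replace (u + k + h - z)%C with (u + h + k - z)%C by ring. lra. }
  (* The mean value inequality for w -> f(w) - f'(u) w, whose derivative f'(w) - f'(u) is at most L2
     |h| on the segment. *)
  assert (HQ : forall u h, Cmod (u - z)%C < r / 8 -> Cmod h < r / 8 -> Cmod (f (u + h) - f u - der f u * h)%C <= L2 * Cmod h * Cmod h).
  { intros u h Hu Hh.
    assert (Huh : Cmod (u + h - z)%C < r / 4).
    { replace (u + h - z)%C with ((u - z) + h)%C by ring. eapply Rle_lt_trans; [apply Cmod_triangle|]. lra. }
    replace (f (u + h) - f u - der f u * h)%C with
      ((f (u + h) + - (der f u) * (u + h)) - (f u + - (der f u) * u))%C by ring.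
    apply (mean_value_Lipschitz (fun w => f w + - (der f u) * w)%C (fun w => der f w - der f u)%C).
    - intros t Ht. unfold Cminus. apply (cderiv_plus f (fun w => - der f u * w)%C).
      + apply der_spec, Hf. pose proof (ball_convex z u h (r / 4) t ltac:(lra) Huh Ht). lra.
      + apply (cderiv_eq _ _ (- der f u)%C); [|reflexivity].
        apply (cderiv_ext_loc (fun w => 0 + - der f u * w)%C _ _ _ 1); [lra|intros; ring|apply cderiv_lin].
    - intros t Ht. eapply Rle_trans; [apply HLip2|].
      + lra.
      + apply ball_convex; lra.
      + rewrite Cmod_mult, Cmod_R, Rabs_pos_eq by lra. pose proof (Cmod_ge_0 h).
        apply Rmult_le_compat_l; [exact HL2p|]. nra. }
  set (rho := r / 16).
  assert (Hrho : 0 < rho) by (unfold rho; lra).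
  (* The candidate is what differentiation under the integral sign predicts. *)
  exists (circ (der f) z rho / RtoC (2 * PI))%C.
  rewrite cderivE. intros eps Heps.
  set (de := Rmin rho (eps * rho / (L2 + 1))).
  assert (Hde : 0 < de) by (apply Rmin_pos; [lra|apply Rdiv_lt_0_compat; nra]).
  exists de; split; [exact Hde|]. intros h Hh.
  assert (Hh1 : Cmod h < rho) by (eapply Rlt_le_trans; [exact Hh|apply Rmin_l]).
  assert (Hh2 : Cmod h * (L2 + 1) <= eps * rho).
  { assert (Hh2 : Cmod h < eps * rho / (L2 + 1)) by (eapply Rlt_le_trans; [exact Hh|apply Rmin_r]).
    apply (Rmult_lt_compat_r (L2 + 1)) in Hh2; [|lra]. unfold Rdiv in Hh2. rewrite Rmult_assoc, Rinv_l in Hh2; lra. }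
  assert (Hzh : Cmod (z + h - z)%C < rho) by (replace (z + h - z)%C with h by ring; exact Hh1).
  assert (Hc : forall v, Cmod (v - z)%C < rho -> (circ f v rho = RtoC (2 * PI) * der f v)%C).
  { intros v Hv. apply (circ_deriv f v (der f v) rho (2 * rho)); [lra| |].
    - eapply holo_ball_sub; [exact Hf|unfold rho in *; lra].
    - apply der_spec, Hf. unfold rho in *; lra. }
  assert (Hcc : forall v, Cmod (v - z)%C < rho -> seg_cont (fun t => f (v + RtoC rho * cis (- t)) * (cis t / RtoC rho))%C 0 (2 * PI)).
  { intros v Hv t _. apply (circ_cont f v rho (2 * rho)); [lra|]. intros w Hw. apply Hcts.
    replace (w - z)%C with ((w - v) + (v - z))%C by ring. eapply Rle_lt_trans; [apply Cmod_triangle|]. unfold rho in *; lra. }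
  (* Differentiability of f' is what is being proved, so its continuity on the circle is taken from
     the Lipschitz bound [HLip2]. *)
  assert (Hcd : seg_cont (fun t => der f (z + RtoC rho * cis (- t)) * (cis t / RtoC rho))%C 0 (2 * PI)).
  { intros t _. apply (circ_cont (der f) z rho (2 * rho)); [lra|]. intros w Hw e He.
    exists (Rmin rho (e / (L2 + 1))). split; [apply Rmin_pos; [lra|apply Rdiv_lt_0_compat; lra]|].
    intros x Hx. assert (X1 : Cmod (x - w)%C < rho) by (eapply Rlt_le_trans; [exact Hx|apply Rmin_l]).
    assert (X2 : Cmod (x - w)%C < e / (L2 + 1)) by (eapply Rlt_le_trans; [exact Hx|apply Rmin_r]).
    replace x with (w + (x - w))%C at 1 by ring. eapply Rle_lt_trans; [apply HLip2|].
    - unfold rho in *; lra.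
    - replace (w + (x - w) - z)%C with ((x - w) + (w - z))%C by ring.
      eapply Rle_lt_trans; [apply Cmod_triangle|]. unfold rho in *; lra.
    - apply (Rmult_lt_compat_r (L2 + 1)) in X2; [|lra]. unfold Rdiv in X2. rewrite Rmult_assoc, Rinv_l in X2 by lra.
      pose proof (Cmod_ge_0 (x - w)%C). lra. }
  apply (Rmult_le_reg_l (2 * PI)); [lra|].
  assert (NP : RtoC (2 * PI) <> 0%C) by (intros Hc0; apply RtoC_inj in Hc0; lra).
  replace (2 * PI * Cmod (der f (z + h) - der f z - circ (der f) z rho / RtoC (2 * PI) * h)%C) with
    (Cmod (circ f (z + h) rho + - 1 * (circ f z rho + h * circ (der f) z rho))%C).
  2:{ rewrite !Hc by lra. rewrite <- (Rabs_pos_eq (2 * PI)) at 3 by lra. rewrite <- Cmod_R, <- Cmod_mult.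
      f_equal. field. exact NP. }
  unfold circ.
  rewrite <- cint_scal; [|lra|exact Hcd].
  rewrite <- cint_plus; [|lra|apply Hcc; lra|intros t Ht; apply pcont_mult; [apply pcont_const|apply Hcd, Ht]].
  rewrite <- cint_scal; [|lra|intros t Ht; apply pcont_plus; [apply Hcc; [lra|exact Ht]|apply pcont_mult; [apply pcont_const|apply Hcd, Ht]]].
  rewrite <- cint_plus; [|lra|apply Hcc; lra|
    intros t Ht; apply pcont_mult; [apply pcont_const|]; apply pcont_plus; [apply Hcc; [lra|exact Ht]|apply pcont_mult; [apply pcont_const|apply Hcd, Ht]]].
  replace (2 * PI * (eps * Cmod h)) with (eps * Cmod h * (2 * PI - 0)) by ring.
  apply cint_bound; [lra| |].
  - intros t Ht. apply pcont_plus; [apply Hcc; [lra|exact Ht]|]. apply pcont_mult; [apply pcont_const|].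
    apply pcont_plus; [apply Hcc; [lra|exact Ht]|apply pcont_mult; [apply pcont_const|apply Hcd, Ht]].
  - intros t _. set (k := (RtoC rho * cis (- t))%C).
    replace (f (z + h + k) * (cis t / RtoC rho) + - 1 * (f (z + k) * (cis t / RtoC rho) + h * (der f (z + k) * (cis t / RtoC rho))))%C
      with ((f (z + k + h) - f (z + k) - der f (z + k) * h) * (cis t / RtoC rho))%C
      by (replace (z + h + k)%C with (z + k + h)%C by ring; ring).
    rewrite Cmod_mult, cis_over_norm by lra.
    assert (G : Cmod (f (z + k + h) - f (z + k) - der f (z + k) * h)%C <= L2 * Cmod h * Cmod h).
    { apply HQ; [|unfold rho in *; lra].
      pose proof (dist_circle z z rho (- t) Hrho) as G. fold k in G. unfold rho in *; lra. }
    apply (Rmult_le_reg_r rho); [lra|]. rewrite Rmult_assoc, Rinv_l by lra.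
    pose proof (Cmod_ge_0 h). nra.
Qed.

(** * Taylor expansion *)

Fixpoint csum (u : nat -> C) (n : nat) : C :=
  match n with O => 0%C | S m => (csum u m + u m)%C end.

(** The derivative is taken on the inside, so that an induction on n passes from f to [der f]. *)
Fixpoint dern (n : nat) (f : C -> C) : C -> C :=
  match n with O => f | S m => dern m (der f) end.

(** Here n counts terms: the degree in h is below n and the remainder is of order n. *)
Definition tay (n : nat) (f : C -> C) (z h : C) : C :=
  csum (fun k => dern k f z * / RtoC (INR (fact k)) * h ^ k)%C n.

Lemma INR_fact_neq (k : nat) : RtoC (INR (fact k)) <> 0%C.
Proof. intros H. apply RtoC_inj in H. exact (INR_fact_neq_0 k H). Qed.

Lemma csum_ext (u v : nat -> C) (n : nat) : (forall k, (k < n)%nat -> u k = v k) -> csum u n = csum v n.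
Proof. induction n; intros H; simpl; [reflexivity|]. rewrite IHn, H; auto. Qed.

Lemma csum_S_l (u : nat -> C) (n : nat) : csum u (S n) = (u O + csum (fun k => u (S k)) n)%C.
Proof. induction n; [simpl; ring|]. change (csum u (S (S n))) with (csum u (S n) + u (S n))%C. rewrite IHn. simpl. ring. Qed.

Lemma cderiv_pow (n : nat) (z : C) : cderiv (fun h => h ^ S n)%C z (RtoC (INR (S n)) * z ^ n)%C.
Proof.
  induction n.
  - apply (cderiv_eq _ _ 1%C); [|simpl; ring].
    apply (cderiv_ext_loc (fun u => u) _ _ _ 1); [lra|intros; simpl; ring|apply cderiv_id].
  - refine (cderiv_eq _ _ _ _ (cderiv_mult (fun h => h) (fun h => h ^ S n)%C z _ _ (cderiv_id z) IHn) _).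
    rewrite (S_INR (S n)), RtoC_plus. simpl. ring.
Qed.

Lemma cderiv_tay (n : nat) (f : C -> C) (z h : C) : cderiv (tay (S n) f z) h (tay n (der f) z h).
Proof.
  induction n.
  - unfold tay at 2. simpl. apply (cderiv_ext_loc (fun _ => (0 + dern 0 f z * / RtoC (INR (fact 0)) * 1)%C) _ _ _ 1);
    [lra|intros; reflexivity|apply cderiv_const].
  - apply (cderiv_plus (tay (S n) f z) (fun h => dern (S n) f z * / RtoC (INR (fact (S n))) * h ^ (S n))%C); [exact IHn|].
    refine (cderiv_eq _ _ _ _ (cderiv_mult (fun _ => dern (S n) f z * / RtoC (INR (fact (S n))))%C
       (fun h => h ^ S n)%C h _ _ (cderiv_const _ h) (cderiv_pow n h)) _).
    change (dern (S n) f) with (dern n (der f)).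
    change (fact (S n)) with (S n * fact n)%nat. rewrite mult_INR, RtoC_mult.
    field. split; [apply INR_fact_neq|]. intros H; apply RtoC_inj in H. revert H. apply not_0_INR. lia.
Qed.

Lemma tay_0 (n : nat) (f : C -> C) (z : C) : tay (S n) f z 0%C = f z.
Proof.
  unfold tay. rewrite csum_S_l. rewrite (csum_ext _ (fun _ => 0%C)).
  - assert (E : forall m, csum (fun _ => 0%C) m = 0%C) by (induction m; simpl; [reflexivity|rewrite IHm; ring]).
    rewrite E. simpl. rewrite <- RtoC_inv by lra. rewrite Rinv_1. ring.
  - intros k _. simpl. ring.
Qed.

Lemma holo_ball_der (f : C -> C) (z : C) (r : R) : holo_ball f z r -> holo_ball (der f) z r.
Proof.
  intros H u Hu. apply (holo_der f u (r - Cmod (u - z)%C)); [lra|]. eapply holo_ball_sub; [exact H|lra].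
Qed.

Lemma holo_ball_dern (n : nat) : forall (f : C -> C) (z : C) (r : R), holo_ball f z r -> holo_ball (dern n f) z r.
Proof. induction n; intros f z r H; [exact H|]. apply IHn, holo_ball_der, H. Qed.

(** The remainder as a function of h vanishes at 0 and its derivative is the remainder of order n
    for f'. Along the segment the induction hypothesis bounds that derivative by a multiple of t^n,
    and [mean_value_ineq] integrates the bound. *)
Lemma taylor_remainder (n : nat) : forall (f : C -> C) (z h : C) (r B : R),
  holo_ball f z r -> (forall u, Cmod (u - z)%C < r -> Cmod (dern n f u) <= B) -> Cmod h < r ->
  Cmod (f (z + h) - tay n f z h)%C <= B * Cmod h ^ n / INR (fact n).
Proof.
  induction n; intros f z h r B Hf HB Hh.
  - unfold tay; simpl. replace (f (z + h) - 0)%C with (f (z + h)%C) by ring.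
    replace (B * 1 / 1) with B by field. apply HB. replace (z + h - z)%C with h by ring. exact Hh.
  - set (F := fun k => (f (z + k) - tay (S n) f z k)%C).
    assert (EF : (F (0 + h) - F 0)%C = (f (z + h) - tay (S n) f z h)%C).
    { unfold F. rewrite tay_0. replace (z + 0)%C with z by ring. replace (0 + h)%C with h by ring. ring. }
    rewrite <- EF.
    assert (Hfn := INR_fact_lt_0 n). assert (Hfn' := INR_fact_lt_0 (S n)).
    set (m := Cmod h) in *.
    assert (EFS : INR (fact (S n)) = INR (S n) * INR (fact n)) by (rewrite <- mult_INR; reflexivity).
    set (FS := INR (fact (S n))) in *.
    replace (B * m ^ S n / FS) with
      (B * m ^ S n / FS * 1 ^ S n - B * m ^ S n / FS * 0 ^ S n)
      by (rewrite pow1; simpl; ring).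
    apply (mean_value_ineq F (fun k => der f (z + k) - tay n (der f) z k)%C 0%C h
       (fun t => B * m ^ S n / FS * t ^ S n)
       (fun t => B * m ^ S n / INR (fact n) * t ^ n)).
    + intros t Ht. unfold F, Cminus.
      apply (cderiv_plus (fun k => f (z + k)%C) (fun k => - tay (S n) f z k)%C).
      * refine (cderiv_eq _ _ _ _ (cderiv_comp f (fun k => z + k)%C _ _ _ _
          (cderiv_plus (fun _ => z) (fun k => k) _ _ _ (cderiv_const _ _) (cderiv_id _))) _).
        -- apply der_spec, Hf. replace (z + (0 + RtoC t * h) - z)%C with (RtoC t * h)%C by ring.
           rewrite Cmod_mult, Cmod_R, Rabs_pos_eq by lra. fold m. pose proof (Cmod_ge_0 h). fold m in H. nra.
        -- ring.
      * apply cderiv_opp, cderiv_tay.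
    + intros t _. auto_derive; [trivial|].
      rewrite EFS.
      change (match n with O => 1 | S _ => INR n + 1 end) with (INR (S n)).
      assert (INR (S n) <> 0) by (apply not_0_INR; lia).
      simpl pow. field. split; [lra|assumption].
    + intros t Ht. replace (0 + RtoC t * h)%C with (RtoC t * h)%C by ring.
      rewrite Cmod_mult.
      assert (Em : Cmod (RtoC t * h)%C = t * m) by (rewrite Cmod_mult, Cmod_R, Rabs_pos_eq; [reflexivity|lra]).
      assert (Hm : 0 <= m) by apply Cmod_ge_0.
      pose proof (IHn (der f) z (RtoC t * h)%C r B (holo_ball_der _ _ _ Hf) HB ltac:(rewrite Em; nra)) as H.
      rewrite Em in H.
      apply (Rmult_le_compat_r m) in H; [|exact Hm]. eapply Rle_trans; [exact H|].
      apply Req_le. rewrite Rpow_mult_distr. simpl. field. lra.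
Qed.

(** Each differentiation gives up a margin [de] of the radius; the first-order Cauchy estimate on a
    circle of radius de/2 costs the factor 2/de. *)
Lemma dern_bound (n : nat) : forall (f : C -> C) (z : C) (r de B : R), 0 < de ->
  holo_ball f z (r + INR n * de) -> (forall u, Cmod (u - z)%C < r + INR n * de -> Cmod (f u) <= B) ->
  forall u, Cmod (u - z)%C < r -> Cmod (dern n f u) <= B * (2 / de) ^ n.
Proof.
  induction n; intros f z r de B Hde Hf HB u Hu.
  - simpl in *. rewrite Rmult_1_r. apply HB. lra.
  - rewrite S_INR in Hf, HB. simpl.
    replace (B * (2 / de * (2 / de) ^ n)) with (B / (de / 2) * (2 / de) ^ n) by (field; lra).
    apply (IHn (der f) z r de); [exact Hde| | |exact Hu].
    + apply holo_ball_der. intros v Hv. apply Hf. lra.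
    + intros v Hv. assert (HR : holo_ball f v de) by (eapply holo_ball_sub; [exact Hf|lra]).
      apply (cauchy_estimate f v _ B (de / 2) de); [lra|exact HR| |].
      * intros w Hw. apply HB. replace (w - z)%C with ((w - v) + (v - z))%C by ring.
        eapply Rle_lt_trans; [apply Cmod_triangle|]. lra.
      * apply der_spec, HR. replace (v - v)%C with (RtoC 0) by ring. rewrite Cmod_0. exact Hde.
Qed.

(** A crude Stirling bound, by induction from (1 + 1/m)^m <= e <= 3. *)
Lemma pow_self_le_fact (n : nat) : INR n ^ n <= 3 ^ n * INR (fact n).
Proof.
  induction n; [simpl; lra|].
  destruct n as [|n]; [simpl; lra|]. set (m := S n) in *.
  assert (Hm : 0 < INR m) by (apply lt_0_INR; unfold m; lia).
  assert (E : INR (S m) ^ m <= 3 * INR m ^ m).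
  { rewrite S_INR. replace (INR m + 1) with (INR m * (1 + / INR m)) by (field; lra).
    rewrite Rpow_mult_distr, Rmult_comm. apply Rmult_le_compat_r; [apply pow_le; lra|].
    eapply Rle_trans; [|apply exp_le_3].
    assert (Hi : 0 < / INR m) by (apply Rinv_0_lt_compat, Hm).
    eapply Rle_trans; [apply pow_incr; split; [lra|left; apply exp_ineq1; lra]|].
    assert (P : forall k, exp (/ INR m) ^ k = exp (INR k * / INR m)).
    { induction k; [simpl; rewrite Rmult_0_l, exp_0; reflexivity|].
      rewrite S_INR, Rmult_plus_distr_r, exp_plus, Rmult_1_l, <- IHk. simpl. ring. }
    rewrite P, Rinv_r by lra. lra. }
  change (fact (S m)) with (S m * fact m)%nat. rewrite mult_INR.
  change (INR (S m) ^ S m) with (INR (S m) * INR (S m) ^ m). change (3 ^ S m) with (3 * 3 ^ m).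
  assert (0 < INR (S m)) by (apply lt_0_INR; lia).
  replace (3 * 3 ^ m * (INR (S m) * INR (fact m))) with (INR (S m) * (3 * (3 ^ m * INR (fact m)))) by ring.
  apply Rmult_le_compat_l; lra.
Qed.

(** The margin r is shared equally among the n differentiations, which gives (2n/r)^n, and n^n is
    traded for 3^n n!. Hence the constant 6 = 2 * 3; the loss against the sharp estimate is
    harmless, as only geometric growth matters. *)
Lemma dern_cauchy (n : nat) (f : C -> C) (z : C) (r B : R) : 0 < r ->
  holo_ball f z (2 * r) -> (forall u, Cmod (u - z)%C < 2 * r -> Cmod (f u) <= B) ->
  forall u, Cmod (u - z)%C < r -> Cmod (dern n f u) <= B * (6 / r) ^ n * INR (fact n).
Proof.
  intros Hr Hf HB u Hu.
  assert (HB0 : 0 <= B) by (eapply Rle_trans; [apply Cmod_ge_0|apply (HB u); lra]).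
  destruct n as [|n]; [simpl; rewrite !Rmult_1_r; apply HB; lra|]. set (m := S n) in *.
  assert (Hm : 0 < INR m) by (apply lt_0_INR; unfold m; lia).
  assert (E : r + INR m * (r / INR m) = 2 * r) by (field; lra).
  eapply Rle_trans; [apply (dern_bound m f z r (r / INR m) B); [apply Rdiv_lt_0_compat; lra|rewrite E; exact Hf|rewrite E; exact HB|exact Hu]|].
  rewrite Rmult_assoc. apply Rmult_le_compat_l; [exact HB0|].
  replace (2 / (r / INR m)) with (2 / r * INR m) by (field; lra).
  replace (6 / r) with (2 / r * 3) by (field; lra).
  rewrite !Rpow_mult_distr, Rmult_assoc. apply Rmult_le_compat_l; [apply pow_le, Rdiv_le_0_compat; lra|].
  apply pow_self_le_fact.
Qed.

Lemma taylor_bound (n : nat) (f : C -> C) (z h : C) (r B : R) : 0 < r ->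
  holo_ball f z (2 * r) -> (forall u, Cmod (u - z)%C < 2 * r -> Cmod (f u) <= B) -> Cmod h < r ->
  Cmod (f (z + h) - tay n f z h)%C <= B * (6 * Cmod h / r) ^ n.
Proof.
  intros Hr Hf HB Hh.
  eapply Rle_trans; [apply (taylor_remainder n f z h r (B * (6 / r) ^ n * INR (fact n))); [|apply dern_cauchy; assumption|exact Hh]|].
  - intros u Hu. apply Hf. lra.
  - apply Req_le. replace (6 * Cmod h / r) with (6 / r * Cmod h) by (field; lra). rewrite Rpow_mult_distr.
    field. apply INR_fact_neq_0.
Qed.

(** * Finite and infinite sums *)

Definition lsum (F : R -> C) (l : list R) : C := Csum_list F l.

Lemma lsum_cons (F : R -> C) (x : R) (l : list R) : lsum F (x :: l) = (F x + lsum F l)%C.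
Proof. reflexivity. Qed.

Lemma lsum_ext (F G : R -> C) (l : list R) : (forall x, In x l -> F x = G x) -> lsum F l = lsum G l.
Proof.
  induction l; intros H; [reflexivity|]. rewrite !lsum_cons, IHl, H; [reflexivity|left; auto|].
  intros x Hx; apply H; right; exact Hx.
Qed.

Lemma lsum_plus (F G : R -> C) (l : list R) : lsum (fun x => F x + G x)%C l = (lsum F l + lsum G l)%C.
Proof. induction l; [unfold lsum; simpl; apply injective_projections; simpl; ring|]. rewrite !lsum_cons, IHl. ring. Qed.

Lemma lsum_scal (k : C) (F : R -> C) (l : list R) : lsum (fun x => k * F x)%C l = (k * lsum F l)%C.
Proof. induction l; [unfold lsum; simpl; apply injective_projections; simpl; ring|]. rewrite !lsum_cons, IHl. ring. Qed.

Lemma lsum_app (F : R -> C) (l l' : list R) : lsum F (l ++ l') = (lsum F l + lsum F l')%C.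
Proof.
  induction l; [unfold lsum; simpl; apply injective_projections; simpl; ring|].
  simpl app. rewrite !lsum_cons, IHl. ring.
Qed.

Lemma lsum_perm (F : R -> C) (l l' : list R) : Permutation l l' -> lsum F l = lsum F l'.
Proof.
  induction 1; [reflexivity|rewrite !lsum_cons, IHPermutation; reflexivity| |congruence].
  rewrite !lsum_cons. ring.
Qed.

Lemma Rsum_list_app (F : R -> R) (l l' : list R) : Rsum_list F (l ++ l') = Rsum_list F l + Rsum_list F l'.
Proof. induction l; simpl; [ring|]. rewrite IHl. ring. Qed.

Lemma Rsum_list_le (F G : R -> R) (l : list R) : (forall x, In x l -> F x <= G x) -> Rsum_list F l <= Rsum_list G l.
Proof.
  induction l; intros H; simpl; [lra|]. apply Rplus_le_compat; [apply H; left; auto|].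
  apply IHl. intros x Hx; apply H; right; exact Hx.
Qed.

Lemma Rsum_list_plus (F G : R -> R) (l : list R) : Rsum_list (fun x => F x + G x) l = Rsum_list F l + Rsum_list G l.
Proof. induction l; simpl; [ring|]. rewrite IHl. ring. Qed.

Lemma Rsum_list_scal (k : R) (F : R -> R) (l : list R) : Rsum_list (fun x => k * F x) l = k * Rsum_list F l.
Proof. induction l; simpl; [ring|]. rewrite IHl. ring. Qed.

Lemma Rsum_list_nonneg (F : R -> R) (l : list R) : (forall x, In x l -> 0 <= F x) -> 0 <= Rsum_list F l.
Proof.
  intros H. replace 0 with (Rsum_list (fun _ => 0) l) by (clear; induction l; simpl; lra).
  apply Rsum_list_le, H.
Qed.

Lemma Cmod_lsum_le (F : R -> C) (l : list R) : Cmod (lsum F l) <= Rsum_list (fun x => Cmod (F x)) l.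
Proof.
  induction l; [unfold lsum; simpl; change (Cmod (RtoC 0) <= 0); rewrite Cmod_0; lra|].
  rewrite lsum_cons. simpl. eapply Rle_trans; [apply Cmod_triangle|]. lra.
Qed.

Lemma finsub_In (Lam : R -> Prop) (l : list R) (x : R) : finsub Lam l -> In x l -> Lam x.
Proof. intros [_ H] Hx. rewrite Forall_forall in H. auto. Qed.

(** * Unordered sums over a set of exponents, and ordinary series *)

Definition hsum (Lam : R -> Prop) (F : R -> C) (S : C) : Prop := Chas_sum Lam F S.

Lemma hsumE (Lam : R -> Prop) (F : R -> C) (S : C) : hsum Lam F S <->
  forall eps, 0 < eps -> exists l0, finsub Lam l0 /\
    forall l, finsub Lam l -> incl l0 l -> Cmod (lsum F l - S)%C < eps.
Proof. apply iff_refl. Qed.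

Lemma finsub_union (Lam : R -> Prop) (l1 l2 : list R) : finsub Lam l1 -> finsub Lam l2 ->
  exists l, finsub Lam l /\ incl l1 l /\ incl l2 l.
Proof.
  intros H1 H2. exists (nodup Req_dec_T (l1 ++ l2)). split; [split|split].
  - apply NoDup_nodup.
  - apply Forall_forall. intros x Hx. apply nodup_In, in_app_or in Hx.
    destruct Hx; [exact (finsub_In _ _ _ H1 H)|exact (finsub_In _ _ _ H2 H)].
  - intros y Hy. apply nodup_In, in_or_app. auto.
  - intros y Hy. apply nodup_In, in_or_app. auto.
Qed.

Lemma hsum_unique (Lam : R -> Prop) (F : R -> C) (S S' : C) : hsum Lam F S -> hsum Lam F S' -> S = S'.
Proof.
  rewrite !hsumE. intros H1 H2. apply Ceq_minus, Cmod_eq_0, Rle_antisym; [|apply Cmod_ge_0].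
  apply le_epsilon. intros eps Heps.
  destruct (H1 (eps / 2)) as [l1 [F1 P1]]; [lra|]. destruct (H2 (eps / 2)) as [l2 [F2 P2]]; [lra|].
  destruct (finsub_union Lam l1 l2 F1 F2) as [l [Fl [I1 I2]]].
  specialize (P1 l Fl I1). specialize (P2 l Fl I2).
  replace (S - S')%C with ((lsum F l - S') + - (lsum F l - S))%C by ring.
  eapply Rle_trans; [apply Cmod_triangle|]. rewrite Cmod_opp. lra.
Qed.

Lemma hsum_ext (Lam : R -> Prop) (F G : R -> C) (S : C) : (forall x, Lam x -> F x = G x) -> hsum Lam F S -> hsum Lam G S.
Proof.
  rewrite !hsumE. intros HE H eps Heps. destruct (H eps Heps) as [l0 [F0 P0]].
  exists l0; split; [exact F0|]. intros l Fl Hl. rewrite <- (lsum_ext F G); [apply P0; assumption|].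
  intros x Hx. apply HE. eapply finsub_In; eauto.
Qed.

Lemma hsum_plus (Lam : R -> Prop) (F G : R -> C) (S S' : C) : hsum Lam F S -> hsum Lam G S' ->
  hsum Lam (fun x => F x + G x)%C (S + S')%C.
Proof.
  rewrite !hsumE. intros H1 H2 eps Heps.
  destruct (H1 (eps / 2)) as [l1 [F1 P1]]; [lra|]. destruct (H2 (eps / 2)) as [l2 [F2 P2]]; [lra|].
  destruct (finsub_union Lam l1 l2 F1 F2) as [l0 [Fl [I1 I2]]].
  exists l0; split; [exact Fl|]. intros l Hl Hi.
  specialize (P1 l Hl (incl_tran I1 Hi)). specialize (P2 l Hl (incl_tran I2 Hi)).
  rewrite lsum_plus. replace (lsum F l + lsum G l - (S + S'))%C with ((lsum F l - S) + (lsum G l - S'))%C by ring.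
  eapply Rle_lt_trans; [apply Cmod_triangle|]. lra.
Qed.

Lemma hsum_zero (Lam : R -> Prop) (F : R -> C) : (forall x, Lam x -> F x = 0%C) -> hsum Lam F 0%C.
Proof.
  rewrite hsumE. intros H eps Heps. exists nil. split; [split; constructor|]. intros l Hl _.
  replace (lsum F l - 0)%C with (RtoC 0); [rewrite Cmod_0; exact Heps|].
  assert (E : lsum F l = 0%C).
  { rewrite (lsum_ext F (fun _ => 0 * 0)%C) by (intros x Hx; rewrite H by (eapply finsub_In; eauto); ring).
    rewrite lsum_scal. ring. }
  rewrite E. ring.
Qed.

Definition cv (u : nat -> C) (l : C) : Prop :=
  forall eps, 0 < eps -> exists N, forall n, (N <= n)%nat -> Cmod (u n - l)%C < eps.

Fixpoint rsum (u : nat -> R) (n : nat) : R :=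
  match n with O => 0 | S m => rsum u m + u m end.

Lemma rsum_le (u v : nat -> R) (n : nat) : (forall k, u k <= v k) -> rsum u n <= rsum v n.
Proof. intros H; induction n; simpl; [lra|]. specialize (H n). lra. Qed.

Lemma rsum_scal (k : R) (u : nat -> R) (n : nat) : rsum (fun j => k * u j) n = k * rsum u n.
Proof. induction n; simpl; [ring|]. rewrite IHn. ring. Qed.

Lemma rsum_incr (u : nat -> R) (n m : nat) : (forall k, 0 <= u k) -> (n <= m)%nat -> rsum u n <= rsum u m.
Proof. intros H; induction 1; simpl; [lra|]. specialize (H m). lra. Qed.

Lemma rsum_tail (K : nat -> R) (M : R) : (forall n, 0 <= K n) -> (forall N, rsum K N <= M) ->
  forall eps, 0 < eps -> exists N, forall n m, (N <= n)%nat -> (n <= m)%nat -> rsum K m <= rsum K n + eps.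
Proof.
  intros HK HM eps Heps.
  destruct (completeness (fun x => exists n, x = rsum K n)) as [l [Hl1 Hl2]].
  - exists M. intros x [n ->]. apply HM.
  - exists 0, O. reflexivity.
  - destruct (classic (exists N, l - eps < rsum K N)) as [[N HN]|HN].
    + exists N. intros n m Hn Hm. pose proof (rsum_incr K N n HK Hn).
      assert (rsum K m <= l) by (apply Hl1; exists m; reflexivity). lra.
    + exfalso. assert (l <= l - eps); [|lra]. apply Hl2. intros x [n ->].
      apply Rnot_lt_le. intros H. apply HN. exists n. exact H.
Qed.

Lemma csum_diff_bound (u : nat -> C) (K : nat -> R) (n m : nat) : (forall k, Cmod (u k) <= K k) -> (n <= m)%nat ->
  Cmod (csum u m - csum u n)%C <= rsum K m - rsum K n.
Proof.
  intros H; induction 1; [replace (csum u n - csum u n)%C with (RtoC 0) by ring; rewrite Cmod_0; lra|].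
  simpl. replace (csum u m + u m - csum u n)%C with ((csum u m - csum u n) + u m)%C by ring.
  eapply Rle_trans; [apply Cmod_triangle|]. specialize (H m). lra.
Qed.

Lemma csum_cv (u : nat -> C) (K : nat -> R) (M : R) : (forall k, Cmod (u k) <= K k) -> (forall N, rsum K N <= M) ->
  exists l, cv (csum u) l.
Proof.
  intros HK HM.
  assert (HK0 : forall k, 0 <= K k) by (intros k; eapply Rle_trans; [apply Cmod_ge_0|apply HK]).
  assert (HC : forall eps, 0 < eps -> exists N, forall n m, (N <= n)%nat -> (N <= m)%nat -> Cmod (csum u n - csum u m)%C < eps).
  { intros eps Heps. destruct (rsum_tail K M HK0 HM (eps / 2)) as [N HN]; [lra|]. exists N. intros n m Hn Hm.
    destruct (Nat.le_ge_cases n m) as [Hnm|Hnm].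
    - replace (csum u n - csum u m)%C with (- (csum u m - csum u n))%C by ring. rewrite Cmod_opp.
      eapply Rle_lt_trans; [apply (csum_diff_bound u K); assumption|]. specialize (HN n m Hn Hnm). lra.
    - eapply Rle_lt_trans; [apply (csum_diff_bound u K); assumption|]. specialize (HN m n Hm Hnm). lra. }
  destruct (Rcomplete.R_complete (fun n => fst (csum u n))) as [x Hx].
  { intros eps Heps. destruct (HC eps Heps) as [N HN]. exists N. intros n m Hn Hm.
    eapply Rle_lt_trans; [apply (fst_le_Cmod (csum u n - csum u m)%C)|]. apply HN; lia. }
  destruct (Rcomplete.R_complete (fun n => snd (csum u n))) as [y Hy].
  { intros eps Heps. destruct (HC eps Heps) as [N HN]. exists N. intros n m Hn Hm.
    eapply Rle_lt_trans; [apply (im_le_Cmod (csum u n - csum u m)%C)|]. apply HN; lia. }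
  exists (x, y). intros eps Heps.
  destruct (Hx (eps / 2)) as [N1 H1]; [lra|]. destruct (Hy (eps / 2)) as [N2 H2]; [lra|].
  exists (max N1 N2). intros n Hn. specialize (H1 n ltac:(lia)). specialize (H2 n ltac:(lia)).
  eapply Rle_lt_trans; [apply Cmod_le_sum|]. unfold Rdist in *. simpl. unfold Rminus in *. lra.
Qed.

(** * Functions represented by a weighted Dirichlet series *)

Definition dterm (a : R -> C) (s : C) (l : R) : C := (a l * cexp (RtoC (- l) * s))%C.
Definition wsum (w : R -> R) (a : R -> C) (l : list R) : R := Rsum_list (fun x => Cmod (a x) * w x) l.
Definition norm_le (Lam : R -> Prop) (w : R -> R) (a : R -> C) (K : R) : Prop :=
  forall l, finsub Lam l -> wsum w a l <= K.
(** On the closed half-plane g is the transform of an element of norm at most K. The coefficients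
    are hidden, since most later arguments only track functions and bounds. *)
Definition rep (Lam : R -> Prop) (w : R -> R) (K : R) (g : C -> C) : Prop :=
  exists c, norm_le Lam w c K /\ forall s : C, 0 <= fst s -> hsum Lam (dterm c s) (g s).

(** Everything except the subexponential growth, which enters only through [cyclic_weight_sum];
    these properties pass to finitely generated subsemigroups. *)
Definition good_weight (Lam : R -> Prop) (w : R -> R) : Prop :=
  add_semigroup0 Lam /\ weight Lam w /\ (forall l, Lam l -> 1 <= w l).

Lemma rep_ge_0 (Lam : R -> Prop) (w : R -> R) (K : R) (g : C -> C) : rep Lam w K g -> 0 <= K.
Proof. intros [c [H _]]. apply (H nil). split; constructor. Qed.

Lemma rep_mono (Lam : R -> Prop) (w : R -> R) (K K' : R) (g : C -> C) : rep Lam w K g -> K <= K' -> rep Lam w K' g.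
Proof. intros [c [H1 H2]] HK. exists c. split; [|exact H2]. intros l Hl. eapply Rle_trans; [apply H1, Hl|exact HK]. Qed.

Lemma rep_ext (Lam : R -> Prop) (w : R -> R) (K : R) (g h : C -> C) :
  (forall s : C, 0 <= fst s -> g s = h s) -> rep Lam w K g -> rep Lam w K h.
Proof. intros He [c [H1 H2]]. exists c. split; [exact H1|]. intros s Hs. rewrite <- He by exact Hs. apply H2, Hs. Qed.

(** For l >= 0 and Re s >= 0 the exponential is at most 1, and 1 <= w l. *)
Lemma Cmod_term_le (Lam : R -> Prop) (w : R -> R) (a : R -> C) (s : C) (l : R) : good_weight Lam w ->
  0 <= fst s -> Lam l -> Cmod (dterm a s l) <= Cmod (a l) * w l.
Proof.
  intros [[S0 _] [_ Hw]] Hs Hl. unfold dterm. rewrite Cmod_mult, Cmod_cexp.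
  apply Rmult_le_compat_l; [apply Cmod_ge_0|]. eapply Rle_trans; [|apply Hw, Hl].
  rewrite <- exp_0. simpl. specialize (S0 l Hl).
  destruct (Req_dec (- l * fst s - 0 * snd s) 0) as [->|Hn]; [lra|].
  left; apply exp_increasing. nra.
Qed.

Lemma lsum_term_le (Lam : R -> Prop) (w : R -> R) (a : R -> C) (s : C) (l : list R) : good_weight Lam w ->
  0 <= fst s -> List.Forall Lam l -> Cmod (lsum (dterm a s) l) <= wsum w a l.
Proof.
  intros HG Hs Hl. eapply Rle_trans; [apply Cmod_lsum_le|]. apply Rsum_list_le. intros x Hx.
  eapply Cmod_term_le; eauto. rewrite Forall_forall in Hl. auto.
Qed.

Lemma rep_bound (Lam : R -> Prop) (w : R -> R) (K : R) (g : C -> C) (s : C) : good_weight Lam w ->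
  rep Lam w K g -> 0 <= fst s -> Cmod (g s) <= K.
Proof.
  intros HG [c [Hc Hg]] Hs. specialize (Hg s Hs). rewrite hsumE in Hg. apply le_epsilon. intros eps Heps.
  destruct (Hg eps Heps) as [l0 [F0 P0]]. specialize (P0 l0 F0 (incl_refl _)).
  replace (g s) with (lsum (dterm c s) l0 + - (lsum (dterm c s) l0 - g s))%C by ring.
  eapply Rle_trans; [apply Cmod_triangle|]. rewrite Cmod_opp.
  pose proof (lsum_term_le Lam w c s l0 HG Hs (proj2 F0)). pose proof (Hc l0 F0). lra.
Qed.

Lemma wsum_plus_le (w : R -> R) (a b : R -> C) (l : list R) : (forall x, In x l -> 0 <= w x) ->
  wsum w (fun x => a x + b x)%C l <= wsum w a l + wsum w b l.
Proof.
  intros Hw. unfold wsum. rewrite <- Rsum_list_plus. apply Rsum_list_le. intros x Hx.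
  specialize (Hw x Hx). pose proof (Cmod_triangle (a x) (b x)). nra.
Qed.

Lemma good_weight_pos (Lam : R -> Prop) (w : R -> R) (l : list R) : good_weight Lam w -> List.Forall Lam l ->
  forall x, In x l -> 0 <= w x.
Proof. intros [_ [_ Hw]] Hl x Hx. rewrite Forall_forall in Hl. specialize (Hw x (Hl x Hx)). lra. Qed.

Lemma rep_plus (Lam : R -> Prop) (w : R -> R) (K K' : R) (g h : C -> C) : good_weight Lam w ->
  rep Lam w K g -> rep Lam w K' h -> rep Lam w (K + K') (fun s => g s + h s)%C.
Proof.
  intros HG [c [H1 H2]] [d [H3 H4]]. exists (fun x => c x + d x)%C. split.
  - intros l Hl. eapply Rle_trans; [apply wsum_plus_le; apply (good_weight_pos Lam w); [exact HG|apply Hl]|].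
    specialize (H1 l Hl). specialize (H3 l Hl). lra.
  - intros s Hs. apply (hsum_ext _ (fun x => dterm c s x + dterm d s x)%C).
    + intros x _. unfold dterm. ring.
    + apply hsum_plus; auto.
Qed.

Lemma wsum_zero (w : R -> R) (a : R -> C) (l : list R) : (forall x, a x = 0%C) -> wsum w a l = 0.
Proof.
  intros H. unfold wsum. induction l; simpl; [reflexivity|]. rewrite IHl, H, Cmod_0. ring.
Qed.

Lemma rep_zero (Lam : R -> Prop) (w : R -> R) : rep Lam w 0 (fun _ => 0%C).
Proof.
  exists (fun _ => 0%C). split.
  - intros l _. rewrite wsum_zero by reflexivity. lra.
  - intros s Hs. apply hsum_zero. intros x _. unfold dterm. ring.
Qed.

Lemma finite_uniform_cv (w : R -> R) (u : nat -> R -> C) (c : R -> C) (l : list R) :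
  (forall x, In x l -> 0 <= w x) -> (forall x, In x l -> cv (fun n => u n x) (c x)) ->
  forall eps, 0 < eps -> exists N, forall n, (N <= n)%nat -> wsum w (fun x => c x - u n x)%C l < eps.
Proof.
  induction l as [|x l IH]; intros Hw Hu eps Heps; [exists O; intros; exact Heps|].
  destruct IH with (eps := eps / 2) as [N1 H1]; [intros; apply Hw; right; auto|intros; apply Hu; right; auto|lra|].
  assert (Hwx : 0 <= w x) by (apply Hw; left; auto).
  destruct (Hu x (or_introl eq_refl) (eps / 2 / (w x + 1))) as [N2 H2]; [apply Rdiv_lt_0_compat; lra|].
  exists (max N1 N2). intros n Hn. specialize (H1 n ltac:(lia)). specialize (H2 n ltac:(lia)).
  unfold wsum in *. simpl.
  replace (c x - u n x)%C with (- (u n x - c x))%C by ring. rewrite Cmod_opp.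
  apply (Rmult_lt_compat_r (w x + 1)) in H2; [|lra]. unfold Rdiv in H2 at 1. rewrite Rmult_assoc, Rinv_l in H2 by lra.
  pose proof (Cmod_ge_0 (u n x - c x)%C). lra.
Qed.

(* The coefficients of a norm-convergent series of Dirichlet series are the termwise sums; the tail
   bound on the coefficients gives both the norm of the sum and the interchange of summations. *)
Lemma rep_series (Lam : R -> Prop) (w : R -> R) (K : nat -> R) (M : R) (g : nat -> C -> C) (h : C -> C) :
  good_weight Lam w -> (forall n, rep Lam w (K n) (g n)) -> (forall N, rsum K N <= M) ->
  (forall s : C, 0 <= fst s -> cv (csum (fun n => g n s)) (h s)) -> rep Lam w M h.
Proof.
  intros HG Hg HM Hh.
  assert (HK0 : forall n, 0 <= K n) by (intros n; apply (rep_ge_0 _ _ _ _ (Hg n))).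
  set (c := fun n => proj1_sig (constructive_indefinite_description _ (Hg n))).
  assert (Hc : forall n, norm_le Lam w (c n) (K n) /\ forall s : C, 0 <= fst s -> hsum Lam (dterm (c n) s) (g n s)).
  { intros n. unfold c. destruct (constructive_indefinite_description _ (Hg n)) as [x Hx]. exact Hx. }
  (* Since w >= 1, the norm dominates each single coefficient, so the termwise sums converge. *)
  assert (Hcx : forall x n, Lam x -> Cmod (c n x) <= K n).
  { intros x n Hx. assert (F : finsub Lam (x :: nil)) by (split; [constructor; [simpl; tauto|constructor]|constructor; auto]).
    pose proof (proj1 (Hc n) _ F) as H. unfold wsum in H. simpl in H.
    pose proof (proj2 (proj2 HG) x Hx). pose proof (Cmod_ge_0 (c n x)). nra. }
  set (d := fun x => epsilon (inhabits (RtoC 0)) (fun l => cv (csum (fun n => c n x)) l)).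
  assert (Hd : forall x, Lam x -> cv (csum (fun n => c n x)) (d x)).
  { intros x Hx. apply epsilon_spec. apply (csum_cv _ K M); [intros k; apply Hcx, Hx|exact HM]. }
  set (cN := fun N x => csum (fun n => c n x) N).
  assert (Hdiff : forall l n m, finsub Lam l -> (n <= m)%nat -> wsum w (fun x => cN m x - cN n x)%C l <= rsum K m - rsum K n).
  { intros l n m Hl. induction 1.
    - rewrite wsum_zero by (intros; ring). lra.
    - eapply Rle_trans with (wsum w (fun x => (cN m x - cN n x) + c m x)%C l).
      + apply Rsum_list_le. intros x _. unfold cN. simpl. apply Req_le. f_equal. f_equal. ring.
      + eapply Rle_trans; [apply wsum_plus_le; apply (good_weight_pos Lam w); [exact HG|apply Hl]|].
        pose proof (proj1 (Hc m) l Hl). simpl. lra. }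
  (* On a fixed finite set of exponents the partial sums converge uniformly, so the norm bound for
     differences of partial sums survives the limit; the resulting tail bound does not depend on the
     finite set. *)
  assert (Htail : forall N T, (forall m, (N <= m)%nat -> rsum K m <= rsum K N + T) ->
     forall l, finsub Lam l -> wsum w (fun x => d x - cN N x)%C l <= T).
  { intros N T HT l Hl. apply le_epsilon. intros eps Heps.
    destruct (finite_uniform_cv w cN d l) with (eps := eps) as [N1 H1]; [apply (good_weight_pos Lam w); [exact HG|apply Hl]| |exact Heps|].
    { intros x Hx. apply Hd. eapply finsub_In; eauto. }
    set (m := max N N1). specialize (H1 m ltac:(lia)).
    eapply Rle_trans with (wsum w (fun x => (d x - cN m x) + (cN m x - cN N x))%C l).
    - apply Rsum_list_le. intros x _. apply Req_le. f_equal. f_equal. ring.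
    - eapply Rle_trans; [apply wsum_plus_le; apply (good_weight_pos Lam w); [exact HG|apply Hl]|].
      pose proof (Hdiff l N m Hl ltac:(lia)). specialize (HT m ltac:(lia)). lra. }
  exists d. split.
  - intros l Hl. pose proof (Htail O M ltac:(intros; simpl; specialize (HM m); lra) l Hl) as H.
    eapply Rle_trans; [|exact H]. apply Rsum_list_le. intros x _. apply Req_le. f_equal. f_equal. unfold cN; simpl. ring.
  - intros s Hs. rewrite hsumE. intros eps Heps.
    destruct (rsum_tail K M HK0 HM (eps / 4)) as [N1 HN1]; [lra|].
    destruct (Hh s Hs (eps / 4)) as [N2 HN2]; [lra|].
    set (N := max N1 N2). specialize (HN2 N ltac:(lia)).
    assert (Hsum : forall n, hsum Lam (dterm (cN n) s) (csum (fun k => g k s) n)).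
    { induction n.
      - apply hsum_zero. intros x _. unfold dterm, cN; simpl. ring.
      - apply (hsum_ext _ (fun x => dterm (cN n) s x + dterm (c n) s x)%C).
        + intros x _. unfold dterm, cN. simpl. ring.
        + apply hsum_plus; [exact IHn|]. apply Hc, Hs. }
    specialize (Hsum N). rewrite hsumE in Hsum. destruct (Hsum (eps / 4)) as [l0 [F0 P0]]; [lra|].
    exists l0. split; [exact F0|]. intros l Hl Hi. specialize (P0 l Hl Hi).
    assert (HT : Cmod (lsum (dterm (fun x => d x - cN N x)%C s) l) <= eps / 4).
    { eapply Rle_trans; [apply (lsum_term_le Lam w); [exact HG|exact Hs|apply Hl]|].
      apply Htail; [|exact Hl]. intros m Hm. apply HN1; lia. }
    assert (E : lsum (dterm d s) l = (lsum (dterm (fun x => d x - cN N x)%C s) l + lsum (dterm (cN N) s) l)%C).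
    { rewrite <- lsum_plus. apply lsum_ext. intros x _. unfold dterm. ring. }
    rewrite E.
    replace (lsum (dterm (fun x => d x - cN N x)%C s) l + lsum (dterm (cN N) s) l - h s)%C with
      (lsum (dterm (fun x => d x - cN N x)%C s) l + ((lsum (dterm (cN N) s) l - csum (fun k => g k s) N) + (csum (fun k => g k s) N - h s)))%C by ring.
    eapply Rle_lt_trans; [apply Cmod_triangle|].
    eapply Rle_lt_trans; [apply Rplus_le_compat_l, Cmod_triangle|]. lra.
Qed.

(** * Restriction of coefficients and multiplication by finite sums *)

Definition decb (p : R -> Prop) (x : R) : bool := if excluded_middle_informative (p x) then true else false.

Lemma decb_true (p : R -> Prop) (x : R) : decb p x = true <-> p x.
Proof. unfold decb. destruct (excluded_middle_informative (p x)); split; intros; auto; discriminate. Qed.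

Definition cut (p : R -> Prop) (F : R -> C) (x : R) : C := if decb p x then F x else 0%C.

Lemma lsum_cut (p : R -> Prop) (F : R -> C) (l : list R) : lsum (cut p F) l = lsum F (filter (decb p) l).
Proof.
  induction l; [reflexivity|]. rewrite lsum_cons, IHl. unfold cut. simpl.
  destruct (decb p a); [reflexivity|ring].
Qed.

Lemma wsum_cut (w : R -> R) (p : R -> Prop) (F : R -> C) (l : list R) :
  wsum w (cut p F) l = wsum w F (filter (decb p) l).
Proof.
  unfold wsum. induction l; [reflexivity|]. simpl. rewrite IHl. unfold cut.
  destruct (decb p a); [reflexivity|]. rewrite Cmod_0. ring.
Qed.

Lemma lsum_map (phi : R -> R) (F : R -> C) (l : list R) : lsum (fun x => F (phi x)) l = lsum F (map phi l).
Proof. induction l; [reflexivity|]. simpl map. rewrite !lsum_cons, IHl. reflexivity. Qed.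

Lemma Rsum_list_map (phi : R -> R) (F : R -> R) (l : list R) : Rsum_list (fun x => F (phi x)) l = Rsum_list F (map phi l).
Proof. induction l; [reflexivity|]. simpl. rewrite IHl. reflexivity. Qed.

Lemma finsub_filter (Lam p : R -> Prop) (l : list R) : NoDup l -> (forall x, In x l -> p x -> Lam x) ->
  finsub Lam (filter (decb p) l).
Proof.
  intros H1 H2. split; [apply NoDup_filter, H1|]. apply Forall_forall. intros x Hx.
  apply filter_In in Hx. destruct Hx as [Hx Hp]. apply decb_true in Hp. auto.
Qed.

Lemma dterm_cut (p : R -> Prop) (a : R -> C) (s : C) (x : R) : dterm (cut p a) s x = cut p (dterm a s) x.
Proof. unfold dterm, cut. destruct (decb p x); [reflexivity|ring]. Qed.

Lemma rep_subsemigroup (S Lam : R -> Prop) (w : R -> R) (K : R) (g : C -> C) :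
  (forall x, S x -> Lam x) -> rep S w K g -> rep Lam w K g.
Proof.
  intros HS [c [H1 H2]]. exists (cut S c). split.
  - intros l [Hl _]. rewrite wsum_cut. apply H1, finsub_filter; auto.
  - intros s Hs. specialize (H2 s Hs). rewrite hsumE in *. intros eps Heps.
    destruct (H2 eps Heps) as [l0 [[N0 F0] P0]]. rewrite Forall_forall in F0. exists l0. split.
    + split; [exact N0|]. apply Forall_forall. auto.
    + intros l [Nl _] Hi. rewrite (lsum_ext _ (cut S (dterm c s))) by (intros; apply dterm_cut).
      rewrite lsum_cut. apply P0; [apply finsub_filter; auto|].
      intros x Hx. apply filter_In. split; [auto|]. apply decb_true. auto.
Qed.

(** The coefficients are translated by mu and scaled by q, and submultiplicativity of w bounds the
    norm. As Lambda is only a semigroup, x - mu may leave it, and the new coefficient at such x is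
    set to 0. *)
Lemma rep_mul_monomial (Lam : R -> Prop) (w : R -> R) (K : R) (g : C -> C) (q : C) (mu : R) : good_weight Lam w ->
  Lam mu -> rep Lam w K g -> rep Lam w (Cmod q * w mu * K) (fun s => q * cexp (RtoC (- mu) * s) * g s)%C.
Proof.
  intros HG Hmu [c [H1 H2]]. pose proof HG as [[S0 [S1 S2]] [[W0 [W1 W2]] W3]].
  set (p := fun x => Lam (x - mu)).
  set (sub := fun l => map (fun x => x - mu) (filter (decb p) l)).
  assert (Hsub : forall l, NoDup l -> finsub Lam (sub l)).
  { intros l Hl. split.
    - apply NoDup_map_NoDup_ForallPairs; [|apply NoDup_filter, Hl]. intros x y _ _ Hxy. lra.
    - apply Forall_forall. intros x Hx. apply in_map_iff in Hx. destruct Hx as [y [<- Hy]].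
      apply filter_In in Hy. destruct Hy as [_ Hy]. apply decb_true in Hy. exact Hy. }
  exists (cut p (fun x => q * c (x - mu)%R)%C). split.
  - intros l [Hl _]. rewrite wsum_cut.
    eapply Rle_trans with (Rsum_list (fun x => Cmod q * w mu * (Cmod (c (x - mu)) * w (x - mu))) (filter (decb p) l)).
    + apply Rsum_list_le. intros x Hx. apply filter_In in Hx. destruct Hx as [_ Hx]. apply decb_true in Hx.
      rewrite Cmod_mult. pose proof (W2 mu (x - mu) Hmu Hx) as HW. replace (mu + (x - mu)) with x in HW by ring.
      pose proof (Cmod_ge_0 q). pose proof (Cmod_ge_0 (c (x - mu))).
      replace (Cmod q * w mu * (Cmod (c (x - mu)) * w (x - mu))) with (Cmod q * Cmod (c (x - mu)) * (w mu * w (x - mu))) by ring.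
      apply Rmult_le_compat_l; [|exact HW]. apply Rmult_le_pos; assumption.
    + rewrite Rsum_list_scal. rewrite (Rsum_list_map (fun x => x - mu) (fun y => Cmod (c y) * w y)).
      apply Rmult_le_compat_l; [apply Rmult_le_pos; [apply Cmod_ge_0|specialize (W3 mu Hmu); lra]|].
      apply H1, Hsub, Hl.
  - intros s Hs. specialize (H2 s Hs). rewrite hsumE in *. intros eps Heps.
    set (k := (q * cexp (RtoC (- mu) * s))%C).
    assert (Hk := Cmod_ge_0 k).
    destruct (H2 (eps / (Cmod k + 1))) as [l0 [[N0 F0] P0]]; [apply Rdiv_lt_0_compat; lra|].
    exists (map (fun x => x + mu) l0). split.
    + split; [apply NoDup_map_NoDup_ForallPairs; [|exact N0]; intros x y _ _ Hxy; lra|].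
      apply Forall_forall. intros x Hx. apply in_map_iff in Hx. destruct Hx as [y [<- Hy]].
      apply S2; [|exact Hmu]. rewrite Forall_forall in F0. auto.
    + intros l [Nl _] Hi.
      assert (E : lsum (dterm (cut p (fun x => q * c (x - mu)%R)%C) s) l = (k * lsum (dterm c s) (sub l))%C).
      { rewrite (lsum_ext _ (cut p (dterm (fun x => q * c (x - mu)%R)%C s))) by (intros; apply dterm_cut).
        rewrite lsum_cut. unfold sub. rewrite <- (lsum_map (fun x => x - mu)), <- lsum_scal.
        apply lsum_ext. intros x _. unfold dterm, k.
        replace (RtoC (- x) * s)%C with (RtoC (- mu) * s + RtoC (- (x - mu)) * s)%C
          by (replace (- (x - mu)) with (- x - - mu) by ring; rewrite RtoC_minus; ring).
        rewrite cexp_plus. ring. }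
      rewrite E. replace (k * lsum (dterm c s) (sub l) - k * g s)%C with (k * (lsum (dterm c s) (sub l) - g s))%C by ring.
      rewrite Cmod_mult.
      assert (HP : Cmod (lsum (dterm c s) (sub l) - g s)%C < eps / (Cmod k + 1)).
      { apply P0; [apply Hsub, Nl|]. intros x Hx. unfold sub. apply in_map_iff. exists (x + mu). split; [ring|].
        apply filter_In. split; [apply Hi, in_map_iff; exists x; auto|].
        apply decb_true. unfold p. replace (x + mu - mu) with x by ring. rewrite Forall_forall in F0. auto. }
      apply (Rmult_lt_compat_r (Cmod k + 1)) in HP; [|lra]. unfold Rdiv in HP. rewrite Rmult_assoc, Rinv_l in HP by lra.
      pose proof (Cmod_ge_0 (lsum (dterm c s) (sub l) - g s)%C). nra.
Qed.

(** Multiplication by a finite sum, one monomial at a time, is the only product needed; products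
    with an infinite remainder are obtained as limits through [rep_series]. *)
Lemma rep_mul_poly (Lam : R -> Prop) (w : R -> R) (K : R) (g : C -> C) (b : R -> C) (l : list R) : good_weight Lam w ->
  List.Forall Lam l -> rep Lam w K g -> rep Lam w (wsum w b l * K) (fun s => lsum (dterm b s) l * g s)%C.
Proof.
  intros HG Hl Hg. induction l as [|x l IH].
  - apply (rep_mono _ _ 0); [|unfold wsum; simpl; lra].
    apply (rep_ext _ _ _ (fun _ => 0%C)); [|apply rep_zero]. intros s _. unfold lsum; simpl.
    change (RtoC 0 = (RtoC 0 * g s)%C). ring.
  - assert (Hx : Lam x) by (inversion Hl; assumption). assert (Hl' : List.Forall Lam l) by (inversion Hl; assumption).
    apply (rep_mono _ _ (Cmod (b x) * w x * K + wsum w b l * K)); [|unfold wsum; simpl; lra].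
    apply (rep_ext _ _ _ (fun s => b x * cexp (RtoC (- x) * s) * g s + lsum (dterm b s) l * g s)%C).
    + intros s _. rewrite lsum_cons. unfold dterm at 2. ring.
    + apply (rep_plus _ _ _ _ (fun s => b x * cexp (RtoC (- x) * s) * g s)%C (fun s => lsum (dterm b s) l * g s)%C HG).
      * apply rep_mul_monomial; assumption.
      * apply IH, Hl'.
Qed.

Lemma lsum_indicator (k : C) (l : list R) : NoDup l ->
  lsum (fun x => if Req_dec_T x 0 then k else 0%C) l = if in_dec Req_dec_T 0 l then k else 0%C.
Proof.
  induction l as [|x l IH]; intros H; [reflexivity|]. inversion H; subst. rewrite lsum_cons, IH by assumption.
  destruct (in_dec Req_dec_T 0 (x :: l)) as [I|I]; destruct (Req_dec_T x 0) as [->|Hn]; destruct (in_dec Req_dec_T 0 l) as [I'|I'];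
  simpl in I; try tauto; try ring.
Qed.

Lemma rep_const (Lam : R -> Prop) (w : R -> R) (k : C) : good_weight Lam w -> rep Lam w (Cmod k) (fun _ => k).
Proof.
  intros [[S0 [S1 S2]] [[W0 [W1 W2]] W3]].
  exists (fun x => if Req_dec_T x 0 then k else 0%C). split.
  - intros l [Nl _]. unfold wsum. induction l as [|x l IH]; [simpl; apply Cmod_ge_0|]. inversion Nl; subst.
    simpl. destruct (Req_dec_T x 0) as [->|Hn].
    + rewrite W1. assert (E : Rsum_list (fun x => Cmod (if Req_dec_T x 0 then k else 0%C) * w x) l <= Rsum_list (fun x => 0 * 0) l).
      { apply Rsum_list_le. intros y Hy. destruct (Req_dec_T y 0) as [->|]; [tauto|]. rewrite Cmod_0. lra. }
      rewrite Rsum_list_scal in E. lra.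
    + rewrite Cmod_0. specialize (IH ltac:(assumption)). lra.
  - intros s Hs. rewrite hsumE. intros eps Heps. exists (0 :: nil). split.
    + split; [constructor; [simpl; tauto|constructor]|constructor; auto].
    + intros l [Nl _] Hi.
      rewrite (lsum_ext _ (fun x => if Req_dec_T x 0 then k else 0%C)).
      * rewrite lsum_indicator by exact Nl. destruct (in_dec Req_dec_T 0 l) as [I|I].
        -- replace (k - k)%C with (RtoC 0) by ring. rewrite Cmod_0. exact Heps.
        -- exfalso. apply I, Hi. left; reflexivity.
      * intros x _. unfold dterm. destruct (Req_dec_T x 0) as [->|]; [|ring].
        rewrite Ropp_0. replace (0 * s)%C with (RtoC 0) by ring. rewrite cexp_0. ring.
Qed.

(** * Splitting a series into finite pieces; multipliers *)

Lemma NoDup_app_inv (l l' : list R) : NoDup (l ++ l') -> NoDup l' /\ forall x, In x l' -> ~ In x l.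
Proof.
  induction l as [|y l IH]; simpl; intros H; [auto|]. inversion H as [|? ? H1 H2]; subst.
  destruct (IH H2) as [N N']. split; [exact N|]. intros x Hx [->|Hx'].
  - apply H1, in_or_app. auto.
  - exact (N' x Hx Hx').
Qed.

(** A finite set almost attaining the supremum of the finite sums leaves at most eps outside. The
    prescribed part [l1] allows nested choices and lets a given exponent be forced into the set. *)
Lemma norm_le_tail (Lam : R -> Prop) (w : R -> R) (a : R -> C) (K : R) : norm_le Lam w a K ->
  forall eps, 0 < eps -> forall l1, finsub Lam l1 -> exists l2, finsub Lam (l1 ++ l2) /\
    forall l, finsub Lam l -> (forall x, In x l -> ~ In x (l1 ++ l2)) -> wsum w a l <= eps.
Proof.
  intros HK eps Heps l1 Hl1.
  destruct (completeness (fun y => exists l, finsub Lam l /\ y = wsum w a l)) as [m [M1 M2]].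
  - exists K. intros y [l [Hl ->]]. apply HK, Hl.
  - exists 0, nil. split; [split; constructor|reflexivity].
  - assert (HE : exists l0, finsub Lam l0 /\ m - eps < wsum w a l0).
    { apply NNPP. intros H. assert (m <= m - eps); [|lra]. apply M2. intros y [l [Hl ->]].
      apply Rnot_lt_le. intros Hlt. apply H. exists l. auto. }
    destruct HE as [l0 [F0 H0]].
    exists (filter (decb (fun x => ~ In x l1)) l0). split.
    + split.
      * apply NoDup_app; [apply Hl1|apply NoDup_filter, F0|].
        intros x Hx Hx'. apply filter_In in Hx'. destruct Hx' as [_ Hx']. apply decb_true in Hx'. tauto.
      * apply Forall_forall. intros x Hx. apply in_app_or in Hx. destruct Hx as [Hx|Hx]; [exact (finsub_In _ _ _ Hl1 Hx)|].
        apply filter_In in Hx. eapply finsub_In; [exact F0|tauto].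
    + intros l Hl Hd.
      assert (Hd' : forall x, In x l -> ~ In x l0).
      { intros x Hx Hx'. apply (Hd x Hx). apply in_or_app. destruct (classic (In x l1)); [auto|right].
        apply filter_In. split; [exact Hx'|]. apply decb_true. assumption. }
      assert (F : finsub Lam (l0 ++ l)).
      { split; [apply NoDup_app; [apply F0|apply Hl|]; intros x Hx Hx'; exact (Hd' x Hx' Hx)|].
        apply Forall_app. split; [apply F0|apply Hl]. }
      assert (H : wsum w a (l0 ++ l) <= m) by (apply M1; exists (l0 ++ l); auto).
      unfold wsum in *. rewrite Rsum_list_app in H. lra.
Qed.

Lemma finsub_complement (Lam : R -> Prop) (l0 l : list R) : finsub Lam l0 -> finsub Lam l -> incl l0 l ->
  exists l', finsub Lam l' /\ (forall x, In x l' -> ~ In x l0) /\ Permutation l (l0 ++ l').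
Proof.
  intros H0 Hl Hi. exists (filter (decb (fun x => ~ In x l0)) l). split; [|split].
  - apply finsub_filter; [apply Hl|]. intros x Hx _. eapply finsub_In; eauto.
  - intros x Hx. apply filter_In in Hx. destruct Hx as [_ Hx]. apply decb_true in Hx. exact Hx.
  - apply NoDup_Permutation; [apply Hl| |].
    + apply NoDup_app; [apply H0|apply NoDup_filter, Hl|]. intros x Hx Hx'. apply filter_In in Hx'.
      destruct Hx' as [_ Hx']. apply decb_true in Hx'. tauto.
    + intros x. split.
      * intros Hx. apply in_or_app. destruct (classic (In x l0)); [auto|right].
        apply filter_In. split; [exact Hx|apply decb_true; assumption].
      * intros Hx. apply in_app_or in Hx. destruct Hx as [Hx|Hx]; [apply Hi, Hx|]. apply filter_In in Hx. tauto.
Qed.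

(** Lambda may be uncountable, so no enumeration is used. Increasing finite sets D j are chosen
    whose complements have geometrically small norm; the increments Q j turn the remainder into an
    ordinary series of finite sums. *)
Lemma split_series (Lam : R -> Prop) (w : R -> R) (a : R -> C) (K kappa : R) : good_weight Lam w ->
  norm_le Lam w a K -> 0 < kappa ->
  exists l0 (Q : nat -> list R), finsub Lam l0 /\ (forall j, List.Forall Lam (Q j)) /\
    (forall N, rsum (fun j => wsum w a (Q j)) N <= kappa) /\
    forall s : C, 0 <= fst s -> exists S, cv (csum (fun j => lsum (dterm a s) (Q j))) S /\
      hsum Lam (dterm a s) (lsum (dterm a s) l0 + S)%C.
Proof.
  intros HG HK Hk.
  (* Q j avoids D j, so its norm is at most e j, and these bounds sum to kappa. *)
  set (e := fun j : nat => kappa / 2 * (/ 2) ^ j).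
  assert (He : forall j, 0 < e j) by (intros j; unfold e; apply Rmult_lt_0_compat; [lra|apply pow_lt; lra]).
  assert (step : forall j l1, exists l2, finsub Lam l1 -> finsub Lam (l1 ++ l2) /\
     forall l, finsub Lam l -> (forall x, In x l -> ~ In x (l1 ++ l2)) -> wsum w a l <= e j).
  { intros j l1. destruct (classic (finsub Lam l1)) as [H|H]; [|exists nil; tauto].
    destruct (norm_le_tail Lam w a K HK (e j) (He j) l1 H) as [l2 H2]. exists l2. auto. }
  set (nx := fun j l1 => proj1_sig (constructive_indefinite_description _ (step j l1))).
  assert (nxP : forall j l1, finsub Lam l1 -> finsub Lam (l1 ++ nx j l1) /\
     forall l, finsub Lam l -> (forall x, In x l -> ~ In x (l1 ++ nx j l1)) -> wsum w a l <= e j).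
  { intros j l1. unfold nx. destruct (constructive_indefinite_description _ (step j l1)) as [q Hq]. exact Hq. }
  set (D := fix D j := match j with O => nx O nil | S m => D m ++ nx (S m) (D m) end).
  assert (HD : forall j, finsub Lam (D j) /\ forall l, finsub Lam l -> (forall x, In x l -> ~ In x (D j)) -> wsum w a l <= e j).
  { induction j.
    - apply (nxP O nil). split; constructor.
    - apply (nxP (S j) (D j)). apply IHj. }
  set (Q := fun j => nx (S j) (D j)).
  assert (HQF : forall j, finsub Lam (Q j) /\ forall x, In x (Q j) -> ~ In x (D j)).
  { intros j. destruct (HD (S j)) as [[N F] _]. change (D (S j)) with (D j ++ Q j) in *.
    apply NoDup_app_inv in N. apply Forall_app in F. destruct N as [N N']. split; [split; tauto|exact N']. }
  exists (D O), Q. split; [apply HD|]. split; [intros j; apply HQF|].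
  assert (HQ : forall j, wsum w a (Q j) <= e j) by (intros j; apply HD; apply HQF).
  assert (Hsum : forall N, rsum (fun j => wsum w a (Q j)) N <= kappa).
  { intros N. eapply Rle_trans; [apply (rsum_le _ e); exact HQ|].
    assert (E : rsum e N = kappa * (1 - (/ 2) ^ N)).
    { induction N; simpl; [ring|]. rewrite IHN. unfold e. field. }
    rewrite E. assert (0 < (/ 2) ^ N) by (apply pow_lt; lra). nra. }
  split; [exact Hsum|]. intros s Hs.
  destruct (csum_cv (fun j => lsum (dterm a s) (Q j)) (fun j => wsum w a (Q j)) kappa) as [S HS].
  { intros j. apply (lsum_term_le Lam); [exact HG|exact Hs|apply HQF]. }
  { exact Hsum. }
  exists S. split; [exact HS|]. rewrite hsumE. intros eps Heps.
  assert (EDJ : forall J, lsum (dterm a s) (D J) = (lsum (dterm a s) (D O) + csum (fun j => lsum (dterm a s) (Q j)) J)%C).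
  { induction J; [simpl; ring|]. change (D (Datatypes.S J)) with (D J ++ Q J). rewrite lsum_app, IHJ. simpl. ring. }
  destruct (HS (eps / 2)) as [N1 H1]; [lra|].
  assert (HeJ : exists N2, forall n, (N2 <= n)%nat -> e n < eps / 2).
  { destruct (pow_lt_1_zero (/ 2) ltac:(rewrite Rabs_pos_eq; lra) (eps / kappa)) as [N HN]; [apply Rdiv_lt_0_compat; lra|].
    exists N. intros n Hn. specialize (HN n Hn). rewrite Rabs_pos_eq in HN by (apply pow_le; lra).
    apply (Rmult_lt_compat_l (kappa / 2)) in HN; [|lra]. unfold e.
    replace (kappa / 2 * (eps / kappa)) with (eps / 2) in HN by (field; lra). exact HN. }
  destruct HeJ as [N2 H2]. set (J := max N1 N2).
  specialize (H1 J ltac:(lia)). specialize (H2 J ltac:(lia)).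
  exists (D J). split; [apply HD|]. intros l Hl Hi.
  destruct (finsub_complement Lam (D J) l (proj1 (HD J)) Hl Hi) as [l' [Fl' [Dl' Hperm]]].
  rewrite (lsum_perm _ _ _ Hperm), lsum_app, EDJ.
  assert (Hl' : Cmod (lsum (dterm a s) l') <= e J).
  { eapply Rle_trans; [apply (lsum_term_le Lam w); [exact HG|exact Hs|apply Fl']|].
    apply HD; [exact Fl'|exact Dl']. }
  set (u := csum (fun j => lsum (dterm a s) (Q j)) J) in *.
  replace (lsum (dterm a s) (D O) + u + lsum (dterm a s) l' - (lsum (dterm a s) (D O) + S))%C with
    ((u - S) + lsum (dterm a s) l')%C by ring.
  eapply Rle_lt_trans; [apply Cmod_triangle|]. lra.
Qed.

Lemma cv_mul (u : nat -> C) (l k : C) : cv u l -> cv (fun n => u n * k)%C (l * k)%C.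
Proof.
  intros H eps Heps. assert (Hk := Cmod_ge_0 k).
  destruct (H (eps / (Cmod k + 1))) as [N HN]; [apply Rdiv_lt_0_compat; lra|].
  exists N. intros n Hn. specialize (HN n Hn).
  replace (u n * k - l * k)%C with ((u n - l) * k)%C by ring. rewrite Cmod_mult.
  apply (Rmult_lt_compat_r (Cmod k + 1)) in HN; [|lra]. unfold Rdiv in HN. rewrite Rmult_assoc, Rinv_l in HN by lra.
  pose proof (Cmod_ge_0 (u n - l)%C). nra.
Qed.

Lemma csum_mul (u : nat -> C) (k : C) (n : nat) : csum (fun j => u j * k)%C n = (csum u n * k)%C.
Proof. induction n; simpl; [ring|]. rewrite IHn. ring. Qed.

Lemma cv_ext (u v : nat -> C) (l : C) : (forall n, u n = v n) -> cv u l -> cv v l.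
Proof. intros E H eps Heps. destruct (H eps Heps) as [N HN]. exists N. intros n Hn. rewrite <- E. auto. Qed.

(** An operator-norm form of having norm at most kappa: powers can be bounded by iterating the
    action, without a convolution product. *)
Definition multiplier (Lam : R -> Prop) (w : R -> R) (kappa : R) (r : C -> C) : Prop :=
  forall K g, rep Lam w K g -> rep Lam w (kappa * K) (fun s => r s * g s)%C.

Lemma multiplier_series (Lam : R -> Prop) (w : R -> R) (a : R -> C) (Q : nat -> list R) (kappa : R) (r : C -> C) :
  good_weight Lam w -> (forall j, List.Forall Lam (Q j)) ->
  (forall N, rsum (fun j => wsum w a (Q j)) N <= kappa) ->
  (forall s : C, 0 <= fst s -> cv (csum (fun j => lsum (dterm a s) (Q j))) (r s)) -> multiplier Lam w kappa r.
Proof.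
  intros HG HQ Hk Hr K g Hg.
  apply (rep_series Lam w (fun j => wsum w a (Q j) * K) _ (fun j s => lsum (dterm a s) (Q j) * g s)%C); [exact HG| | |].
  - intros j. apply rep_mul_poly; auto.
  - intros N. assert (E : rsum (fun j => wsum w a (Q j) * K) N = rsum (fun j => wsum w a (Q j)) N * K).
    { induction N; simpl; [ring|]. rewrite IHN. ring. }
    rewrite E. apply Rmult_le_compat_r; [eapply rep_ge_0; exact Hg|apply Hk].
  - intros s Hs. apply (cv_ext (fun n => csum (fun j => lsum (dterm a s) (Q j)) n * g s)%C).
    + intros n. symmetry. apply csum_mul.
    + apply cv_mul, Hr, Hs.
Qed.

(** The action on the constant 1, whose norm is w 0 = 1. *)
Lemma multiplier_bound (Lam : R -> Prop) (w : R -> R) (kappa : R) (r : C -> C) (s : C) : good_weight Lam w ->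
  multiplier Lam w kappa r -> 0 <= fst s -> Cmod (r s) <= kappa.
Proof.
  intros HG H Hs. pose proof (rep_bound Lam w _ _ s HG (H _ _ (rep_const Lam w 1%C HG)) Hs) as Hb.
  rewrite Cmod_1 in Hb. replace (r s) with (r s * 1)%C by ring. lra.
Qed.

Lemma multiplier_pow (Lam : R -> Prop) (w : R -> R) (kappa : R) (r : C -> C) (n : nat) (K : R) (g : C -> C) :
  multiplier Lam w kappa r -> rep Lam w K g -> rep Lam w (kappa ^ n * K) (fun s => g s * r s ^ n)%C.
Proof.
  intros H Hg. induction n.
  - apply (rep_mono _ _ K); [|simpl; lra]. apply (rep_ext _ _ _ g); [|exact Hg]. intros s _. simpl. ring.
  - apply (rep_mono _ _ (kappa * (kappa ^ n * K))); [|simpl; lra].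
    apply (rep_ext _ _ _ (fun s => r s * (g s * r s ^ n))%C); [intros s _; simpl; ring|]. apply H, IHn.
Qed.

(** * Finitely generated semigroups and Bohr coefficients *)

Fixpoint gen (L : list R) (x : R) : Prop :=
  match L with nil => x = 0 | m :: L' => exists n y, gen L' y /\ x = INR n * m + y end.

Lemma gen_0 (L : list R) : gen L 0.
Proof. induction L; simpl; [reflexivity|]. exists O, 0. split; [exact IHL|simpl; ring]. Qed.

Lemma gen_plus (L : list R) : forall x y, gen L x -> gen L y -> gen L (x + y).
Proof.
  induction L; simpl; intros x y Hx Hy; [lra|].
  destruct Hx as [n [x' [Hx ->]]]. destruct Hy as [k [y' [Hy ->]]].
  exists (n + k)%nat, (x' + y'). split; [auto|]. rewrite plus_INR. ring.
Qed.

Lemma gen_In (L : list R) (x : R) : In x L -> gen L x.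
Proof.
  induction L; simpl; intros H; [tauto|]. destruct H as [->|H].
  - exists 1%nat, 0. split; [apply gen_0|simpl; ring].
  - exists O, x. split; [auto|simpl; ring].
Qed.

Lemma semigroup_mult (Lam : R -> Prop) (x : R) (n : nat) : add_semigroup0 Lam -> Lam x -> Lam (INR n * x).
Proof.
  intros [_ [H0 HP]] Hx. induction n; [simpl; rewrite Rmult_0_l; exact H0|].
  rewrite S_INR. replace ((INR n + 1) * x) with (INR n * x + x) by ring. auto.
Qed.

Lemma gen_sub (Lam : R -> Prop) (L : list R) : add_semigroup0 Lam -> List.Forall Lam L -> forall x, gen L x -> Lam x.
Proof.
  intros HS. induction L as [|m L IH]; simpl; intros HL x Hx; [subst; apply HS|].
  inversion HL; subst. destruct Hx as [n [y [Hy ->]]]. apply HS; [apply semigroup_mult; assumption|auto].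
Qed.

Lemma gen_good_weight (Lam : R -> Prop) (w : R -> R) (L : list R) : good_weight Lam w -> List.Forall Lam L ->
  good_weight (gen L) w.
Proof.
  intros [HS [[W0 [W1 W2]] W3]] HL. assert (H := gen_sub Lam L HS HL). repeat split.
  - intros x Hx. apply HS; auto.
  - apply gen_0.
  - apply gen_plus.
  - intros l Hl; auto.
  - exact W1.
  - intros l l' Hl Hl'; auto.
  - intros l Hl; auto.
Qed.

Lemma geometric_sum_le (A q : R) (u : nat -> R) (n : nat) : 0 <= A -> 0 <= q < 1 -> (forall k, u k <= A * q ^ k) ->
  rsum u n <= A / (1 - q).
Proof.
  intros HA Hq Hu. assert (HE : rsum (fun k => A * q ^ k) n = A / (1 - q) * (1 - q ^ n)).
  { induction n; simpl; [ring|]. rewrite IHn. field. lra. }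
  eapply Rle_trans; [apply (rsum_le _ _ n Hu)|]. rewrite HE.
  assert (0 <= q ^ n) by (apply pow_le; lra). assert (0 <= A / (1 - q)) by (apply Rdiv_le_0_compat; lra). nra.
Qed.

Lemma exp_pow (x : R) (n : nat) : exp x ^ n = exp (INR n * x).
Proof.
  induction n; [simpl; rewrite Rmult_0_l, exp_0; reflexivity|].
  rewrite S_INR, Rmult_plus_distr_r, exp_plus, Rmult_1_l, <- IHn. simpl. ring.
Qed.

(** Admissibility gives w(nm) < e^(n sigma m / 2) for large n, so half of the decay e^(-sigma n m)
    absorbs the weight and the other half remains as a geometric series. *)
Lemma cyclic_weight_sum (Lam : R -> Prop) (w : R -> R) (m sigma : R) : add_semigroup0 Lam -> admissible Lam w ->
  Lam m -> 0 < m -> 0 < sigma ->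
  exists A, forall N, rsum (fun n => exp (- sigma * (INR n * m)) * w (INR n * m)) N <= A.
Proof.
  intros HS [[W0 _] [_ Hadm]] Hm Hm0 Hs.
  set (q := exp (- sigma * m / 2)).
  assert (Hq : 0 < q < 1).
  { split; [apply exp_pos|]. rewrite <- exp_0. apply exp_increasing. nra. }
  assert (Hq1 : 0 < exp (sigma * m / 2) - 1).
  { assert (exp 0 < exp (sigma * m / 2)) by (apply exp_increasing; nra). rewrite exp_0 in H. lra. }
  destruct (Hadm m Hm (exp (sigma * m / 2) - 1) Hq1) as [N HN].
  set (F := fun n => exp (- sigma * (INR n * m)) * w (INR n * m)).
  assert (HF0 : forall n, 0 <= F n).
  { intros n. apply Rmult_le_pos; [left; apply exp_pos|]. left; apply W0, semigroup_mult; assumption. }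
  assert (HF : forall k, (N <= k)%nat -> F (S k) <= q ^ S k).
  { intros k Hk. specialize (HN k Hk). unfold Rdist in HN. apply Rabs_def2 in HN. destruct HN as [HN _].
    assert (Hp : 0 < INR (S k)) by (apply lt_0_INR; lia).
    assert (Hw : 0 < w (INR (S k) * m)) by (apply W0, semigroup_mult; assumption).
    assert (HR : Rpower (w (INR (S k) * m)) (/ INR (S k)) < exp (sigma * m / 2)) by lra.
    unfold Rpower in HR. apply exp_lt_inv in HR.
    assert (HL : ln (w (INR (S k) * m)) < INR (S k) * (sigma * m / 2)).
    { apply (Rmult_lt_compat_l (INR (S k))) in HR; [|exact Hp]. rewrite <- Rmult_assoc, Rinv_r, Rmult_1_l in HR by lra. exact HR. }
    unfold F, q. rewrite exp_pow. rewrite <- (exp_ln (w (INR (S k) * m))) by exact Hw. rewrite <- exp_plus.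
    left. apply exp_increasing. lra. }
  (* The sum takes care of the indices up to N, the summand 1 of the later ones. *)
  set (A := 1 + rsum (fun n => F n / q ^ n) (S N)).
  assert (Hqn : forall n, 0 < q ^ n) by (intros; apply pow_lt; lra).
  assert (HA : forall n, F n <= A * q ^ n).
  { intros n. destruct (Nat.le_gt_cases n N) as [Hn|Hn].
    - assert (Hin : F n / q ^ n <= rsum (fun n => F n / q ^ n) (S N)).
      { eapply Rle_trans; [|apply (rsum_incr _ (S n)); [intros k; apply Rdiv_le_0_compat; [apply HF0|apply Hqn]|lia]].
        simpl. assert (0 <= rsum (fun n => F n / q ^ n) n); [|lra].
        change 0 with (rsum (fun n => F n / q ^ n) 0). apply rsum_incr; [|lia].
        intros k. apply Rdiv_le_0_compat; [apply HF0|apply Hqn]. }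
      replace (F n) with (F n / q ^ n * q ^ n) by (field; apply Rgt_not_eq, Hqn).
      apply Rmult_le_compat_r; [left; apply Hqn|]. unfold A. lra.
    - destruct n as [|k]; [lia|]. eapply Rle_trans; [apply HF; lia|].
      assert (0 <= rsum (fun n => F n / q ^ n) (S N)).
      { change 0 with (rsum (fun n => F n / q ^ n) 0). apply rsum_incr; [|lia].
        intros k0. apply Rdiv_le_0_compat; [apply HF0|apply Hqn]. }
      specialize (Hqn (S k)). unfold A. nra. }
  exists (A / (1 - q)). intros n. apply geometric_sum_le; [|lra|exact HA].
  pose proof (HA O) as H0. simpl in H0. specialize (HF0 O). lra.
Qed.

Lemma Rsum_list_by_class (F : R -> R) (cl : R -> nat) (l : list R) (N : nat) :
  rsum (fun n => Rsum_list F (filter (fun x => Nat.eqb (cl x) n) l)) N = Rsum_list F (filter (fun x => Nat.ltb (cl x) N) l).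
Proof.
  induction N as [|N IH]; cbn [rsum].
  - induction l as [|x l IHl]; [reflexivity|]. simpl. exact IHl.
  - rewrite IH. clear IH. induction l as [|x l IHl]; [simpl; ring|]. simpl.
    destruct (Nat.ltb_spec (cl x) N); destruct (Nat.eqb_spec (cl x) N); destruct (Nat.ltb_spec (cl x) (S N)); try lia; simpl; lra.
Qed.

Lemma class_bound (cl : R -> nat) (l : list R) : exists N, forall x, In x l -> (cl x < N)%nat.
Proof.
  induction l as [|x l [N HN]]; [exists O; simpl; tauto|].
  exists (max (S (cl x)) N). intros y [<-|Hy]; [lia|]. specialize (HN y Hy). lia.
Qed.

(** Induction on the generators: with x = n m + y, submultiplicativity bounds the term at x by the
    product of the terms at n m and y, so the sum is at most a cyclic sum times the sum for the
    remaining generators. *)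
Lemma gen_weight_sum (Lam : R -> Prop) (w : R -> R) (sigma : R) : add_semigroup0 Lam -> admissible Lam w -> 0 < sigma ->
  forall L, List.Forall Lam L ->
  exists A, 0 <= A /\ forall l, finsub (gen L) l -> Rsum_list (fun x => exp (- sigma * x) * w x) l <= A.
Proof.
  intros HS Hadm Hs. pose proof Hadm as [[W0 [W1 W2]] _].
  set (F := fun x => exp (- sigma * x) * w x).
  induction L as [|m L IH]; intros HL.
  - exists 1. split; [lra|]. intros l [N G]. rewrite Forall_forall in G. simpl in G.
    assert (HF0 : F 0 = 1) by (unfold F; rewrite Rmult_0_r, exp_0, W1; ring).
    destruct l as [|x [|y l]]; simpl; [lra|rewrite (G x (or_introl eq_refl)), HF0; lra|].
    exfalso. inversion N as [|? ? N1 N2]. apply N1. rewrite (G x), (G y); simpl; auto.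
  - inversion HL as [|? ? Hm HL']; subst. destruct (IH HL') as [A [HA0 HA]].
    destruct (Req_dec m 0) as [->|Hm0].
    (* A zero generator adds no elements; it must be set apart because its cyclic sum would
       diverge. *)
    + exists A. split; [exact HA0|]. intros l [N G]. apply HA. split; [exact N|].
      rewrite Forall_forall in *. intros x Hx. destruct (G x Hx) as [n [y [Hy ->]]].
      replace (INR n * 0 + y) with y by ring. exact Hy.
    + assert (Hmp : 0 < m) by (pose proof (proj1 HS m Hm); lra).
      destruct (cyclic_weight_sum Lam w m sigma HS Hadm Hm Hmp Hs) as [B HB].
      assert (HB0 : 0 <= B) by (apply (HB O)).
      exists (B * A). split; [apply Rmult_le_pos; assumption|]. intros l [N G].
      (* Representations need not be unique, so one is fixed for every x; the list is then grouped
         by the chosen n. *)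
      assert (HGe : forall x, exists ny : nat * R, gen (m :: L) x -> gen L (snd ny) /\ x = INR (fst ny) * m + snd ny).
      { intros x. destruct (classic (gen (m :: L) x)) as [[n [y H]]|H]; [exists (n, y); auto|exists (O, 0); tauto]. }
      set (cl := fun x => fst (proj1_sig (constructive_indefinite_description _ (HGe x)))).
      set (yy := fun x => snd (proj1_sig (constructive_indefinite_description _ (HGe x)))).
      assert (HC : forall x, In x l -> gen L (yy x) /\ x = INR (cl x) * m + yy x).
      { intros x Hx. unfold cl, yy. destruct (constructive_indefinite_description _ (HGe x)) as [q Hq]. simpl.
        apply Hq. rewrite Forall_forall in G. auto. }
      destruct (class_bound cl l) as [N0 HN0].
      assert (El : Rsum_list F l = rsum (fun n => Rsum_list F (filter (fun x => Nat.eqb (cl x) n) l)) N0).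
      { rewrite Rsum_list_by_class. f_equal. clear - HN0. induction l as [|x l IHl]; [reflexivity|]. simpl.
        assert (H := HN0 x (or_introl eq_refl)). apply Nat.ltb_lt in H. rewrite H. f_equal. apply IHl.
        intros y Hy. apply HN0. right; exact Hy. }
      change (Rsum_list F l <= B * A). rewrite El.
      eapply Rle_trans; [apply (rsum_le _ (fun n => A * F (INR n * m)))|].
      * intros n. set (ln := filter (fun x => Nat.eqb (cl x) n) l).
        assert (Hln : forall x, In x ln -> gen L (yy x) /\ x = INR n * m + yy x).
        { intros x Hx. apply filter_In in Hx. destruct Hx as [Hx E]. apply Nat.eqb_eq in E. rewrite <- E. apply HC, Hx. }
        assert (HFn : 0 <= F (INR n * m)).
        { apply Rmult_le_pos; [left; apply exp_pos|left; apply W0, semigroup_mult; assumption]. }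
        eapply Rle_trans with (Rsum_list (fun x => F (INR n * m) * F (yy x)) ln).
        -- apply Rsum_list_le. intros x Hx. destruct (Hln x Hx) as [Hy E].
           assert (Hyl : Lam (yy x)) by (eapply gen_sub; eauto).
           unfold F. rewrite E at 1 2.
           replace (exp (- sigma * (INR n * m)) * w (INR n * m) * (exp (- sigma * yy x) * w (yy x))) with
             ((exp (- sigma * (INR n * m)) * exp (- sigma * yy x)) * (w (INR n * m) * w (yy x))) by ring.
           rewrite <- exp_plus, <- Rmult_plus_distr_l.
           apply Rmult_le_compat_l; [left; apply exp_pos|]. apply W2; [apply semigroup_mult; assumption|exact Hyl].
        (* With n fixed, y determines x, so the residues of one class are distinct and the bound for
           [gen L] applies. *)
        -- rewrite Rsum_list_scal, (Rsum_list_map yy F), Rmult_comm.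
           apply Rmult_le_compat_r; [exact HFn|]. apply HA. split.
           ++ apply NoDup_map_NoDup_ForallPairs; [|apply NoDup_filter, N].
              intros x y Hx Hy Hxy. destruct (Hln x Hx) as [_ E1]. destruct (Hln y Hy) as [_ E2]. congruence.
           ++ apply Forall_forall. intros y Hy. apply in_map_iff in Hy. destruct Hy as [x [<- Hx]]. apply Hln, Hx.
      * rewrite rsum_scal, Rmult_comm. apply Rmult_le_compat_r; [exact HA0|]. apply HB.
Qed.

(** * Bohr coefficients and the a priori bound *)

Lemma hsum_tail (Lam : R -> Prop) (w : R -> R) (a : R -> C) (s S : C) (l0 : list R) (e : R) : good_weight Lam w ->
  0 <= fst s -> finsub Lam l0 ->
  (forall l, finsub Lam l -> (forall x, In x l -> ~ In x l0) -> wsum w a l <= e) ->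
  hsum Lam (dterm a s) S -> Cmod (S - lsum (dterm a s) l0)%C <= e.
Proof.
  intros HG Hs H0 He HS. rewrite hsumE in HS. apply le_epsilon. intros eps Heps.
  destruct (HS eps Heps) as [l1 [F1 P1]].
  destruct (finsub_union Lam l0 l1 H0 F1) as [l [Fl [I0 I1]]].
  specialize (P1 l Fl I1).
  destruct (finsub_complement Lam l0 l H0 Fl I0) as [l' [F' [D' Hp]]].
  rewrite (lsum_perm _ _ _ Hp), lsum_app in P1.
  pose proof (lsum_term_le Lam w a s l' HG Hs (proj2 F')). specialize (He l' F' D').
  set (u := lsum (dterm a s) l0) in *. set (v := lsum (dterm a s) l') in *.
  replace (S - u)%C with (v + - (u + v - S))%C by ring.
  eapply Rle_trans; [apply Cmod_triangle|]. rewrite Cmod_opp. lra.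
Qed.

Lemma cexp_imag (x t : R) : cexp (RtoC x * (0, t))%C = cis (x * t).
Proof.
  rewrite cexp_polar. simpl. replace (x * 0 - 0 * t) with 0 by ring. replace (x * t + 0 * 0) with (x * t) by ring.
  rewrite exp_0. ring.
Qed.

(** Orthogonality in unnormalised form: the integral of e^(i (lam - x) t) over [-T, T] is 2T for x =
    lam and otherwise at most 2/|lam - x|, so the total error stays bounded in T. *)
Lemma bohr_polynomial (c : R -> C) (lam : R) (l : list R) : NoDup l ->
  (forall t, pcont (fun t => (lsum (dterm c (0, t)) l * cexp (RtoC lam * (0, t)))%C) t) /\
  exists B, 0 <= B /\ forall T, 0 <= T ->
   Cmod (cint (fun t => (lsum (dterm c (0, t)) l * cexp (RtoC lam * (0, t)))%C) (- T) T
      - (if in_dec Req_dec_T lam l then RtoC (2 * T) * c lam else 0))%C <= B.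
Proof.
  induction l as [|x l IH]; intros N.
  - assert (E : forall t, (lsum (dterm c (0, t)) nil * cexp (RtoC lam * (0, t)))%C = 0%C).
    { intros t. change (RtoC 0 * cexp (RtoC lam * (0, t)) = RtoC 0)%C. ring. }
    split.
    + intros t. apply pcont_eps. intros eps Heps. exists 1. split; [lra|]. intros u _. rewrite !E.
      replace (0 - 0)%C with (RtoC 0) by ring. rewrite Cmod_0. exact Heps.
    + exists 0. split; [lra|]. intros T HT. rewrite (cint_ext _ (fun _ => 0%C)) by (intros; try apply E; lra).
      rewrite cint_const. simpl. replace (RtoC (T - - T) * 0 - 0)%C with (RtoC 0) by ring. rewrite Cmod_0. lra.
  - inversion N as [|? ? N1 N2]; subst. destruct (IH N2) as [Hc [B [HB0 HB]]].
    set (P := fun t => (lsum (dterm c (0, t)) l * cexp (RtoC lam * (0, t)))%C) in *.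
    assert (E : forall t, (lsum (dterm c (0, t)) (x :: l) * cexp (RtoC lam * (0, t)))%C = (c x * cis ((lam - x) * t) + P t)%C).
    { intros t. rewrite lsum_cons. unfold dterm at 1, P. rewrite !cexp_imag.
      replace ((lam - x) * t) with (- x * t + lam * t) by ring. rewrite cis_plus. ring. }
    assert (Hc1 : forall t, pcont (fun t => c x * cis ((lam - x) * t))%C t).
    { intros t. apply pcont_mult; [apply pcont_const|apply pcont_comp_cis]. }
    split.
    + intros t. assert (H := pcont_plus _ _ t (Hc1 t) (Hc t)). rewrite pcont_eps in *. intros eps Heps.
      destruct (H eps Heps) as [de [Hde H1]]. exists de; split; [exact Hde|]. intros u Hu. rewrite !E. apply H1, Hu.
    + assert (ES : forall T, 0 <= T -> cint (fun t => (lsum (dterm c (0, t)) (x :: l) * cexp (RtoC lam * (0, t)))%C) (- T) T =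
         (c x * cint (fun t => cis ((lam - x) * t)) (- T) T + cint P (- T) T)%C).
      { intros T HT. rewrite (cint_ext _ (fun t => c x * cis ((lam - x) * t) + P t)%C) by (intros; try apply E; lra).
        rewrite (cint_plus (fun t => c x * cis ((lam - x) * t))%C P); [|lra|intros t _; apply Hc1|intros t _; apply Hc].
        rewrite cint_scal; [reflexivity|lra|]. intros t _. apply pcont_comp_cis. }
      destruct (Req_dec x lam) as [->|Hx].
      * exists B. split; [exact HB0|]. intros T HT. rewrite ES by exact HT. specialize (HB T HT).
        destruct (in_dec Req_dec_T lam l) as [I|_]; [tauto|].
        destruct (in_dec Req_dec_T lam (lam :: l)) as [_|I]; [|exfalso; apply I; left; reflexivity].
        rewrite (cint_ext _ (fun _ => 1%C)); [|lra|].
        -- rewrite cint_const. replace (T - - T) with (2 * T) by ring.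
           replace (c lam * (RtoC (2 * T) * 1) + cint P (- T) T - RtoC (2 * T) * c lam)%C with (cint P (- T) T - 0)%C by ring.
           exact HB.
        -- intros t _. unfold cis. replace ((lam - lam) * t) with 0 by ring. rewrite cos_0, sin_0. reflexivity.
      * set (D := Rabs (lam - x)). assert (HD : 0 < D) by (apply Rabs_pos_lt; lra).
        exists (Cmod (c x) * (2 / D) + B). split.
        { apply Rplus_le_le_0_compat; [|exact HB0]. apply Rmult_le_pos; [apply Cmod_ge_0|apply Rdiv_le_0_compat; lra]. }
        intros T HT. rewrite ES by exact HT. specialize (HB T HT).
        assert (Ed : (if in_dec Req_dec_T lam (x :: l) then (RtoC (2 * T) * c lam)%C else 0%C) =
          (if in_dec Req_dec_T lam l then (RtoC (2 * T) * c lam)%C else 0%C)).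
        { destruct (in_dec Req_dec_T lam (x :: l)) as [I|I]; destruct (in_dec Req_dec_T lam l) as [I'|I']; try reflexivity.
          - destruct I; [congruence|tauto].
          - exfalso; apply I; right; exact I'. }
        rewrite Ed. set (R0 := if in_dec Req_dec_T lam l then (RtoC (2 * T) * c lam)%C else 0%C) in *.
        replace (c x * cint (fun t => cis ((lam - x) * t)) (- T) T + cint P (- T) T - R0)%C with
          (c x * cint (fun t => cis ((lam - x) * t)) (- T) T + (cint P (- T) T - R0))%C by ring.
        eapply Rle_trans; [apply Cmod_triangle|]. apply Rplus_le_compat; [|exact HB].
        rewrite Cmod_mult. apply Rmult_le_compat_l; [apply Cmod_ge_0|].
        rewrite cint_cis by lra.
        replace ((lam - x) * - T) with (- ((lam - x) * T)) by ring. rewrite sin_neg, cos_neg.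
        replace ((sin ((lam - x) * T) - - sin ((lam - x) * T)) / (lam - x),
          (cos ((lam - x) * T) - cos ((lam - x) * T)) / (lam - x)) with (RtoC (2 * sin ((lam - x) * T) / (lam - x)))
          by (apply injective_projections; simpl; field; lra).
        rewrite Cmod_R. unfold Rdiv. rewrite !Rabs_mult, Rabs_inv. fold D.
        apply Rmult_le_compat_r; [left; apply Rinv_0_lt_compat, HD|]. rewrite (Rabs_pos_eq 2) by lra.
        assert (Rabs (sin ((lam - x) * T)) <= 1) by (apply Rabs_le, SIN_bound). lra.
Qed.

(* Shift the line of integration in the Bohr mean from 0 to -sigma. *)
Lemma bohr_coefficient_bound (Lam : R -> Prop) (w : R -> R) (c : R -> C) (K : R) (g : C -> C) (de sigma M lam : R) :
  good_weight Lam w -> norm_le Lam w c K -> 0 < sigma < de ->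
  (forall s : C, 0 <= fst s -> hsum Lam (dterm c s) (g s)) ->
  (forall s : C, - de < fst s -> exists d, cderiv g s d) ->
  (forall s : C, - de < fst s -> Cmod (g s) <= M) ->
  Lam lam -> Cmod (c lam) <= M * exp (- sigma * lam).
Proof.
  intros HG HK Hsig Hg Hd HM Hlam.
  assert (Hlam0 : 0 <= lam) by (apply HG, Hlam).
  assert (HM0 : 0 <= M) by (eapply Rle_trans; [apply Cmod_ge_0|apply (HM (0, 0)); simpl; lra]).
  set (h := fun s => (g s * cexp (RtoC lam * s))%C).
  assert (Hh : forall s : C, - de < fst s -> exists d, cderiv h s d).
  { intros s Hs. destruct (Hd s Hs) as [d Hds]. eexists.
    apply (cderiv_mult g (fun s => cexp (RtoC lam * s))%C); [exact Hds|].
    apply (cderiv_comp cexp (fun s => RtoC lam * s)%C); [apply cderiv_cexp|].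
    apply (cderiv_ext_loc (fun s => 0 + RtoC lam * s)%C _ _ _ 1); [lra|intros; ring|apply cderiv_lin]. }
  assert (Hb : forall s : C, - de < fst s -> Cmod (h s) <= M * exp (lam * fst s)).
  { intros s Hs. unfold h. rewrite Cmod_mult, Cmod_cexp. simpl. replace (lam * fst s - 0 * snd s) with (lam * fst s) by ring.
    apply Rmult_le_compat_r; [left; apply exp_pos|apply HM, Hs]. }
  apply le_epsilon. intros eps Heps.
  assert (F1 : finsub Lam (lam :: nil)) by (split; [constructor; [simpl; tauto|constructor]|constructor; auto]).
  (* Starting from the singleton forces [lam] into the finite set; the rest of the series is at most
     eps/4 uniformly on the imaginary axis. *)
  destruct (norm_le_tail Lam w c K HK (eps / 4) ltac:(lra) _ F1) as [l2 [F0 Htail]].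
  set (l0 := (lam :: nil) ++ l2) in *.
  destruct (bohr_polynomial c lam l0 (proj1 F0)) as [Hpc [B [HB0 HB]]].
  destruct (in_dec Req_dec_T lam l0) as [_|I]; [|exfalso; apply I; left; reflexivity].
  set (P := fun t => (lsum (dterm c (0, t)) l0 * cexp (RtoC lam * (0, t)))%C) in *.
  (* T is so large that the errors bounded in T, namely [B] from the finite sum and 2 M sigma from
     the two horizontal edges, together are at most eps T. *)
  set (T := 1 + (B + 2 * M * sigma) / eps).
  assert (HT : 1 <= T).
  { assert (0 <= (B + 2 * M * sigma) / eps); [apply Rdiv_le_0_compat; [nra|lra]|unfold T; lra]. }
  assert (HTe : B + 2 * M * sigma <= eps * T).
  { unfold T. rewrite Rmult_plus_distr_l. replace (eps * ((B + 2 * M * sigma) / eps)) with (B + 2 * M * sigma) by (field; lra). lra. }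
  specialize (HB T ltac:(lra)).
  assert (Hct : ccts_rect h (- sigma) 0 (- T) T).
  { intros x y Hx Hy. destruct (Hh (x, y)) as [d Hd']; [simpl; lra|]. eapply cderiv_ccts; eauto. }
  assert (HV0c : seg_cont (fun t => h (0, t)) (- T) T) by (eapply ccts_vedge; [exact Hct|lra]).
  assert (HR : rect h (- sigma) 0 (- T) T = 0%C).
  { apply goursat; [lra|lra|]. intros x y Hx Hy. apply Hh. simpl. lra. }
  (* To the left of the axis e^(lam Re s) <= 1, so these edges are bounded independently of T. *)
  assert (HH : forall y, - T <= y <= T -> Cmod (hedge h y (- sigma) 0) <= M * sigma).
  { intros y Hy. replace (M * sigma) with (M * (0 - - sigma)) by ring.
    apply cint_bound; [lra|eapply ccts_hedge; eauto|]. intros t Ht.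
    eapply Rle_trans; [apply Hb; simpl; lra|]. simpl. rewrite <- (Rmult_1_r M) at 2.
    apply Rmult_le_compat_l; [exact HM0|]. rewrite <- exp_0.
    destruct (Req_dec (lam * t) 0) as [->|Hn]; [lra|]. left; apply exp_increasing. nra. }
  assert (HV : Cmod (vedge h (- sigma) (- T) T) <= M * exp (- sigma * lam) * (T - - T)).
  { apply cint_bound; [lra|eapply ccts_vedge; [exact Hct|lra]|]. intros t Ht.
    eapply Rle_trans; [apply Hb; simpl; lra|]. simpl. replace (lam * - sigma) with (- sigma * lam) by ring. lra. }
  assert (HV0 : Cmod (vedge h 0 (- T) T) <= 2 * M * sigma + M * exp (- sigma * lam) * (2 * T)).
  { unfold rect in HR.
    assert (E : (Ci * vedge h 0 (- T) T)%C = (hedge h T (- sigma) 0 + - hedge h (- T) (- sigma) 0 + Ci * vedge h (- sigma) (- T) T)%C).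
    { match type of HR with ?X = _ => replace (Ci * vedge h 0 (- T) T)%C with
       (X + (hedge h T (- sigma) 0 + - hedge h (- T) (- sigma) 0 + Ci * vedge h (- sigma) (- T) T))%C by ring end.
      rewrite HR. ring. }
    assert (E2 : Cmod (vedge h 0 (- T) T) = Cmod (Ci * vedge h 0 (- T) T)%C) by (rewrite Cmod_mult, Cmod_Ci; ring).
    rewrite E2, E. eapply Rle_trans; [apply Cmod_triangle|].
    rewrite (Cmod_mult Ci), Cmod_Ci.
    pose proof (Cmod_triangle (hedge h T (- sigma) 0) (- hedge h (- T) (- sigma) 0)%C) as Ht. rewrite Cmod_opp in Ht.
    pose proof (HH T ltac:(lra)). pose proof (HH (- T) ltac:(lra)). lra. }
  assert (HD : Cmod (vedge h 0 (- T) T - cint P (- T) T)%C <= eps / 4 * (T - - T)).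
  { replace (vedge h 0 (- T) T - cint P (- T) T)%C with (vedge h 0 (- T) T + - 1 * cint P (- T) T)%C by ring.
    unfold vedge. rewrite <- cint_scal; [|lra|intros t _; apply Hpc].
    rewrite <- cint_plus; [|lra|exact HV0c|intros t _; apply pcont_mult; [apply pcont_const|apply Hpc]].
    apply cint_bound; [lra| |].
    - intros t Ht. apply pcont_plus; [apply HV0c, Ht|apply pcont_mult; [apply pcont_const|apply Hpc]].
    - intros t _. unfold h, P.
      replace (g (0, t) * cexp (RtoC lam * (0, t)) + - 1 * (lsum (dterm c (0, t)) l0 * cexp (RtoC lam * (0, t))))%C with
        ((g (0, t) - lsum (dterm c (0, t)) l0) * cexp (RtoC lam * (0, t)))%C by ring.
      rewrite Cmod_mult, cexp_imag, Cmod_cis, Rmult_1_r.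
      apply (hsum_tail Lam w c (0, t) _ l0 (eps / 4) HG); [simpl; lra|exact F0|exact Htail|apply Hg; simpl; lra]. }
  assert (Hfin : Cmod (RtoC (2 * T) * c lam)%C <= (M * exp (- sigma * lam) + eps) * (2 * T)).
  { set (V := vedge h 0 (- T) T) in *. set (I := cint P (- T) T) in *.
    replace (RtoC (2 * T) * c lam)%C with (V + (- (V - I) + - (I - RtoC (2 * T) * c lam)))%C by ring.
    eapply Rle_trans; [apply Cmod_triangle|].
    eapply Rle_trans; [apply Rplus_le_compat_l, Cmod_triangle|]. rewrite !Cmod_opp.
    assert (0 <= eps * T) by nra. lra. }
  rewrite Cmod_mult, Cmod_R, Rabs_pos_eq in Hfin by lra. apply (Rmult_le_reg_l (2 * T)); lra.
Qed.

(** A qualitative expansion, with some norm bound K, becomes a quantitative one: K lets the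
    coefficients be recovered as Bohr means but disappears from the result. The line is shifted by
    de/2, and [A] is the sum of w(x) e^(-(de/2) x) over the semigroup or a bound for it. *)
Lemma rep_a_priori (Lam : R -> Prop) (w : R -> R) (L : list R) (de : R) : add_semigroup0 Lam -> admissible Lam w ->
  List.Forall Lam L -> 0 < de ->
  exists A, 0 <= A /\ forall K M (g : C -> C), rep (gen L) w K g ->
    (forall s : C, - de < fst s -> exists d, cderiv g s d) ->
    (forall s : C, - de < fst s -> Cmod (g s) <= M) -> rep (gen L) w (A * M) g.
Proof.
  intros HS Hadm HL Hde.
  destruct (gen_weight_sum Lam w (de / 2) HS Hadm ltac:(lra) L HL) as [A [HA0 HA]].
  exists A. split; [exact HA0|]. intros K M g [c [Hc Hg]] Hd HM.
  assert (HG : good_weight (gen L) w) by (apply (gen_good_weight Lam); [split; [exact HS|split; apply Hadm]|exact HL]).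
  assert (HM0 : 0 <= M) by (eapply Rle_trans; [apply Cmod_ge_0|apply (HM (0, 0)); simpl; lra]).
  exists c. split; [|exact Hg]. intros l Hl.
  eapply Rle_trans with (Rsum_list (fun x => M * (exp (- (de / 2) * x) * w x)) l).
  - apply Rsum_list_le. intros x Hx. assert (Hx' : gen L x) by (eapply finsub_In; eauto).
    rewrite <- Rmult_assoc. apply Rmult_le_compat_r; [pose proof (proj2 (proj2 HG) x Hx'); lra|].
    apply (bohr_coefficient_bound (gen L) w c K g de (de / 2) M x HG Hc); try assumption. lra.
  - rewrite Rsum_list_scal, Rmult_comm. apply Rmult_le_compat_r; [exact HM0|]. apply HA, Hl.
Qed.

(** * Superposition *)

(** A Lebesgue number argument for a closed bounded set: one radius works for all points of K, and f
    is bounded on the resulting neighbourhood. *)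
Lemma compact_neighbourhood (K G : C -> Prop) (f : C -> C) (b : R) :
  (forall z, K z -> Cmod z <= b) ->
  (forall z, (forall eps, 0 < eps -> exists k, K k /\ Cmod (k - z)%C < eps) -> K z) ->
  (forall z, K z -> exists r, 0 < r /\ forall y, Cmod (y - z)%C < r -> G y) ->
  (forall z, K z -> ccts f z) ->
  exists r M, 0 < r /\ forall z k, K k -> Cmod (z - k)%C < r -> G z /\ Cmod (f z) <= M.
Proof.
  intros Hb Hcl HG Hf.
  (* A gauge on the whole plane: at points of K the one number d serves as a radius and, through
     1/d, as a bound for f; elsewhere the ball of radius 2d misses K. *)
  assert (HD : forall p : C, exists d : posreal,
     (K p /\ forall z, Cmod (z - p)%C < 3 * d -> G z /\ Cmod (f z) <= / d) \/
     (forall k, K k -> ~ Cmod (k - p)%C < 2 * d)).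
  { intros p. destruct (classic (K p)) as [Hp|Hp].
    - destruct (HG p Hp) as [r1 [Hr1 H1]]. destruct (Hf p Hp 1 Rlt_0_1) as [r2 [Hr2 H2]].
      assert (Hm := Cmod_ge_0 (f p)).
      assert (Hi : 0 < / (Cmod (f p) + 1)) by (apply Rinv_0_lt_compat; lra).
      set (d := Rmin (Rmin r1 r2 / 3) (/ (Cmod (f p) + 1))).
      assert (Hd : 0 < d) by (apply Rmin_pos; [apply Rdiv_lt_0_compat; [apply Rmin_pos; assumption|lra]|exact Hi]).
      assert (Hd1 : d <= Rmin r1 r2 / 3) by apply Rmin_l.
      assert (Hd2 : d <= / (Cmod (f p) + 1)) by apply Rmin_r.
      pose proof (Rmin_l r1 r2). pose proof (Rmin_r r1 r2).
      exists (mkposreal d Hd). left. split; [exact Hp|]. simpl. intros z Hz. split; [apply H1; lra|].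
      apply Rle_trans with (Cmod (f p) + 1).
      + replace (f z) with ((f z - f p) + f p)%C by ring. eapply Rle_trans; [apply Cmod_triangle|].
        specialize (H2 z ltac:(lra)). lra.
      + rewrite <- (Rinv_inv (Cmod (f p) + 1)). apply Rinv_le_contravar; [exact Hd|exact Hd2].
    - apply NNPP. intros H. apply Hp, Hcl. intros eps Heps. apply NNPP. intros Hk.
      assert (He : 0 < eps / 2) by lra.
      apply H. exists (mkposreal _ He). right. simpl. intros k Kk Hlt. apply Hk. exists k. split; [exact Kk|lra]. }
  set (delta := fun u v : R => proj1_sig (constructive_indefinite_description _ (HD (u, v)))).
  assert (Hdelta : forall u v, (K (u, v) /\ forall z, Cmod (z - (u, v))%C < 3 * delta u v -> G z /\ Cmod (f z) <= / delta u v) \/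
     (forall k, K k -> ~ Cmod (k - (u, v))%C < 2 * delta u v)).
  { intros u v. unfold delta. destruct (constructive_indefinite_description _ (HD (u, v))) as [d Hd]. exact Hd. }
  (* Every point of the square is within the gauge, in each coordinate, of some (u, v) whose gauge
     is at least d. In modulus this is less than twice the gauge, and the distance from z to its
     point of K adds at most one more, whence 3 in the gauge condition. *)
  destruct (compactness_value_2d (- b) b (- b) b delta) as [d Hd].
  exists d, (/ d). split; [apply cond_pos|]. intros z [x y] Hk Hz.
  assert (Hxy := Hb _ Hk).
  assert (Hx := fst_le_Cmod (x, y)). assert (Hy := im_le_Cmod (x, y)). cbn [fst snd] in Hx, Hy.
  apply NNPP. intros Hc. apply (Hd x y); [apply Rabs_le_between; lra|apply Rabs_le_between; lra|].
  intros [u [v [_ [_ [Hu [Hv Hle]]]]]]. apply Hc.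
  assert (Hdist : Cmod ((x, y) - (u, v))%C < 2 * delta u v).
  { eapply Rle_lt_trans; [apply Cmod_le_sum|]. simpl. unfold Rminus in *. lra. }
  destruct (Hdelta u v) as [[_ HA]|HN]; [|exfalso; exact (HN _ Hk Hdist)].
  destruct (HA z) as [H1 H2].
  - replace (z - (u, v))%C with ((z - (x, y)) + ((x, y) - (u, v)))%C by ring.
    eapply Rle_lt_trans; [apply Cmod_triangle|]. lra.
  - split; [exact H1|]. eapply Rle_trans; [exact H2|]. apply Rinv_le_contravar; [apply cond_pos|exact Hle].
Qed.

Definition nbhd (K : C -> Prop) (t : R) (z : C) : Prop := exists k, K k /\ Cmod (z - k)%C < t.

Lemma nbhd_shift (K : C -> Prop) (t e : R) (z u : C) : nbhd K t z -> Cmod (u - z)%C <= e -> nbhd K (t + e) u.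
Proof.
  intros [k [Kk Hk]] Hu. exists k. split; [exact Kk|].
  replace (u - k)%C with ((u - z) + (z - k))%C by ring. eapply Rle_lt_trans; [apply Cmod_triangle|]. lra.
Qed.

Lemma nbhd_mono (K : C -> Prop) (t t' : R) (z : C) : nbhd K t z -> t <= t' -> nbhd K t' z.
Proof. intros [k [Kk Hk]] Ht. exists k. split; [exact Kk|lra]. Qed.

(* Boundedness is only required on the smaller neighbourhoods, which makes the class stable under
   differentiation. *)
Definition admits (K : C -> Prop) (r : R) (phi : C -> C) : Prop :=
  (forall z, nbhd K r z -> exists d, cderiv phi z d) /\
  forall t, t < r -> exists B, forall z, nbhd K t z -> Cmod (phi z) <= B.

Lemma admits_holo_ball (K : C -> Prop) (r t : R) (phi : C -> C) (z : C) : admits K r phi -> nbhd K t z ->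
  holo_ball phi z (r - t).
Proof.
  intros [H _] Hz u Hu. apply H. replace r with (t + (r - t)) by ring. eapply nbhd_shift; [exact Hz|lra].
Qed.

Definition taylor_coeff (n : nat) (phi : C -> C) (z : C) : C := (dern n phi z * / RtoC (INR (fact n)))%C.

Lemma taylor_coeff_bound (K : C -> Prop) (r t rho B : R) (n : nat) (phi : C -> C) (z : C) : admits K r phi ->
  0 < rho -> t + 2 * rho <= r -> (forall z, nbhd K (t + 2 * rho) z -> Cmod (phi z) <= B) -> nbhd K t z ->
  Cmod (taylor_coeff n phi z) <= B * (6 / rho) ^ n.
Proof.
  intros HA Hr Ht HB Hz. unfold taylor_coeff.
  rewrite Cmod_mult, Cmod_inv by apply INR_fact_neq.
  assert (Hf := INR_fact_lt_0 n). rewrite Cmod_R, Rabs_pos_eq by lra.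
  apply (Rmult_le_reg_r (INR (fact n))); [exact Hf|]. rewrite Rmult_assoc, Rinv_l, Rmult_1_r by lra.
  apply (dern_cauchy n phi z rho B Hr).
  - eapply holo_ball_sub; [apply (admits_holo_ball K r t phi z HA Hz)|].
    replace (z - z)%C with (RtoC 0) by ring. rewrite Cmod_0. lra.
  - intros u Hu. apply HB. eapply nbhd_shift; [exact Hz|lra].
  - replace (z - z)%C with (RtoC 0) by ring. rewrite Cmod_0. lra.
Qed.

Lemma admits_taylor_coeff (K : C -> Prop) (r : R) (n : nat) (phi : C -> C) : admits K r phi -> admits K r (taylor_coeff n phi).
Proof.
  intros HA. split.
  - intros z [k [Kk Hk]]. set (t := Cmod (z - k)%C) in *.
    assert (Hz : nbhd K ((t + r) / 2) z) by (exists k; split; [exact Kk|fold t; lra]).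
    pose proof (holo_ball_dern n _ _ _ (admits_holo_ball K r _ phi z HA Hz)) as H.
    destruct (H z) as [d Hd]; [replace (z - z)%C with (RtoC 0) by ring; rewrite Cmod_0; lra|].
    eexists. apply (cderiv_mult (dern n phi) (fun _ => / RtoC (INR (fact n)))%C _ _ _ Hd (cderiv_const _ z)).
  - intros t Ht. set (rho := (r - t) / 4). destruct (proj2 HA (t + 2 * rho)) as [B HB]; [unfold rho; lra|].
    exists (B * (6 / rho) ^ n). intros z Hz. apply (taylor_coeff_bound K r t rho B n phi z HA); try assumption; unfold rho; lra.
Qed.

(** Taylor expansion of phi(g + rr) in powers of [rr]. The hypothesis on g is used for every Taylor
    coefficient of phi in the role of psi, always with the same [A]. *)
Lemma rep_superposition_perturb (Lam : R -> Prop) (w : R -> R) (K : C -> Prop) (r A : R) (g rr phi : C -> C) :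
  good_weight Lam w -> 0 < r ->
  (forall psi M, admits K r psi -> (forall z, nbhd K (r / 4) z -> Cmod (psi z) <= M) -> rep Lam w (A * M) (fun s => psi (g s))) ->
  multiplier Lam w (r / 96) rr ->
  (forall s : C, 0 <= fst s -> nbhd K (r / 4) (g s)) ->
  admits K r phi -> exists K', rep Lam w K' (fun s => phi (g s + rr s)%C).
Proof.
  intros HG Hr Hg Hrr HV Hphi.
  destruct (proj2 Hphi (r / 4 + 2 * (r / 8))) as [B HB]; [lra|].
  (* Centres lie in the r/4-neighbourhood and the Cauchy estimate uses twice the radius r/8, so phi
     is bounded on the r/2-neighbourhood; r/96 is the size for which the ratio of the series is
     1/2. *)
  set (q := 6 / (r / 8)).
  assert (Hq : r / 96 * q = / 2) by (unfold q; field; lra).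
  assert (Hbd : forall n z, nbhd K (r / 4) z -> Cmod (taylor_coeff n phi z) <= B * q ^ n).
  { intros n z Hz. apply (taylor_coeff_bound K r (r / 4) (r / 8) B n phi z Hphi); try assumption; lra. }
  set (Kn := fun n => (r / 96) ^ n * (A * (B * q ^ n))).
  assert (EK : forall n, Kn n = A * B * (/ 2) ^ n).
  { intros n. unfold Kn. rewrite <- Hq, Rpow_mult_distr. ring. }
  assert (Hrep : forall n, rep Lam w (Kn n) (fun s => taylor_coeff n phi (g s) * rr s ^ n)%C).
  { intros n. apply (multiplier_pow Lam w (r / 96) rr n _ (fun s => taylor_coeff n phi (g s)) Hrr).
    apply Hg; [apply admits_taylor_coeff, Hphi|apply Hbd]. }
  assert (HAB : 0 <= A * B).
  { pose proof (rep_ge_0 _ _ _ _ (Hrep O)) as H. rewrite EK in H. simpl in H. lra. }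
  exists (A * B / (1 - / 2)).
  apply (rep_series Lam w Kn _ (fun n s => taylor_coeff n phi (g s) * rr s ^ n)%C _ HG Hrep).
  - intros N. apply geometric_sum_le; [exact HAB|lra|]. intros k. rewrite EK. lra.
  - intros s Hs eps Heps.
    assert (Hb := multiplier_bound Lam w _ rr s HG Hrr Hs). specialize (HV s Hs).
    assert (HB0 : 0 <= B) by (eapply Rle_trans; [apply Cmod_ge_0|apply (HB (g s)); eapply nbhd_mono; [exact HV|lra]]).
    destruct (pow_lt_1_zero (/ 2) ltac:(rewrite Rabs_pos_eq; lra) (eps / (B + 1))) as [N HN]; [apply Rdiv_lt_0_compat; lra|].
    exists N. intros n Hn. specialize (HN n Hn). rewrite Rabs_pos_eq in HN by (apply pow_le; lra).
    pose proof (taylor_bound n phi (g s) (rr s) (r / 8) B ltac:(lra)) as HT.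
    assert (HTb : Cmod (phi (g s + rr s) - tay n phi (g s) (rr s))%C <= B * (6 * Cmod (rr s) / (r / 8)) ^ n).
    { apply HT.
      - intros u Hu. apply Hphi. apply (nbhd_mono K (r / 4 + 2 * (r / 8))); [eapply nbhd_shift; [exact HV|lra]|lra].
      - intros u Hu. apply HB. eapply nbhd_shift; [exact HV|lra].
      - lra. }
    change (csum (fun k => taylor_coeff k phi (g s) * rr s ^ k)%C n) with (tay n phi (g s) (rr s)).
    replace (tay n phi (g s) (rr s) - phi (g s + rr s))%C with (- (phi (g s + rr s) - tay n phi (g s) (rr s)))%C by ring.
    rewrite Cmod_opp. eapply Rle_lt_trans; [exact HTb|].
    assert (Hp : (6 * Cmod (rr s) / (r / 8)) ^ n <= (/ 2) ^ n).
    { apply pow_incr. pose proof (Cmod_ge_0 (rr s)). split; [apply Rdiv_le_0_compat; lra|].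
      apply (Rmult_le_reg_r (r / 8)); [lra|]. unfold Rdiv at 1. rewrite Rmult_assoc, Rinv_l by lra. lra. }
    apply (Rmult_lt_compat_r (B + 1)) in HN; [|lra]. unfold Rdiv in HN. rewrite Rmult_assoc, Rinv_l in HN by lra.
    assert (0 <= (/ 2) ^ n) by (apply pow_le; lra). nra.
Qed.

Lemma multiplier_poly (Lam : R -> Prop) (w : R -> R) (b : R -> C) (l : list R) (kappa : R) : good_weight Lam w ->
  List.Forall Lam l -> wsum w b l <= kappa -> multiplier Lam w kappa (fun s => lsum (dterm b s) l).
Proof.
  intros HG Hl Hk K g Hg. apply (rep_mono _ _ (wsum w b l * K)).
  - apply rep_mul_poly; assumption.
  - apply Rmult_le_compat_r; [eapply rep_ge_0; exact Hg|exact Hk].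
Qed.

(** * Finite sums: holomorphy, translation, values left of the axis *)

Lemma cderiv_poly (b : R -> C) (l : list R) (s : C) : exists d, cderiv (fun s => lsum (dterm b s) l) s d.
Proof.
  induction l as [|x l [d Hd]].
  - exists 0%C. exact (cderiv_const 0%C s).
  - eexists. apply (cderiv_plus (fun s => dterm b s x) (fun s => lsum (dterm b s) l)); [|exact Hd].
    apply (cderiv_mult (fun _ => b x) (fun s => cexp (RtoC (- x) * s))%C); [apply cderiv_const|].
    apply (cderiv_comp cexp (fun s => RtoC (- x) * s)%C); [apply cderiv_cexp|].
    apply (cderiv_ext_loc (fun s => 0 + RtoC (- x) * s)%C _ _ _ 1); [lra|intros; ring|apply cderiv_lin].
Qed.

(** Translation by x carried out on the coefficients ([dterm_damp]): all translates are sums over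
    the same exponents and can be compared in norm. *)
Definition damp (a : R -> C) (x : R) (l : R) : C := (RtoC (exp (- (l * x))) * a l)%C.

Lemma dterm_damp (a : R -> C) (x : R) (s : C) (l : R) : dterm (damp a x) s l = dterm a (s + RtoC x)%C l.
Proof.
  unfold dterm, damp. replace (RtoC (- l) * (s + RtoC x))%C with (RtoC (- (l * x)) + RtoC (- l) * s)%C
    by (replace (- (l * x)) with (- l * x) by ring; rewrite RtoC_mult; ring).
  rewrite cexp_plus. rewrite (cexp_polar (RtoC (- (l * x)))). simpl.
  unfold cis. rewrite cos_0, sin_0. change ((1, 0) : C) with (RtoC 1). ring.
Qed.

Lemma exp_opp_diff (u v : R) : 0 <= u <= v -> Rabs (exp (- u) - exp (- v)) <= v - u.
Proof.
  intros H. assert (E : exp (- v) = exp (- u) * exp (- (v - u))) by (rewrite <- exp_plus; f_equal; ring).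
  assert (H1 : 0 < exp (- u) <= 1).
  { split; [apply exp_pos|]. rewrite <- exp_0. destruct (Req_dec u 0) as [->|]; [rewrite Ropp_0; lra|].
    left; apply exp_increasing; lra. }
  assert (H2 : 1 - (v - u) <= exp (- (v - u)) <= 1).
  { split.
    - destruct (Req_dec (- (v - u)) 0) as [E0|E0]; [rewrite E0, exp_0; lra|]. pose proof (exp_ineq1 _ E0). lra.
    - rewrite <- exp_0. destruct (Req_dec (- (v - u)) 0) as [->|]; [lra|]. left; apply exp_increasing; lra. }
  rewrite E. apply Rabs_le. nra.
Qed.

(** The map x -> e^(-v x) is Lipschitz with constant v, so the step [eta] is the same at every x;
    this is what makes the later descent finite. *)
Lemma damp_modulus (Lam : R -> Prop) (w : R -> R) (a : R -> C) (l : list R) (kappa : R) : good_weight Lam w ->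
  List.Forall Lam l -> 0 < kappa ->
  exists eta, 0 < eta /\ forall x y, 0 <= x <= y -> y <= x + eta -> wsum w (fun v => damp a x v - damp a y v)%C l <= kappa.
Proof.
  intros HG Hl Hk.
  set (D := Rsum_list (fun v => Cmod (a v) * w v * v) l).
  assert (Hl' := Hl). rewrite Forall_forall in Hl'.
  assert (HD : 0 <= D).
  { apply Rsum_list_nonneg. intros v Hv. apply Rmult_le_pos; [apply Rmult_le_pos|].
    - apply Cmod_ge_0.
    - eapply good_weight_pos; eauto.
    - apply HG, Hl', Hv. }
  exists (kappa / (D + 1)). split; [apply Rdiv_lt_0_compat; lra|]. intros x y Hx Hy.
  apply Rle_trans with (kappa / (D + 1) * D).
  - apply Rle_trans with (Rsum_list (fun v => kappa / (D + 1) * (Cmod (a v) * w v * v)) l);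
      [|rewrite Rsum_list_scal; apply Rle_refl].
    apply Rsum_list_le. intros v Hv.
    assert (Hv0 : 0 <= v) by (apply HG, Hl', Hv).
    assert (Hw : 0 <= w v) by (eapply good_weight_pos; eauto).
    unfold damp. replace (RtoC (exp (- (v * x))) * a v - RtoC (exp (- (v * y))) * a v)%C with
      (RtoC (exp (- (v * x)) - exp (- (v * y))) * a v)%C by (rewrite RtoC_minus; ring).
    rewrite Cmod_mult, Cmod_R.
    assert (HE : Rabs (exp (- (v * x)) - exp (- (v * y))) <= v * (kappa / (D + 1))).
    { eapply Rle_trans; [apply exp_opp_diff; nra|]. nra. }
    assert (0 <= Cmod (a v) * w v) by (apply Rmult_le_pos; [apply Cmod_ge_0|exact Hw]).
    apply Rle_trans with (v * (kappa / (D + 1)) * (Cmod (a v) * w v)); [|apply Req_le; ring].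
    rewrite Rmult_assoc. apply Rmult_le_compat_r; assumption.
  - apply (Rmult_le_reg_r (D + 1)); [lra|]. replace (kappa / (D + 1) * D * (D + 1)) with (kappa * D) by (field; lra). nra.
Qed.

(** The limit of [damp a x] as x tends to infinity: only the exponent 0 survives. *)
Definition const_part (a : R -> C) (x : R) : C := if Req_dec_T x 0 then a x else 0%C.

Lemma damp_limit (Lam : R -> Prop) (w : R -> R) (a : R -> C) (l : list R) : good_weight Lam w ->
  List.Forall Lam l -> forall kappa, 0 < kappa ->
  exists X, 0 <= X /\ forall x, X <= x -> wsum w (fun v => damp a x v - const_part a v)%C l <= kappa.
Proof.
  intros HG Hl. induction l as [|v l IH]; intros kappa Hk; [exists 0; split; [lra|]; intros; simpl; unfold wsum; simpl; lra|].
  inversion Hl as [|? ? Hv Hl']; subst. destruct (IH Hl' (kappa / 2)) as [X1 [HX1 H1]]; [lra|].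
  assert (Hv0 : 0 <= v) by (apply HG, Hv). assert (Hw : 1 <= w v) by (apply HG, Hv).
  destruct (Req_dec v 0) as [->|Hn].
  - exists X1. split; [exact HX1|]. intros x Hx. specialize (H1 x Hx). unfold wsum in *. simpl.
    unfold damp at 1, const_part at 1. destruct (Req_dec_T 0 0) as [_|]; [|lra].
    rewrite Rmult_0_l, Ropp_0, exp_0. replace (1 * a 0 - a 0)%C with (RtoC 0) by ring. rewrite Cmod_0. lra.
  - set (D := Cmod (a v) * w v).
    assert (HD : 0 <= D) by (apply Rmult_le_pos; [apply Cmod_ge_0|lra]).
    (* From x >= X2 on, (1 + v x) kappa/2 is at least D, and e^(v x) >= 1 + v x. *)
    set (X2 := 2 * D / (kappa * v)).
    assert (HX2 : 0 <= X2) by (apply Rdiv_le_0_compat; [lra|nra]).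
    exists (X1 + X2). split; [lra|]. intros x Hx. specialize (H1 x ltac:(lra)). unfold wsum in *. simpl.
    unfold damp at 1, const_part at 1. destruct (Req_dec_T v 0) as [|_]; [lra|].
    replace (RtoC (exp (- (v * x))) * a v - 0)%C with (RtoC (exp (- (v * x))) * a v)%C by ring.
    rewrite Cmod_mult, Cmod_R, Rabs_pos_eq by (left; apply exp_pos). rewrite Rmult_assoc. fold D.
    assert (HE : exp (- (v * x)) * D <= kappa / 2).
    { apply (Rmult_le_reg_l (exp (v * x))); [apply exp_pos|].
      rewrite <- Rmult_assoc, <- exp_plus. replace (v * x + - (v * x)) with 0 by ring. rewrite exp_0, Rmult_1_l.
      apply Rle_trans with ((1 + v * x) * (kappa / 2)).
      - assert (HX : X2 * (kappa * v) = 2 * D) by (unfold X2; field; lra).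
        assert (X2 <= x) by lra. assert (0 < kappa * v) by nra. nra.
      - apply Rmult_le_compat_r; [lra|].
        destruct (Req_dec (v * x) 0) as [E0|E0]; [rewrite E0, exp_0; lra|]. pose proof (exp_ineq1 _ E0). lra. }
    lra.
Qed.

Lemma poly_left_extension (Lam : R -> Prop) (a : R -> C) (l : list R) : (forall x, Lam x -> 0 <= x) -> List.Forall Lam l ->
  forall e, 0 < e -> exists de, 0 < de /\ forall t, 0 <= t <= de -> Rsum_list (fun v => Cmod (a v) * (exp (v * t) - 1)) l <= e.
Proof.
  intros HS Hl. induction l as [|v l IH]; intros e He; [exists 1; split; [lra|]; intros; simpl; lra|].
  inversion Hl as [|? ? Hv Hl']; subst. destruct (IH Hl' (e / 2)) as [d1 [Hd1 H1]]; [lra|].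
  assert (Hm := Cmod_ge_0 (a v)). specialize (HS v Hv).
  destruct (derivable_continuous exp derivable_exp 0 (e / 2 / (Cmod (a v) + 1))) as [d2 [Hd2 H2]].
  { apply Rdiv_lt_0_compat; lra. }
  exists (Rmin d1 (d2 / 2 / (v + 1))). split; [apply Rmin_pos; [lra|apply Rdiv_lt_0_compat; lra]|].
  intros t Ht. assert (T1 := Rmin_l d1 (d2 / 2 / (v + 1))). assert (T2 := Rmin_r d1 (d2 / 2 / (v + 1))).
  specialize (H1 t ltac:(lra)). simpl.
  assert (Hvt : (v + 1) * t <= d2 / 2).
  { apply Rle_trans with ((v + 1) * (d2 / 2 / (v + 1))); [apply Rmult_le_compat_l; lra|]. right. field. lra. }
  assert (HE : exp (v * t) - 1 <= e / 2 / (Cmod (a v) + 1)).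
  { destruct (Req_dec (v * t) 0) as [->|Hn].
    - rewrite exp_0. assert (0 < e / 2 / (Cmod (a v) + 1)) by (apply Rdiv_lt_0_compat; lra). lra.
    - apply Rle_trans with (Rabs (exp (v * t) - exp 0)); [rewrite exp_0; apply Rle_abs|]. left. apply H2. split.
      + split; [exact I|auto].
      + simpl. unfold Rdist. rewrite Rminus_0_r, Rabs_pos_eq by nra. nra. }
  assert (Cmod (a v) * (exp (v * t) - 1) <= e / 2); [|lra].
  apply Rle_trans with (Cmod (a v) * (e / 2 / (Cmod (a v) + 1))); [apply Rmult_le_compat_l; assumption|].
  apply (Rmult_le_reg_r (Cmod (a v) + 1)); [lra|].
  replace (Cmod (a v) * (e / 2 / (Cmod (a v) + 1)) * (Cmod (a v) + 1)) with (Cmod (a v) * (e / 2)) by (field; lra). nra.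
Qed.

(** For Re s >= -de, |e^(-v s)| (1 - e^(-v de)) <= e^(v de) - 1. Values slightly left of the axis
    are thus compared with values to its right, uniformly in s. *)
Lemma poly_shift_bound (Lam : R -> Prop) (a : R -> C) (l : list R) (s : C) (de : R) : (forall x, Lam x -> 0 <= x) -> List.Forall Lam l ->
  0 <= de -> - de <= fst s ->
  Cmod (lsum (dterm a s) l - lsum (dterm a (s + RtoC de)%C) l)%C <= Rsum_list (fun v => Cmod (a v) * (exp (v * de) - 1)) l.
Proof.
  intros HS Hl Hde Hs.
  replace (lsum (dterm a s) l - lsum (dterm a (s + RtoC de)%C) l)%C with
    (lsum (fun v => dterm a s v + - (1) * dterm a (s + RtoC de)%C v)%C l) by (rewrite lsum_plus, lsum_scal; ring).
  eapply Rle_trans; [apply Cmod_lsum_le|]. apply Rsum_list_le. intros v Hv.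
  rewrite Forall_forall in Hl. specialize (HS v (Hl v Hv)).
  rewrite <- dterm_damp. unfold dterm, damp.
  replace (a v * cexp (RtoC (- v) * s) + - (1) * (RtoC (exp (- (v * de))) * a v * cexp (RtoC (- v) * s)))%C with
    (a v * (cexp (RtoC (- v) * s) * RtoC (1 - exp (- (v * de)))))%C by (rewrite RtoC_minus; ring).
  rewrite !Cmod_mult. apply Rmult_le_compat_l; [apply Cmod_ge_0|].
  rewrite Cmod_cexp, Cmod_R. simpl. replace (- v * fst s - 0 * snd s) with (- v * fst s) by ring.
  assert (H1 : exp (- (v * de)) <= 1).
  { rewrite <- exp_0. destruct (Req_dec (- (v * de)) 0) as [->|]; [lra|]. left; apply exp_increasing. nra. }
  rewrite Rabs_pos_eq by lra.
  assert (H2 : exp (- v * fst s) <= exp (v * de)).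
  { destruct (Req_dec (- v * fst s) (v * de)) as [->|]; [lra|]. left; apply exp_increasing. nra. }
  apply Rle_trans with (exp (v * de) * (1 - exp (- (v * de)))); [apply Rmult_le_compat_r; lra|].
  rewrite Rmult_minus_distr_l, <- exp_plus. replace (v * de + - (v * de)) with 0 by ring. rewrite exp_0. lra.
Qed.

(* Continuation in x from the constant P(+oo) down to P(s + 0): each step is a small perturbation,
   and the a priori bound keeps the step size uniform. *)
Lemma rep_superposition_poly (Lam : R -> Prop) (w : R -> R) (K : C -> Prop) (r de : R) (a : R -> C) (l : list R) :
  add_semigroup0 Lam -> admissible Lam w -> List.Forall Lam l -> 0 < r -> 0 < de ->
  (forall s : C, - de < fst s -> nbhd K (r / 8) (lsum (dterm a s) l)) ->
  exists A, forall psi M, admits K r psi -> (forall z, nbhd K (r / 4) z -> Cmod (psi z) <= M) ->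
    rep (gen l) w (A * M) (fun s => psi (lsum (dterm a s) l)).
Proof.
  intros HS Hadm Hl Hr Hde HV.
  assert (HG0 : good_weight Lam w) by (split; [exact HS|split; apply Hadm]).
  assert (HG : good_weight (gen l) w) by (apply (gen_good_weight Lam); assumption).
  assert (Hgl : List.Forall (gen l) l) by (apply Forall_forall; intros x Hx; apply gen_In, Hx).
  destruct (rep_a_priori Lam w l de HS Hadm Hl Hde) as [A [HA0 HA]].
  set (P := fun b s => lsum (dterm b s) l).
  (* The qualitative statement that propagates along the chain; its bound K' may depend on psi. *)
  set (E := fun b => forall psi, admits K r psi -> exists K', rep (gen l) w K' (fun s => psi (P b s))).
  assert (EPx : forall x s, P (damp a x) s = P a (s + RtoC x)%C).
  { intros x s. apply lsum_ext. intros v _. apply dterm_damp. }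
  (* The a priori bound restores uniformity after each step, with the same [A] for all translates,
     since for x >= 0 they take their values from the same half-plane. *)
  assert (Hstrong : forall x, 0 <= x -> E (damp a x) -> forall psi M, admits K r psi ->
     (forall z, nbhd K (r / 4) z -> Cmod (psi z) <= M) -> rep (gen l) w (A * M) (fun s => psi (P (damp a x) s))).
  { intros x Hx HE psi M Hpsi HM. destruct (HE psi Hpsi) as [K' HK'].
    assert (Hin : forall s : C, - de < fst s -> nbhd K (r / 8) (P (damp a x) s)).
    { intros s Hs. rewrite EPx. apply HV. simpl. lra. }
    apply (HA K' M _ HK').
    - intros s Hs. destruct (cderiv_poly (damp a x) l s) as [d Hd].
      destruct (proj1 Hpsi (P (damp a x) s)) as [d' Hd']; [eapply nbhd_mono; [apply Hin, Hs|lra]|].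
      eexists. apply (cderiv_comp psi (P (damp a x)) s d' d Hd' Hd).
    - intros s Hs. apply HM. eapply nbhd_mono; [apply Hin, Hs|lra]. }
  assert (Hdiff : forall b b' s, P b' s = (P b s + P (fun v => b' v - b v)%C s)%C).
  { intros b b' s. unfold P. rewrite <- lsum_plus. apply lsum_ext. intros v _. unfold dterm. ring. }
  (* Uniform control at b yields only the qualitative statement at a nearby b'; alternating with
     [Hstrong] keeps the admissible step at r/96. *)
  assert (Hstep : forall b b' A', (forall psi M, admits K r psi ->
       (forall z, nbhd K (r / 4) z -> Cmod (psi z) <= M) -> rep (gen l) w (A' * M) (fun s => psi (P b s))) ->
     (forall s : C, 0 <= fst s -> nbhd K (r / 4) (P b s)) ->
     wsum w (fun v => b' v - b v)%C l <= r / 96 -> E b').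
  { intros b b' A' Hb Hin Hw psi Hpsi.
    destruct (rep_superposition_perturb (gen l) w K r A' (P b) (P (fun v => b' v - b v)%C) psi HG Hr Hb) as [K' HK'];
      [apply multiplier_poly; assumption|exact Hin|exact Hpsi|].
    exists K'. apply (rep_ext _ _ _ (fun s => psi (P b s + P (fun v => b' v - b v)%C s)%C)); [|exact HK'].
    intros s _. rewrite <- Hdiff. reflexivity. }
  destruct (damp_limit (gen l) w a l HG Hgl (r / 96)) as [X [HX0 HX]]; [lra|].
  destruct (damp_modulus (gen l) w a l (r / 96) HG Hgl) as [eta [Heta Hmod]]; [lra|].
  assert (Hconst : forall s, P (const_part a) s = P (const_part a) 0%C).
  { intros s. apply lsum_ext. intros v _. unfold dterm, const_part. destruct (Req_dec_T v 0) as [->|]; [|ring].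
    rewrite Ropp_0. replace (0 * s)%C with (0 * 0)%C by ring. reflexivity. }
  assert (Hbase : forall x, X <= x -> E (damp a x)).
  { intros x Hx.
    assert (Hp0 : forall s : C, nbhd K (r / 4) (P (const_part a) s)).
    { intros s. rewrite Hconst.
      assert (Hin : nbhd K (r / 8) (P (damp a x) 0%C)) by (rewrite EPx; apply HV; simpl; lra).
      apply (nbhd_mono K (r / 8 + r / 96)); [|lra]. eapply nbhd_shift; [exact Hin|].
      rewrite (Hdiff (const_part a) (damp a x)).
      set (p0 := P (const_part a) 0%C). set (p1 := P (fun v => damp a x v - const_part a v)%C 0%C).
      replace (p0 - (p0 + p1))%C with (- p1)%C by ring. rewrite Cmod_opp.
      eapply Rle_trans; [apply (lsum_term_le (gen l) w); [exact HG|simpl; lra|exact Hgl]|]. apply HX, Hx. }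
    (* At the constant limit psi(P) is a constant function, so uniform control holds with A' = 1. *)
    apply (Hstep (const_part a) (damp a x) 1); [|intros s _; apply Hp0|apply HX, Hx].
    intros psi M Hpsi HM. apply (rep_mono _ _ (Cmod (psi (P (const_part a) 0%C)))).
    - apply (rep_ext _ _ _ (fun _ => psi (P (const_part a) 0%C))); [intros s _; rewrite (Hconst s); reflexivity|].
      apply rep_const, HG.
    - rewrite Rmult_1_l. apply HM, Hp0. }
  (* Here k counts the steps of length [eta] still separating x from the region x >= X where the
     base case applies. *)
  assert (Hchain : forall k x, 0 <= x -> X <= x + INR k * eta -> E (damp a x)).
  { induction k; intros x Hx HXk; [apply Hbase; simpl in HXk; lra|].
    assert (HE : E (damp a (x + eta))) by (apply IHk; [lra|rewrite S_INR in HXk; lra]).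
    apply (Hstep (damp a (x + eta)) (damp a x) A).
    - apply Hstrong; [lra|exact HE].
    - intros s Hs. rewrite EPx. eapply nbhd_mono; [apply HV; simpl; lra|lra].
    - apply Hmod; lra. }
  destruct (INR_unbounded (X / eta)) as [k Hk].
  assert (HE0 : E (damp a 0)).
  { apply (Hchain k 0); [lra|]. apply (Rmult_lt_compat_r eta) in Hk; [|exact Heta].
    unfold Rdiv in Hk. rewrite Rmult_assoc, Rinv_l in Hk by lra. lra. }
  exists A. intros psi M Hpsi HM.
  apply (rep_ext _ _ _ (fun s => psi (P (damp a 0) s))); [|apply Hstrong; try assumption; lra].
  intros s _. rewrite EPx. replace (s + 0)%C with s by ring. reflexivity.
Qed.

Theorem theorem3 (Lam : R -> Prop) (G : Cx -> Prop) (f : Cx -> Cx) (w : R -> R) (a : R -> Cx) :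
  add_semigroup0 Lam ->
  Cregion G ->
  holomorphic_on G f ->
  admissible Lam w ->
  in_Aw Lam w a ->
  (forall z, in_closure_tilde_H Lam a z -> G z) ->
  exists c : R -> Cx, in_Aw Lam w c /\
    forall s, 0 <= Cre s -> forall z, tilde_is Lam a s z -> tilde_is Lam c s (f z).
Proof.
  intros HS [HGo _] Hf Hadm [Ka HKa] HKG.
  assert (HG : good_weight Lam w) by (split; [exact HS|split; apply Hadm]).
  assert (Ha : norm_le Lam w a Ka) by exact HKa.
  set (K := in_closure_tilde_H Lam a : C -> Prop).
  assert (HKE : forall z, K z <-> forall eps, 0 < eps -> exists s y : C, 0 < fst s /\ hsum Lam (dterm a s) y /\ Cmod (y - z)%C < eps)
    by (intros; apply iff_refl).
  assert (HfC : forall z, G z -> exists d, cderiv f z d) by exact Hf.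
  (* The values of the transform are bounded by [Ka], and points of the closure lie within 1 of such
     values; closedness holds because K is a closure. *)
  destruct (compact_neighbourhood K G f (Ka + 1)) as [r [M [Hr HrM]]].
  { intros z Hz. destruct (proj1 (HKE z) Hz 1 Rlt_0_1) as [s [y [Hs [Hy Hyz]]]].
    assert (Hyb : Cmod (y - lsum (dterm a s) nil)%C <= Ka).
    { apply (hsum_tail Lam w a s y nil Ka HG); [lra|split; constructor| |exact Hy]. intros l Hl _. apply Ha, Hl. }
    replace (y - lsum (dterm a s) nil)%C with y in Hyb by (unfold lsum; simpl; change (y = (y - 0)%C); ring).
    replace z with (y + - (y - z))%C by ring. eapply Rle_trans; [apply Cmod_triangle|]. rewrite Cmod_opp. lra. }
  { intros z Hz. apply HKE. intros eps Heps. destruct (Hz (eps / 2)) as [k [Kk Hk]]; [lra|].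
    destruct (proj1 (HKE k) Kk (eps / 2)) as [s [y [Hs [Hy Hyk]]]]; [lra|].
    exists s, y. split; [exact Hs|split; [exact Hy|]].
    replace (y - z)%C with ((y - k) + (k - z))%C by ring. eapply Rle_lt_trans; [apply Cmod_triangle|]. lra. }
  { intros z Hz. apply HGo, HKG, Hz. }
  { intros z Hz. destruct (HfC z (HKG z Hz)) as [d Hd]. eapply cderiv_ccts; eauto. }
  assert (Hfadm : admits K r f).
  { split.
    - intros z [k [Kk Hk]]. apply HfC. apply (HrM z k Kk Hk).
    - intros t Ht. exists M. intros z [k [Kk Hk]]. apply (HrM z k Kk). lra. }
  destruct (split_series Lam w a Ka (r / 96) HG Ha) as [l0 [Q [Hl0 [HQ [HQn HQs]]]]]; [lra|].
  (* The sum of the remainder at each s, so that P + rr is the full transform on the closed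
     half-plane. *)
  set (rr := fun s : C => epsilon (inhabits (RtoC 0)) (fun S => cv (csum (fun j => lsum (dterm a s) (Q j))) S /\
      hsum Lam (dterm a s) (lsum (dterm a s) l0 + S)%C)).
  assert (Hrr : forall s : C, 0 <= fst s -> cv (csum (fun j => lsum (dterm a s) (Q j))) (rr s) /\
      hsum Lam (dterm a s) (lsum (dterm a s) l0 + rr s)%C).
  { intros s Hs. unfold rr. apply epsilon_spec. apply HQs, Hs. }
  assert (Hmul : multiplier Lam w (r / 96) rr).
  { apply (multiplier_series Lam w a Q); try assumption. intros s Hs. apply Hrr, Hs. }
  destruct (poly_left_extension Lam a l0 (proj1 HS) (proj2 Hl0) (r / 96)) as [de [Hde Hext]]; [lra|].
  (* P(s) is compared with the full transform at s + de, which lies in the open half-plane: the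
     shift costs at most r/96 and the remainder at most r/96, together less than r/8. *)
  assert (HV : forall s : C, - de < fst s -> nbhd K (r / 8) (lsum (dterm a s) l0)).
  { intros s Hs. set (s' := (s + RtoC de)%C). assert (Hs' : 0 < fst s') by (unfold s'; simpl; lra).
    assert (HKs : K (lsum (dterm a s') l0 + rr s')%C).
    { apply HKE. intros eps Heps. exists s', (lsum (dterm a s') l0 + rr s')%C. split; [exact Hs'|split; [apply Hrr; lra|]].
      set (u := (lsum (dterm a s') l0 + rr s')%C). replace (u - u)%C with (RtoC 0) by ring. rewrite Cmod_0. exact Heps. }
    exists (lsum (dterm a s') l0 + rr s')%C. split; [exact HKs|].
    pose proof (poly_shift_bound Lam a l0 s de (proj1 HS) (proj2 Hl0) ltac:(lra) ltac:(lra)) as H1.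
    specialize (Hext de ltac:(lra)). fold s' in H1.
    pose proof (multiplier_bound Lam w _ rr s' HG Hmul ltac:(lra)) as H2.
    replace (lsum (dterm a s) l0 - (lsum (dterm a s') l0 + rr s'))%C with
      ((lsum (dterm a s) l0 - lsum (dterm a s') l0) + - rr s')%C by ring.
    eapply Rle_lt_trans; [apply Cmod_triangle|]. rewrite Cmod_opp. lra. }
  destruct (rep_superposition_poly Lam w K r de a l0 HS Hadm (proj2 Hl0) Hr Hde HV) as [A HA].
  destruct (rep_superposition_perturb Lam w K r A (fun s => lsum (dterm a s) l0) rr f HG Hr) as [K' [c [Hc Hcs]]].
  { intros psi M' Hpsi HM'. apply (rep_subsemigroup (gen l0)); [apply gen_sub; [exact HS|apply Hl0]|].
    apply HA; assumption. }
  { exact Hmul. }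
  { intros s Hs. eapply nbhd_mono; [apply HV; lra|lra]. }
  { exact Hfadm. }
  exists c. split; [exists K'; exact Hc|].
  intros s Hs z Hz.
  (* The transform is a relation in the statement; uniqueness of unordered sums identifies z with P
     + rr. *)
  assert (Ez : z = (lsum (dterm a s) l0 + rr s)%C).
  { apply (hsum_unique Lam (dterm a s)); [exact Hz|apply Hrr, Hs]. }
  rewrite Ez. apply Hcs, Hs.
Qed.
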